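(* Let $F_{X,Y}$ be any fixed continuous distribution function such that $Y$ is not a measurable function of $X$ almost surely. Then, as $n\to\infty$, $$\frac{\xi_n^*-\mathrm E[\xi_n^*]}{\sqrt{\operatorname{Var}[\xi_n^*]}}\longrightarrow N(0,1)\quad\text{in distribution},$$ and, when $d=1$, $$\frac{\overline\xi_n^*-\mathrm E[\overline\xi_n^*]}{\sqrt{\operatorname{Var}[\overline\xi_n^*]}}\longrightarrow N(0,1)\quad\text{in distribution}.$$
   Context: $Y$ is a real random variable and $X$ is a random vector in $\mathbb{R}^d$, defined on the same probability space, with joint distribution function $F_{X,Y}$, which is fixed (not depending on $n$) and continuous; $F_Y$ is the distribution function of $Y$. $(X_1,Y_1),\ldots,(X_n,Y_n)$ are $n$ independent copies of $(X,Y)$. $N_1(i)$ is the index of the nearest neighbor of $X_i$ among $\{X_j\}_{j\neq i}$ in the Euclidean metric. When $d=1$, $\overline{N}_1(i)$ is the index of the right nearest neighbor of $X_i$ (the closest sample point larger than $X_i$), with $\overline{N}_1(i):=i$ if $X_i$ is the largest. For $t\in\mathbb R$, $G_X(t):=\mathrm P(Y\ge t\mid X)$ and $h(t):=\mathrm E[G_X^2(t)]$. Define $$\xi_n^*:=\frac{6n}{n^2-1}\Big(\sum_{i=1}^n\min\{F_Y(Y_i),F_Y(Y_{N_1(i)})\}+\sum_{i=1}^nh(Y_i)\Big),$$ $$\overline\xi_n^*:=\frac{6n}{n^2-1}\Big(\sum_{i=1}^n\min\{F_Y(Y_i),F_Y(Y_{\overline N_1(i)})\}+\sum_{i=1}^nh(Y_i)\Big)\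 (d=1).$$ *)

(* Defs.v *)
From HB Require Import structures.
From mathcomp Require Import all_boot all_order all_algebra finmap.
From mathcomp Require Import all_classical all_reals all_analysis.

Set Implicit Arguments.
Unset Strict Implicit.
Unset Printing Implicit Defensive.

Import Order.TTheory GRing.Theory Num.Theory.
Import numFieldNormedType.Exports.

Local Open Scope classical_set_scope.
Local Open Scope ring_scope.

(* Points of R^d are [d.-tuple R], which carries the product (Borel)
   sigma-algebra; ['rV[R]_d] is used when the topology of R^d is needed. *)

Section Probability.
Context {dT : measure_display} {T : measurableType dT} {R : realType}.
Variable P : probability T R.

Definition mutually_independent (dU : measure_display) (U : measurableType dU)
    (Z : nat -> T -> U) : Prop :=
  forall (J : {fset nat}) (B : nat -> set U),
    (forall i, measurable (B i)) ->
    P (\bigcap_(i in [set` J]) (Z i @^-1` B i)) =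
    (\prod_(i <- J) P (Z i @^-1` B i))%E.

Definition identically_distributed (dU : measure_display)
    (U : measurableType dU) (Z Z' : T -> U) : Prop :=
  forall B : set U, measurable B -> P (Z @^-1` B) = P (Z' @^-1` B).

(* [g] is a version of P(A | X): it is sigma(X)-measurable, integrable, and has
   the right integral over every event of sigma(X). *)
Definition is_cond_prob (dU : measure_display) (U : measurableType dU)
    (X : T -> U) (A : set T) (g : T -> R) : Prop :=
  [/\ forall B : set R, measurable B ->
        preimage_set_system setT X measurable (g @^-1` B),
      P.-integrable setT (EFin \o g) &
      forall C : set U, measurable C ->
        (\int[P]_(w in X @^-1` C) (g w)%:E = P (A `&` X @^-1` C))%E].

Definition is_ae_measurable_function_of (dU : measure_display)
    (U : measurableType dU) (Y : T -> R) (X : T -> U) : Prop :=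
  exists2 f : U -> R, measurable_fun setT f & {ae P, forall w, Y w = f (X w)}.

Definition joint_cdf (d : nat) (X : T -> d.-tuple R) (Y : T -> R)
    (p : 'rV[R]_d * R) : R :=
  fine (P [set w | (forall k : 'I_d, tnth (X w) k <= p.1 ord0 k) /\ Y w <= p.2]).

Definition cvg_in_distribution (Z : nat -> T -> R)
    (mu : probability (measurableTypeR R) R) : Prop :=
  (forall n, measurable_fun setT (Z n)) /\
  forall t : R, {for t, continuous (fun s : R => mu `]-oo, s]%classic)} ->
    P [set w | Z n w <= t] @[n --> \oo] --> mu `]-oo, t]%classic.

Definition standardize (Z : T -> R) (w : T) : R :=
  (Z w - fine ('E_P[Z])%E) / Num.sqrt (fine ('V_P[Z])%E).

End Probability.

Section Neighbors.
Context {R : realType} {d : nat}.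

(* The library norm on ['rV[R]_d] is the sup norm. *)
Definition eucl_dist (x y : d.-tuple R) : R :=
  Num.sqrt (\sum_(k < d) (tnth x k - tnth y k) ^+ 2).

(* [pick] returns the first solution in the enumeration of ['I_n], so a tie is
   resolved in favour of the smallest index.  The default value [i] is only used
   when n = 1. *)
Definition nearest_neighbor (n : nat) (x : 'I_n -> d.-tuple R) (i : 'I_n) :
    'I_n :=
  odflt i [pick j | (j != i) &&
    [forall k, (k != i) ==> (eucl_dist (x i) (x j) <= eucl_dist (x i) (x k))]].

(* Meant for d = 1, where the first coordinate [x`_0] of a point [x] is the
   point itself. *)
Definition right_nearest_neighbor (n : nat) (x : 'I_n -> d.-tuple R)
    (i : 'I_n) : 'I_n :=
  odflt i [pick j | ((x i)`_0 < (x j)`_0) &&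
    [forall k, ((x i)`_0 < (x k)`_0) ==> ((x j)`_0 <= (x k)`_0)]].

End Neighbors.

Section Statistic.
Context {dT : measure_display} {T : measurableType dT} {R : realType}.
Variables (P : probability T R) (d : nat).

(* [neighbor] is one of the two rules above; [G t] is a version of
   P(Y >= t | X).  The sample of size n is (Xs 0, Ys 0), ..., (Xs n.-1, Ys n.-1). *)
Definition xi_star
    (neighbor : forall n : nat, ('I_n -> d.-tuple R) -> 'I_n -> 'I_n)
    (Y : {RV P >-> R}) (G : R -> T -> R)
    (Xs : nat -> {RV P >-> d.-tuple R}) (Ys : nat -> {RV P >-> R})
    (n : nat) (w : T) : R :=
  let F (t : R) : R := fine (cdf Y t) in
  let h (t : R) : R := fine ('E_P[fun u => (G t u ^+ 2)%R])%E in
  let N : 'I_n -> 'I_n := neighbor n (fun i => Xs i w) in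
  (6 * n%:R) / (n%:R ^+ 2 - 1) *
  (\sum_(i < n) Num.min (F (Ys i w)) (F (Ys (N i) w)) +
   \sum_(i < n) h (Ys i w)).

End Statistic.

(* Main.v *)
Require Import Defs.
From HB Require Import structures.
From mathcomp Require Import all_boot all_order all_algebra finmap.
From mathcomp Require Import all_classical all_reals all_analysis.
From mathcomp Require Import measurable_realfun ring lra zify.

Set Implicit Arguments.
Unset Strict Implicit.
Unset Printing Implicit Defensive.

Import Order.TTheory GRing.Theory Num.Theory.
Import numFieldNormedType.Exports.

Local Open Scope classical_set_scope.
Local Open Scope ring_scope.

(** The centred sum S = sum_i (min(F(Y_i), F(Y_N(i))) + h(Y_i)) is a sum of terms that look at a
    sample point and its neighbour only; the factor in front of it disappears when the statistic is
    standardized.  Two facts make a central limit theorem possible.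

    First, a sample point is the neighbour, or the neighbour after one deletion, of at most K other
    points, where K depends only on the dimension ([edge2_indegree], [eucl_cone]).  So altering one
    point alters boundedly many terms, and the Efron-Stein inequality bounds the variance of every
    bounded local sum by a constant times n ([Var_local_sum]).

    Second, given the X's, the terms factor.  With V = F(Y) in [0, 1] and a grid of M+1 levels,
    min(V, V') is within 1/(M+1) of the mean over k of 1(V >= t_k) 1(V' >= t_k).  Let pb_k(X) be
    the conditional probability of {V >= t_k} given X.  Subtracting pb_k(X) pb_k(X') leaves a pair
    kernel a whose mean vanishes against every function that ignores the two Y's, and the term
    pb_k(X_i) pb_k(X_N(i)) is pb_k(X_i)^2 up to a sum of negligible variance, because a measurable
    function takes nearly the same value at a point and at its neighbour on average
    ([nn_small_all]).  So S is W = sum_i (a(Z_i, Z_N(i)) + l(Z_i)) up to a remainder whose variance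
    is at most any prescribed fraction of n ([split_statistic]).

    For W, Stein's method works without a limiting variance.  Comparing W with what remains of it
    after the pieces that touch one pair, or one point, are removed, a Taylor expansion turns
    E[W f(W)] into E[f'(W) H], where H is again a local sum with E[H] = E[W^2] and a variance of
    order n; so E[W f(W)] is E[f'(W)] E[W^2] up to an error of order sqrt(n) ([stein_identity],
    with f and f' rescaled later).  Solutions of f'(x) = x f(x) + g(x) - E g(N), for Lipschitz
    functions g that step from 1 to 0, have the required regularity ([stein_solution]).

    It remains to see that Var S grows linearly ([Var_stat_ge]).  With f = V - E[V | X], the sum
    over i of f(Z_i) f(Z_N(i)) has a variance of order n, and its covariance with S is at least of
    order n (E f^2)^2: conditionally on the X's, terms of S and of this sum are uncorrelated unless
    they involve the same pair.  If E f^2 were 0, then F(Y) would be a function of X; as Y can be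
    read off from F(Y) almost surely ([recover_from_cdf]), Y would be one too. *)

(** * Expectations of bounded measurable functions *)

Section BoundedMeasurable.
Context {d : measure_display} {T : measurableType d} {R : realType}.

(** Every random quantity below is bounded, so integrability is never an issue: this
    class is stable under all the operations used, and [Ex] is linear on it. *)
Definition bmf (f : T -> R) :=
  measurable_fun setT f /\ exists c, forall w, `|f w| <= c.

Lemma bmf_cst c : bmf (fun _ => c).
Proof. by split; [exact: measurable_cst | exists `|c|]. Qed.

Lemma bmfD f g : bmf f -> bmf g -> bmf (fun w => f w + g w).
Proof.
move=> [mf [a Ha]] [mg [b Hb]]; split; first exact: measurable_funD.
by exists (a + b) => w; rewrite (le_trans (ler_normD _ _))// lerD.
Qed.

Lemma bmfN f : bmf f -> bmf (fun w => - f w).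
Proof.
move=> [mf [a Ha]]; split; first exact: measurable_funN.
by exists a => w; rewrite normrN.
Qed.

Lemma bmfB f g : bmf f -> bmf g -> bmf (fun w => f w - g w).
Proof. by move=> bf bg; apply: bmfD => //; exact: bmfN. Qed.

Lemma bmfM f g : bmf f -> bmf g -> bmf (fun w => f w * g w).
Proof.
move=> [mf [a Ha]] [mg [b Hb]]; split; first exact: measurable_funM.
by exists (a * b) => w; rewrite normrM ler_pM.
Qed.

Lemma bmfX f k : bmf f -> bmf (fun w => f w ^+ k).
Proof.
move=> bf; elim: k => [|k IH].
  by under eq_fun do rewrite expr0; exact: bmf_cst.
by under eq_fun do rewrite exprS; exact: bmfM.
Qed.

Lemma bmf_norm f : bmf f -> bmf (fun w => `|f w|).
Proof.
move=> [mf [a Ha]]; split; last by exists a => w; rewrite normr_id.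
by apply: measurableT_comp => //; exact: measurable_normr.
Qed.

Lemma bmf_sum I (r : seq I) (Q : pred I) (f : I -> T -> R) :
  (forall i, bmf (f i)) -> bmf (fun w => \sum_(i <- r | Q i) f i w).
Proof.
move=> bf; elim: r => [|i r IH].
  by under eq_fun do rewrite big_nil; exact: bmf_cst.
under eq_fun do rewrite big_cons; case: (Q i) => //.
exact: bmfD.
Qed.

Lemma bmf_bool (b : T -> bool) :
  measurable_fun setT b -> bmf (fun w => (b w)%:R).
Proof.
move=> mb; split; last by exists 1 => w; case: (b w); rewrite /= ?normr1 ?normr0.
have -> : (fun w => (b w)%:R : R) = (fun w => if b w then 1 else 0).
  by apply/funext => w; case: (b w).
by apply: measurable_fun_ifT => //; exact: measurable_cst.
Qed.

Lemma bmf_le (f : T -> R) c : measurable_fun setT f -> (forall w, `|f w| <= c) -> bmf f.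
Proof. by move=> mf Hc; split => //; exists c. Qed.

End BoundedMeasurable.

Lemma bmf_comp {R : realType} d (T : measurableType d) d'
    (T' : measurableType d') (g : T' -> T) (f : T -> R) :
  bmf f -> measurable_fun setT g -> bmf (fun w => f (g w)).
Proof.
move=> [mf [a Ha]] mg; split; last by exists a.
exact: (measurableT_comp mf mg).
Qed.

Section Expectation.
Context {d : measure_display} {T : measurableType d} {R : realType}.
Variable P : probability T R.

Definition Ex (f : T -> R) : R := \int[P]_w f w.

Lemma bmf_integrable f : bmf f -> P.-integrable setT (EFin \o f).
Proof.
move=> [mf [a Ha]]; apply: measurable_bounded_integrable => //.
  by rewrite (le_lt_trans (probability_le1 P measurableT))// ltry.
exists a; split; first exact: num_real.
by move=> b ab w _ /=; exact: le_trans (Ha w) (ltW ab).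
Qed.

Lemma EFin_Ex f : bmf f -> (Ex f)%:E = (\int[P]_w (f w)%:E)%E.
Proof.
move=> bf; rewrite /Ex /Rintegral fineK//.
exact: integrable_fin_num (bmf_integrable bf).
Qed.

Lemma Ex_ext f g : f =1 g -> Ex f = Ex g.
Proof. by move=> fg; apply: eq_Rintegral => w _; exact: fg. Qed.

Lemma Ex_cst c : Ex (fun _ => c) = c.
Proof.
rewrite /Ex Rintegral_cst// [X in fine X](_ : _ = 1%E) ?mulr1//.
exact: probability_setT.
Qed.

Lemma ExD f g : bmf f -> bmf g -> Ex (fun w => f w + g w) = Ex f + Ex g.
Proof. by move=> bf bg; rewrite /Ex RintegralD//; exact: bmf_integrable. Qed.

Lemma ExB f g : bmf f -> bmf g -> Ex (fun w => f w - g w) = Ex f - Ex g.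
Proof. by move=> bf bg; rewrite /Ex RintegralB//; exact: bmf_integrable. Qed.

Lemma ExZ c f : bmf f -> Ex (fun w => c * f w) = c * Ex f.
Proof. by move=> bf; rewrite /Ex RintegralZl//; exact: bmf_integrable. Qed.

Lemma ExZr c f : bmf f -> Ex (fun w => f w * c) = Ex f * c.
Proof. by move=> bf; rewrite /Ex RintegralZr//; exact: bmf_integrable. Qed.

Lemma Ex_sum I (r : seq I) (Q : pred I) (f : I -> T -> R) :
  (forall i, bmf (f i)) ->
  Ex (fun w => \sum_(i <- r | Q i) f i w) = \sum_(i <- r | Q i) Ex (f i).
Proof.
move=> bf; elim: r => [|i r IH].
  by rewrite big_nil -[RHS]Ex_cst; apply: Ex_ext => w; rewrite big_nil.
rewrite big_cons -IH; under Ex_ext do rewrite big_cons.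
by case: (Q i) => //; rewrite ExD//; exact: bmf_sum.
Qed.

Lemma Ex_ge0 f : (forall w, 0 <= f w) -> 0 <= Ex f.
Proof. by move=> f0; apply: Rintegral_ge0. Qed.

Lemma Ex_le f g : bmf f -> bmf g -> (forall w, f w <= g w) -> Ex f <= Ex g.
Proof. by move=> bf bg fg; apply: le_Rintegral => //; exact: bmf_integrable. Qed.

Lemma Ex_le_cst f c : bmf f -> (forall w, f w <= c) -> Ex f <= c.
Proof. by move=> bf fc; rewrite -(Ex_cst c); apply: Ex_le => //; exact: bmf_cst. Qed.

Lemma Ex_normr f : bmf f -> `|Ex f| <= Ex (fun w => `|f w|).
Proof. by move=> bf; apply: le_normr_Rintegral => //; exact: bmf_integrable. Qed.

Lemma Ex_ae_eq f g : bmf f -> bmf g -> {ae P, forall w, f w = g w} -> Ex f = Ex g.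
Proof.
move=> bf bg fg; rewrite /Ex /Rintegral; congr fine.
apply: ae_eq_integral => //; do ?by apply/measurable_EFinP; case: bf; case: bg.
by apply: filterS fg => w /= -> _.
Qed.

Lemma Ex_le_ae f g : bmf f -> bmf g -> {ae P, forall w, f w <= g w} ->
  Ex f <= Ex g.
Proof.
move=> bf bg fg.
have bm : bmf (fun w => Num.min (f w) (g w)).
  case: bf bg => mf [a Ha] [mg [b Hb]]; split; first exact: measurable_minr.
  exists (a + b) => w; rewrite /Num.min; case: ifP => _.
    by rewrite (le_trans (Ha w))// lerDl (le_trans _ (Hb w)).
  by rewrite (le_trans (Hb w))// lerDr (le_trans _ (Ha w)).
rewrite (@Ex_ae_eq f (fun w => Num.min (f w) (g w)))//.
  by apply: Ex_le => // w; rewrite ge_min lexx orbT.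
by apply: filterS fg => w; rewrite minEle => ->.
Qed.

Lemma Ex_indic (A : set T) : measurable A -> Ex (\1_A : T -> R) = fine (P A).
Proof. by move=> mA; rewrite /Ex /Rintegral integral_indic// setIT. Qed.

Lemma Ex_sqr_ge f : bmf f -> Ex f ^+ 2 <= Ex (fun w => f w ^+ 2).
Proof.
move=> bf; rewrite -subr_ge0.
have := Ex_ge0 (fun w => sqr_ge0 (f w - Ex f)).
under Ex_ext do rewrite sqrrB.
rewrite ExD; last exact: bmf_cst.
  rewrite ExB; [|exact: bmfX|].
    rewrite Ex_cst.
    have -> : Ex (fun w => f w * Ex f *+ 2) = Ex f ^+ 2 *+ 2.
      under Ex_ext do rewrite -mulrnAr.
      by rewrite ExZr// mulrnAr expr2.
    by rewrite mulr2n; lra.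
  by under eq_fun do rewrite -mulrnAr; apply: bmfM => //; exact: bmf_cst.
apply: bmfB; first exact: bmfX.
by under eq_fun do rewrite -mulrnAr; apply: bmfM => //; exact: bmf_cst.
Qed.

Lemma Ex_CS_abs f : bmf f -> Ex (fun w => `|f w|) ^+ 2 <= Ex (fun w => f w ^+ 2).
Proof.
move=> bf; apply: le_trans (Ex_sqr_ge (bmf_norm bf)) _.
by under Ex_ext do rewrite real_normK ?num_real//.
Qed.

Definition Var (f : T -> R) := Ex (fun w => (f w - Ex f) ^+ 2).

Lemma VarE f : bmf f -> Var f = Ex (fun w => f w ^+ 2) - Ex f ^+ 2.
Proof.
move=> bf; rewrite /Var.
under Ex_ext do rewrite sqrrB.
have b2 : bmf (fun w => f w * Ex f *+ 2).
  by under eq_fun do rewrite -mulrnAr; apply: bmfM => //; exact: bmf_cst.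
rewrite ExD; [|by apply: bmfB => //; exact: bmfX|exact: bmf_cst].
rewrite ExB//; last exact: bmfX.
rewrite Ex_cst.
have -> : Ex (fun w => f w * Ex f *+ 2) = Ex f ^+ 2 *+ 2.
  by under Ex_ext do rewrite -mulrnAr; rewrite ExZr// mulrnAr expr2.
by rewrite mulr2n; lra.
Qed.

Lemma Var_ge0 f : 0 <= Var f.
Proof. by apply: Ex_ge0 => w; exact: sqr_ge0. Qed.

Lemma Var_le_sqr f c : bmf f -> Var f <= Ex (fun w => (f w - c) ^+ 2).
Proof.
move=> bf; have bg : bmf (fun w => f w - c) by apply: bmfB => //; exact: bmf_cst.
have -> : Var f = Var (fun w => f w - c).
  rewrite /Var ExB//; last exact: bmf_cst.
  by rewrite Ex_cst; apply: Ex_ext => w; congr (_ ^+ 2); lra.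
by rewrite VarE// lerBlDr lerDl sqr_ge0.
Qed.

Lemma Var_D_le f g : bmf f -> bmf g ->
  Var (fun w => f w + g w) <= 2 * Var f + 2 * Var g.
Proof.
move=> bf bg; rewrite /Var ExD//.
have b1 : bmf (fun w => (f w - Ex f) ^+ 2).
  by apply: bmfX; apply: bmfB => //; exact: bmf_cst.
have b2 : bmf (fun w => (g w - Ex g) ^+ 2).
  by apply: bmfX; apply: bmfB => //; exact: bmf_cst.
have b3 (h : T -> R) : bmf h -> bmf (fun w => 2 * h w).
  by move=> bh; apply: bmfM => //; exact: bmf_cst.
rewrite -!ExZ//.
rewrite -[leRHS]ExD; [|exact: b3|exact: b3].
apply: Ex_le.
- by apply: bmfX; apply: bmfB; [exact: bmfD|exact: bmf_cst].
- by apply: bmfD; exact: b3.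
move=> w; have := sqr_ge0 ((f w - Ex f) - (g w - Ex g)); lra.
Qed.

End Expectation.

Ltac bm := repeat first
  [ assumption
  | apply: bmf_cst
  | apply: bmfX
  | apply: bmf_norm
  | apply: bmfD
  | apply: bmfN
  | apply: bmfM
  | apply: bmf_sum; intro ].

(** * Independent samples and the Efron-Stein inequality *)

Section Rectangles.
Context {d : measure_display} {S : measurableType d} {n : nat}.

Definition rectangle : set (set (n.-tuple S)) :=
  [set A | exists2 B : 'I_n -> set S, (forall i, measurable (B i)) &
     A = [set z | forall i, B i (tnth z i)]].

Lemma rectangle_setI : setI_closed rectangle.
Proof.
move=> _ _ [B mB ->] [C mC ->]; exists (fun i => B i `&` C i).
  by move=> i; exact: measurableI.
by apply/seteqP; split => z /= => [[zB zC] i|zBC]; [split|split => i; case: (zBC i)].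
Qed.

Lemma rectangle_setT : rectangle setT.
Proof. by exists (fun _ => setT) => //; apply/seteqP; split. Qed.

Lemma rectangle_measurable A : rectangle A -> measurable A.
Proof.
move=> [B mB ->].
rewrite (_ : [set _ | _] =
    \bigcap_(i in [set: 'I_n]) ((fun z : n.-tuple S => tnth z i) @^-1` B i)).
  apply: fin_bigcap_measurable => // i _.
  by rewrite -[X in measurable X]setTI; exact: measurable_tnth.
by apply/seteqP; split => z /= zB => [i _|i]; exact: zB.
Qed.

Lemma measurable_rectangle :
  (@measurable _ (n.-tuple S)) = <<s rectangle >>.
Proof.
apply/seteqP; split.
  apply: smallest_sub; first exact: smallest_sigma_algebra.
  rewrite -bigcup_seq => A [i _ [Y mY <-]]; apply: sub_sigma_algebra.
  exists (fun k => if k == i then Y else setT).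
    by move=> k; case: ifP.
  apply/seteqP; split => z /=; first by move=> [_ Yz] k; case: eqP => // ->.
  by move=> /(_ i); rewrite eqxx.
apply: smallest_sub; first exact: sigma_algebra_measurable.
exact: rectangle_measurable.
Qed.

End Rectangles.

(** The pi-lambda argument by which laws of samples are compared through rectangles. *)
Lemma pushforward_unique (R : realType) d d1 d2 (T1 : measurableType d1)
    (T2 : measurableType d2) (U : measurableType d)
    (m1 : {measure set T1 -> \bar R}) (m2 : {measure set T2 -> \bar R})
    (f1 : T1 -> U) (f2 : T2 -> U) (G : set (set U)) :
  measurable_fun setT f1 -> measurable_fun setT f2 ->
  @measurable _ U = <<s G >> -> setI_closed G -> G setT -> (m1 setT < +oo)%E ->
  (forall A, G A -> m1 (f1 @^-1` A) = m2 (f2 @^-1` A)) ->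
  forall A, measurable A -> m1 (f1 @^-1` A) = m2 (f2 @^-1` A).
Proof.
move=> mf1 mf2 GE GI GT m1T eqG A mA.
apply: (@measure_unique _ R U G (fun _ => setT) GE GI _ _ (pushforward m1 f1) (pushforward m2 f2)) => //.
by rewrite bigcup_const.
Qed.

Section Sample.
Context {dT : measure_display} {T : measurableType dT} {R : realType}.
Variable P : probability T R.
Context {dS : measure_display} {S : measurableType dS}.
Variables (Z : nat -> T -> S) (Z0 : T -> S).
Hypothesis mZ : forall i, measurable_fun setT (Z i).
Hypothesis mZ0 : measurable_fun setT Z0.
Hypothesis copies : forall i, identically_distributed P (Z i) Z0.
Hypothesis indep : mutually_independent P Z.

Definition sample n (w : T) : n.-tuple S := [tuple Z i w | i < n].

Lemma measurable_sample n : measurable_fun setT (@sample n).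
Proof.
apply/measurable_fun_tnthP => i /=.
by rewrite (_ : _ \o _ = Z i)//; apply/funext => w /=; rewrite tnth_mktuple.
Qed.

Lemma sample_rectangle n (B : 'I_n -> set S) : (forall i, measurable (B i)) ->
  P [set w | forall i, B i (Z i w)] = (\prod_(i < n) P (Z0 @^-1` B i))%E.
Proof.
move=> mB; pose C k := if insub k is Some i then B i else setT.
have CE (i : 'I_n) : C i = B i by rewrite /C valK.
have mC k : measurable (C k) by rewrite /C; case: insubP.
have := indep [fset k | k in iota 0 n]%fset mC.
have memJ k : (k \in [fset k | k in iota 0 n]%fset) = (k < n)%N.
  by rewrite in_fset /= mem_iota.
have -> : \bigcap_(i in [set` [fset k | k in iota 0 n]%fset]) (Z i @^-1` C i) =
    [set w | forall i, B i (Z i w)].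
  apply/seteqP; split => w /=.
    by move=> wC i; rewrite -CE; apply: wC => /=; rewrite memJ.
  move=> wB k /=; rewrite memJ => kn.
  by have := wB (Ordinal kn); rewrite -CE.
move=> ->.
rewrite (perm_big (iota 0 n)) /=; last first.
  apply: uniq_perm; rewrite ?fset_uniq ?iota_uniq// => k.
  by rewrite memJ mem_iota.
have := @big_mkord _ 1%E mule n xpredT (fun k => P (Z k @^-1` C k)).
rewrite /index_iota subn0 => ->.
by apply: eq_bigr => i _; rewrite CE copies.
Qed.

Definition upd n (z : n.-tuple S) (j : 'I_n) (s : S) : n.-tuple S :=
  [tuple if k == j then s else tnth z k | k < n].

Lemma tnth_upd n (z : n.-tuple S) j s k :
  tnth (upd z j s) k = if k == j then s else tnth z k.
Proof. by rewrite tnth_mktuple. Qed.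

Lemma measurable_upd n d' (T' : measurableType d') (f : T' -> n.-tuple S) j g :
  measurable_fun setT f -> measurable_fun setT g ->
  measurable_fun setT (fun w => upd (f w) j (g w)).
Proof.
move=> mf mg; apply/measurable_fun_tnthP => i /=.
rewrite (_ : _ \o _ = if i == j then g else (fun z => tnth z i) \o f).
  by case: ifP => // _; apply: measurableT_comp => //; exact: measurable_tnth.
by apply/funext => w /=; rewrite tnth_upd; case: ifP.
Qed.

(** Replacing one point by an independent copy does not change the law of the sample.  This
    is where independence and equality in law enter; later arguments only use its consequence
    [Ex_avg]. *)
Lemma sample_resample n (j : 'I_n) (A : set (n.-tuple S)) : measurable A ->
  P (sample n @^-1` A) =
  (P \x P)%E ((fun w : T * T => upd (sample n w.1) j (Z0 w.2)) @^-1` A).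
Proof.
apply: (pushforward_unique (G := rectangle)).
- exact: measurable_sample.
- apply: measurable_upd; last exact: measurableT_comp.
  by apply: measurableT_comp => //; exact: measurable_sample.
- exact: measurable_rectangle.
- exact: rectangle_setI.
- exact: rectangle_setT.
- by rewrite (le_lt_trans (probability_le1 P measurableT))// ltry.
move=> _ [B mB ->].
rewrite (_ : _ @^-1` _ = [set w | forall i, B i (Z i w)]); last first.
  by apply/seteqP; split => w /= wB i; have := wB i; rewrite tnth_mktuple.
rewrite [LHS](sample_rectangle mB).
rewrite (_ : _ @^-1` _ =
    [set w | forall i, (if i == j then setT else B i) (Z i w)] `*` (Z0 @^-1` B j)).
  have mB' i : measurable (if i == j then setT else B i) by case: ifP.
  have mA1 : measurable [set w | forall i, (if i == j then setT else B i) (Z i w)].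
    rewrite (_ : [set _ | _] = \bigcap_(i in [set: 'I_n])
        (Z i @^-1` (if i == j then setT else B i))).
      apply: fin_bigcap_measurable => // i _.
      by rewrite -[X in measurable X]setTI; exact: mZ.
    by apply/seteqP; split => w /= wB => [i _|i]; exact: wB.
  have mA2 : measurable (Z0 @^-1` B j).
    by rewrite -[X in measurable X]setTI; exact: mZ0.
  apply: (eq_trans _ (esym (@product_measure1E _ _ _ _ R P P _ _ mA1 mA2))).
  rewrite [X in _ = (X * _)%E](sample_rectangle mB').
  rewrite [LHS](bigD1 j)//= [X in _ = (X * _)%E](bigD1 j)//= eqxx preimage_setT.
  rewrite probability_setT mul1e muleC; congr (_ * _)%E.
  by apply: eq_bigr => i /negbTE ->.
apply/seteqP; split => -[w w'] /=.
  move=> wB; split; last by have := wB j; rewrite tnth_upd eqxx.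
  by move=> i; have := wB i; rewrite tnth_upd tnth_mktuple; case: ifP.
move=> [wB w'B] i; rewrite tnth_upd tnth_mktuple; have := wB i.
by case: eqP => // ->.
Qed.

(** The conditional expectation given all points except the j-th. *)
Definition avg n (j : 'I_n) (Phi : n.-tuple S -> R) (z : n.-tuple S) : R :=
  Ex P (fun w => Phi (upd z j (Z0 w))).

Lemma measurable_upd2 n (j : 'I_n) :
  measurable_fun setT (fun u : n.-tuple S * T => upd u.1 j (Z0 u.2)).
Proof. by apply: measurable_upd => //; exact: measurableT_comp. Qed.

Lemma bmf_upd n (Phi : n.-tuple S -> R) j z :
  bmf Phi -> bmf (fun w => Phi (upd z j (Z0 w))).
Proof. by move=> bPhi; apply: bmf_comp => //; exact: measurable_upd. Qed.

Lemma bmf_Ex d' (T' : measurableType d') (f : T' * T -> R) :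
  bmf f -> bmf (fun z => Ex P (fun w => f (z, w))).
Proof.
move=> bf; have [mf [c Hc]] := bf.
have bz z : bmf (fun w => f (z, w)).
  by apply: bmf_comp => //; exact: measurable_pair1.
split; last first.
  exists c => z; apply: le_trans (Ex_normr _ (bz z)) _.
  by apply: Ex_le_cst => //; exact: bmf_norm.
pose g u := (f u + c)%:E.
have g0 u : (0 <= g u)%E.
  by rewrite lee_fin; have := Hc u; rewrite ler_norml => /andP[]; lra.
have mg : measurable_fun setT g.
  by apply/measurable_EFinP; apply: measurable_funD => //; exact: measurable_cst.
have := @measurable_fun_fubini_tonelli_F _ _ _ _ R P g mg g0.
rewrite (_ : fubini_F P g = fun z => (Ex P (fun w => f (z, w)) + c)%:E).
  move=> /measurable_EFinP mFc.
  rewrite (_ : (fun z => _) = fun z => (Ex P (fun w => f (z, w)) + c) - c).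
    by apply: measurable_funB => //; exact: measurable_cst.
  by apply/funext => z; rewrite addrK.
apply/funext => z; rewrite /fubini_F.
rewrite -(Ex_cst P c) -ExD//; last exact: bmf_cst.
by rewrite EFin_Ex//; apply: bmfD => //; exact: bmf_cst.
Qed.

Lemma bmf_avg n j (Phi : n.-tuple S -> R) : bmf Phi -> bmf (avg j Phi).
Proof.
move=> bPhi; apply: (@bmf_Ex _ _ (fun u => Phi (upd u.1 j (Z0 u.2)))).
by apply: bmf_comp => //; exact: measurable_upd2.
Qed.

Lemma Ex_prod d' (T' : measurableType d') (Q : probability T' R) (f : T' * T -> R) :
  bmf f -> (Ex Q (fun z => Ex P (fun w => f (z, w))))%:E =
           (\int[Q \x P]_u (f u)%:E)%E.
Proof.
move=> bf.
have bz z : bmf (fun w => f (z, w)).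
  by case: bf => mf [c Hc]; split; [apply: measurableT_comp => //; exact: measurable_pair1|exists c].
rewrite -integral12_prod_meas1.
  rewrite EFin_Ex; last exact: bmf_Ex.
  by apply: eq_integral => z _; rewrite /fubini_F EFin_Ex.
have [mf [c Hc]] := bf.
apply/integrable12ltyP; first exact/measurable_EFinP.
apply: (@le_lt_trans _ _ (\int[Q]_x \int[P]_y (`|c|)%:E)%E).
  apply: ge0_le_integral => //.
  - by move=> x _; apply: integral_ge0 => y _.
  - apply: (@measurable_fun_fubini_tonelli_F _ _ _ _ R P (fun u => `|(f u)%:E|%E)) => //.
    by apply: measurableT_comp => //; exact/measurable_EFinP.
  - move=> x _; apply: ge0_le_integral => //.
    + by apply: measurableT_comp => //; apply/measurable_EFinP; case: (bz x).
    + by move=> y _; rewrite lee_fin (le_trans (Hc _))// ler_norm.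
have cE d1 (U : measurableType d1) (Q' : probability U R) (e : \bar R) :
    (\int[Q']_(_ in setT) e = e)%E.
  rewrite integral_cst// [X in (_ * X)%E](_ : _ = 1%E) ?mule1//.
  exact: probability_setT.
by rewrite (eq_integral (fun _ => `|c|%:E)) ?cE ?ltry// => x _; rewrite cE.
Qed.

Lemma Ex_avg n j (Phi : n.-tuple S -> R) : bmf Phi ->
  Ex P (fun w => Phi (sample n w)) = Ex P (fun w => avg j Phi (sample n w)).
Proof.
move=> bPhi; apply: EFin_inj.
have [mPhi _] := bPhi.
pose f2 (u : T * T) := upd (sample n u.1) j (Z0 u.2).
have mf2 : measurable_fun setT f2.
  apply: measurable_upd; last exact: measurableT_comp.
  by apply: measurableT_comp => //; exact: measurable_sample.
rewrite (@Ex_prod _ _ P (fun u => Phi (f2 u))); last exact: bmf_comp.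
rewrite EFin_Ex; last by apply: bmf_comp => //; exact: measurable_sample.
have i1 : P.-integrable setT (fun w => (Phi (sample n w))%:E).
  apply: (@bmf_integrable _ _ _ P (fun w => Phi (sample n w))).
  by apply: bmf_comp => //; exact: measurable_sample.
have i2 : (P \x P)%E.-integrable setT (fun u => (Phi (f2 u))%:E).
  apply: (@bmf_integrable _ _ R (P \x P)%E (fun u => Phi (f2 u))).
  exact: bmf_comp.
have := @integral_pushforward _ _ _ _ _ _ (@measurable_sample n) P setT (EFin \o Phi).
rewrite preimage_setT => <- //; last exact/measurable_EFinP.
have := @integral_pushforward _ _ _ _ _ _ mf2 (P \x P)%E setT (EFin \o Phi).
rewrite preimage_setT => <- //; last exact/measurable_EFinP.
apply: eq_measure_integral; first exact: measurable_sample.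
by move=> ms A mA _; exact: (sample_resample j mA).
Qed.

Definition En n (Phi : n.-tuple S -> R) := Ex P (fun w => Phi (sample n w)).

Lemma bmf_sample n (Phi : n.-tuple S -> R) :
  bmf Phi -> bmf (fun w => Phi (sample n w)).
Proof. by move=> bPhi; apply: bmf_comp => //; exact: measurable_sample. Qed.

(** The form in which conditional centering is used: averaging out one suitable point is
    enough to see that an expectation vanishes. *)
Lemma En_eq0 n j (Phi : n.-tuple S -> R) : bmf Phi ->
  (forall z, Ex P (fun w => Phi (upd z j (Z0 w))) = 0) -> En Phi = 0.
Proof.
move=> bPhi Phi0; rewrite /En (Ex_avg j)// -[RHS](Ex_cst P 0).
by apply: Ex_ext => w; exact: Phi0.
Qed.

(** Independence of one coordinate as an algebraic invariance, which is what the
    deletion arguments provide. *)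
Definition indep_of n (j : 'I_n) (Phi : n.-tuple S -> R) :=
  forall z s, Phi (upd z j s) = Phi z.

Lemma upd_upd n (z : n.-tuple S) j s s' : upd (upd z j s) j s' = upd z j s'.
Proof.
by apply: eq_from_tnth => k; rewrite !tnth_upd; case: eqP.
Qed.

Lemma updC n (z : n.-tuple S) i j s s' : i != j ->
  upd (upd z i s) j s' = upd (upd z j s') i s.
Proof.
move=> ij; apply: eq_from_tnth => k; rewrite !tnth_upd.
by case: eqP => // ->; rewrite eq_sym (negbTE ij).
Qed.

Lemma indep_of_avg n (j k : 'I_n) Phi :
  (j = k \/ indep_of k Phi) -> indep_of k (avg j Phi).
Proof.
have [->|jk] := eqVneq j k.
  by move=> _ z s; rewrite /avg; apply: Ex_ext => w; rewrite upd_upd.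
move=> [/eqP|iPhi z s]; first by rewrite (negbTE jk).
by rewrite /avg; apply: Ex_ext => w; rewrite updC 1?eq_sym// iPhi.
Qed.

Lemma En_sqr_avg n (j : 'I_n) (Phi : n.-tuple S -> R) : bmf Phi ->
  En (fun z => Phi z ^+ 2) - En (fun z => avg j Phi z ^+ 2) =
  En (fun z => (Phi z - avg j Phi z) ^+ 2).
Proof.
move=> bPhi; have bA := bmf_avg j bPhi.
rewrite /En [in RHS](@Ex_avg n j (fun z => (Phi z - avg j Phi z) ^+ 2)); last first.
  by apply: bmfX; exact: bmfB.
rewrite [X in X - _](@Ex_avg n j (fun z => Phi z ^+ 2)); last exact: bmfX.
rewrite -ExB; [|by apply: (@bmf_sample _ (avg j _)); apply: bmf_avg; exact: bmfX|
                by apply: bmfX; exact: bmf_sample].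
apply: Ex_ext => w; rewrite {1 3}/avg.
have := VarE P (bmf_upd j (sample n w) bPhi).
rewrite /Var => <-; apply: Ex_ext => w' /=.
by rewrite (@indep_of_avg n j j Phi (or_introl erefl)).
Qed.

Lemma En_avg_sqr_le n (j : 'I_n) (Phi : n.-tuple S -> R) : bmf Phi ->
  En (fun z => avg j Phi z ^+ 2) <= En (fun z => Phi z ^+ 2).
Proof.
by move=> bPhi; rewrite -subr_ge0 En_sqr_avg//; apply: Ex_ge0 => w; exact: sqr_ge0.
Qed.

(** Conditional expectation is the best approximation among functions of the other
    points, so any convenient function of them can be used in its place in the Efron-Stein bound. *)
Lemma En_avg_best n (j : 'I_n) (Phi D : n.-tuple S -> R) : bmf Phi -> bmf D ->
  indep_of j D ->
  En (fun z => (Phi z - avg j Phi z) ^+ 2) <= En (fun z => (Phi z - D z) ^+ 2).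
Proof.
move=> bPhi bD iD; have bA := bmf_avg j bPhi.
rewrite /En [leLHS](@Ex_avg n j (fun z => (Phi z - avg j Phi z) ^+ 2)); last first.
  by apply: bmfX; exact: bmfB.
rewrite [leRHS](@Ex_avg n j (fun z => (Phi z - D z) ^+ 2)); last first.
  by apply: bmfX; exact: bmfB.
apply: Ex_le.
- by apply: (@bmf_sample _ (avg j _)); apply: bmf_avg; apply: bmfX; exact: bmfB.
- by apply: (@bmf_sample _ (avg j _)); apply: bmf_avg; apply: bmfX; exact: bmfB.
move=> w; set z := sample n w.
have -> : avg j (fun z => (Phi z - D z) ^+ 2) z =
    Ex P (fun w' => (Phi (upd z j (Z0 w')) - D z) ^+ 2).
  by apply: Ex_ext => w'; rewrite iD.
apply: le_trans (Var_le_sqr P (D z) (bmf_upd j z bPhi)); rewrite le_eqVlt.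
apply/orP; left; apply/eqP; rewrite /Var; apply: Ex_ext => w'.
by rewrite (@indep_of_avg n j j Phi (or_introl erefl)).
Qed.

Lemma indep_of_all_cst n (Phi : n.-tuple S -> R) :
  (forall j, indep_of j Phi) -> forall z z', Phi z = Phi z'.
Proof.
move=> iPhi z z'.
pose r (s : seq 'I_n) := foldr (fun j y => upd y j (tnth z' j)) z s.
have Pr s : Phi (r s) = Phi z by elim: s => //= j s IH; rewrite iPhi.
rewrite -(Pr (enum 'I_n)); congr Phi; apply: eq_from_tnth => k.
have : k \in enum 'I_n by rewrite mem_enum.
elim: (enum 'I_n) => //= j s IH; rewrite inE tnth_upd.
by case: eqP => [->//|_] /=; exact: IH.
Qed.

(** Averaging out the points one after the other ends in a constant, and the second moment
    lost at each step is that of an orthogonal increment; by conditional Jensen it is at most the loss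
    from averaging out this single point in Phi itself. *)
Lemma efron_stein n (Phi : n.-tuple S -> R) (D : 'I_n -> n.-tuple S -> R) :
  bmf Phi -> (forall j, bmf (D j)) -> (forall j, indep_of j (D j)) ->
  Var P (fun w => Phi (sample n w)) <=
  \sum_j En (fun z => (Phi z - D j z) ^+ 2).
Proof.
move=> bPhi bD iD.
pose avgs (r : seq 'I_n) Psi := foldl (fun Psi j => avg j Psi) Psi r.
have bavgs r : forall Psi, bmf Psi -> bmf (avgs r Psi).
  by elim: r => //= j r IH Psi bPsi; apply: IH; exact: bmf_avg.
have Eavgs r : forall Psi, bmf Psi -> En (avgs r Psi) = En Psi.
  elim: r => //= j r IH Psi bPsi; rewrite IH; last exact: bmf_avg.
  by rewrite /En -Ex_avg.
have iavgs r k : forall Psi, indep_of k Psi \/ k \in r -> indep_of k (avgs r Psi).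
  elim: r => /= [Psi []//|j r IH Psi H]; apply: IH.
  move: H; rewrite inE => -[iPsi|/orP[/eqP ->|kr]]; [left|left|by right].
    by apply: indep_of_avg; right.
  by apply: indep_of_avg; left.
have main r : forall Psi (E : 'I_n -> n.-tuple S -> R), bmf Psi ->
    (forall j, bmf (E j)) -> (forall j, indep_of j (E j)) ->
    En (fun z => Psi z ^+ 2) - En (fun z => avgs r Psi z ^+ 2) <=
    \sum_(j <- r) En (fun z => (Psi z - E j z) ^+ 2).
  elim: r => [|j r IH] Psi E bPsi bE iE; first by rewrite big_nil subrr.
  rewrite big_cons /=; have bA := bmf_avg j bPsi.
  rewrite -(subrKA (En (fun z => avg j Psi z ^+ 2))) lerD//.
    by rewrite En_sqr_avg//; exact: En_avg_best.
  have iE' k : indep_of k (avg j (E k)) by apply: indep_of_avg; right.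
  apply: le_trans (IH _ _ bA (fun k => bmf_avg j (bE k)) iE') _.
  apply: ler_sum => k _.
  apply: le_trans (En_avg_sqr_le j (bmfB bPsi (bE k))).
  rewrite /En le_eqVlt; apply/orP; left; apply/eqP; apply: Ex_ext => w.
  by rewrite /avg ExB//; exact: bmf_upd.
apply: le_trans (_ : _ <= \sum_(j <- enum 'I_n) En (fun z => (Phi z - D j z) ^+ 2)) _;
  last by rewrite big_enum.
apply: le_trans (main _ _ _ bPhi bD iD).
rewrite VarE; last exact: bmf_sample.
rewrite lerD2l lerN2 /En.
rewrite (_ : Ex P (fun w => Phi (sample n w)) = En Phi)// -(Eavgs (enum 'I_n) Phi bPhi).
have w0 : T := point.
have cE z : avgs (enum 'I_n) Phi z = avgs (enum 'I_n) Phi (sample n w0).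
  by apply: indep_of_all_cst => j; apply: iavgs; right; rewrite mem_enum.
rewrite /En; set c := avgs (enum 'I_n) Phi (sample n w0) in cE.
have -> : Ex P (fun w => avgs (enum 'I_n) Phi (sample n w)) = c.
  by rewrite -[RHS](Ex_cst P); apply: Ex_ext => w; rewrite cE.
rewrite -[leRHS](Ex_cst P) le_eqVlt; apply/orP; left; apply/eqP.
by apply: Ex_ext => w; rewrite cE.
Qed.

End Sample.

(** * Nearest points with respect to finite preference orders *)

(** Deleting points other than the one selected keeps the selection. *)
Lemma pick_restrict (T : finType) (p q : pred T) r :
  pick p = Some r -> q r -> pick (fun x => q x && p x) = Some r.
Proof.
rewrite /pick /enum_mem => + qr.
elim: (Finite.enum _) => //= x s IH; rewrite -!topredE /=; case: (p x); rewrite ?andbT ?andbF//=.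
by move=> -[->]; rewrite qr.
Qed.

Section Preferences.
Local Open Scope set_scope.
Context {n : nat}.
Variables (a : rel 'I_n) (le : 'I_n -> rel 'I_n).
Implicit Types (J : {set 'I_n}) (i j k : 'I_n).

Definition cand J i j := [&& j \in J, j != i & a i j].

Definition nb J i : 'I_n :=
  odflt i [pick j | cand J i j && [forall k, cand J i k ==> le i j k]].

Definition nb2 J i := nb (J :\ nb J i) i.

Definition closer J i j := [set k | cand J i k && ~~ le i j k].

(** A relation that contains both the edge to the nearest candidate and the edge to the
    nearest candidate after one deletion, for which a degree bound is still available. *)
Definition edge2 J i j := cand J i j && (#|closer J i j| <= 1)%N.

Hypothesis le_refl : forall i, reflexive (le i).
Hypothesis le_trans : forall i, transitive (le i).
Hypothesis le_total : forall i, total (le i).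

Lemma cand_min J i j : cand J i j ->
  exists2 r, cand J i r & forall k, cand J i k -> le i r k.
Proof.
move=> cj; pose s := sort (le i) (enum (cand J i)).
have sP k : (k \in s) = cand J i k by rewrite mem_sort mem_enum.
have : j \in s by rewrite sP.
have : sorted (le i) s by apply: sort_sorted; exact: le_total.
case: s sP => // r s sP /= pth _; exists r; first by rewrite -sP mem_head.
move=> k; rewrite -sP inE => /orP[/eqP ->|ks]; first exact: le_refl.
by move: pth; rewrite path_sortedE//= => /andP[/allP/(_ _ ks)].
Qed.

Variant nb_spec J i : 'I_n -> Prop :=
| NbSome r of cand J i r & (forall k, cand J i k -> le i r k) : nb_spec J i r
| NbNone of (forall k, cand J i k = false) : nb_spec J i i.

Lemma nbP J i : nb_spec J i (nb J i).
Proof.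
rewrite /nb; case: pickP => [r /andP[cr /forallP mr]|none] /=.
  by apply: NbSome => // k; exact/implyP.
apply: NbNone => k; apply/negP => /cand_min[r cr mr].
have := none r; rewrite cr /= => /negP; apply.
by apply/forallP => l; apply/implyP; exact: mr.
Qed.

Lemma nb_cand J i : nb J i != i -> cand J i (nb J i).
Proof. by case: nbP => // _; rewrite eqxx. Qed.

Lemma nb_in J i : i \in J -> nb J i \in J.
Proof. by case: nbP => // r /and3P[]. Qed.

Lemma candD1 J i j k : cand (J :\ j) i k = (k != j) && cand J i k.
Proof. by rewrite /cand in_setD1 -andbA. Qed.

(** Deletion consistency: this is why removing a point only disturbs the points that were
    attached to it. *)
Lemma nb_del J i j : nb J i != j -> nb (J :\ j) i = nb J i.
Proof.
move=> nbj; have [E|E] := eqVneq (nb J i) i.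
  rewrite E; case: (nbP (J :\ j) i) => // r; rewrite candD1 => /andP[_ cr] _.
  by have := E; case: nbP => [s /and3P[_ /eqP si _] _ /si//|none _]; rewrite none in cr.
rewrite /nb.
set PJ := fun j0 => cand J i j0 && _; set PD := fun j0 => cand (J :\ j) i j0 && _.
have : nb J i = odflt i (pick PJ) by [].
case pJ : (pick PJ) => [r|] /= nbE; last by rewrite nbE eqxx in E.
rewrite -nbE in pJ *; move: nbj E; rewrite nbE => rj _.
have /andP[cr /forallP mr] : PJ r by move: pJ; rewrite nbE; case: pickP => // ? ? [<-].
have PDE k : PD k = (k != j) && PJ k.
  rewrite /PD /PJ candD1 -andbA; case: (k != j) => //=.
  case ck : (cand J i k) => //=; apply/forallP/forallP => H l; apply/implyP.
    move=> cl; have [lj|lj] := eqVneq l j; last first.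
      by have := H l; rewrite candD1 lj cl.
    apply: le_trans (implyP (mr l) cl).
    by have := H r; rewrite candD1 rj cr.
  by rewrite candD1 => /andP[_ cl]; have := H l; rewrite cl.
by rewrite (eq_pick PDE) (pick_restrict pJ)// nbE.
Qed.

Lemma nb_self J i : nb (J :\ i) i = nb J i.
Proof.
rewrite /nb; congr odflt; apply: eq_pick => k /=.
have cE l : cand (J :\ i) i l = cand J i l.
  by rewrite candD1 /cand; case: (l == i) => //; rewrite andbF.
by rewrite cE; congr andb; apply: eq_forallb => l; rewrite cE.
Qed.

Lemma nb_edge2 J i : nb J i != i -> edge2 J i (nb J i).
Proof.
move=> ni; rewrite /edge2 nb_cand//=.
rewrite (_ : closer J i (nb J i) = finset.set0) ?cards0//.
apply/finset.setP => k; rewrite !inE; apply/negP => /andP[ck].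
case: (nbP J i) => [r _ H|none]; first by rewrite H.
by rewrite none in ck.
Qed.

Lemma nb2_edge2 J i : nb2 J i != i -> edge2 J i (nb2 J i).
Proof.
move=> ni; have := nb_cand ni; rewrite candD1 => /andP[_ c2].
rewrite /edge2 c2 /=.
suff /subset_leq_card/leq_trans : closer J i (nb2 J i) \subset [set nb J i].
  by apply; rewrite cards1.
apply/fintype.subsetP => k; rewrite !inE => /andP[ck]; apply: contraR => kn.
rewrite /nb2; case: nbP => [r _ H|none]; first by apply: H; rewrite candD1 kn.
by have := none k; rewrite candD1 kn ck.
Qed.

Lemma nb2_self J i : nb J i = i -> nb2 J i = i.
Proof. by move=> E; rewrite /nb2 E nb_self. Qed.

Lemma nb2_del J i j : nb J i != j -> nb2 J i != j -> nb2 (J :\ j) i = nb2 J i.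
Proof.
move=> n1 n2; rewrite /nb2 (nb_del n1) finset.setDDl finset.setUC -finset.setDDl nb_del//.
Qed.

(** Among the sources of one colour, take the one farthest from j: it prefers all the
    others to j, and at most one point may be preferred to j.  So each colour contributes at most two
    sources. *)
Lemma edge2_indegree (R : realDomainType) (C : finType)
    (col : 'I_n -> 'I_n -> C) (rho : 'I_n -> 'I_n -> R) :
  (forall j i k, i != k -> i != j -> k != j -> a i j -> a k j ->
     col j i = col j k -> rho k j <= rho i j -> a i k && ~~ le i j k) ->
  forall J j, (#|[set i in J | edge2 J i j]| <= 2 * #|C|)%N.
Proof.
move=> Hcol J j; set A := [set i in J | _].
rewrite -sum1_card (partition_big (col j) predT)//=.
rewrite mulnC -sum_nat_const; apply: leq_sum => c _.
rewrite sum1_card.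
have [->//|/card_gt0P[i0]] := posnP #|[pred x | (x \in A) && (col j x == c)]|.
move=> Hi0; set B := [pred x | _] in Hi0 *.
case: (@arg_maxP _ _ _ i0 (mem B) (rho ^~ j) Hi0) => i iB imax.
have {}iB : i \in B by exact: iB.
rewrite (cardD1 i) iB ltnS.
move: (iB); rewrite !inE => /andP[/andP[iJ /andP[cij ci1]] /eqP ci].
apply: leq_trans ci1; apply: subset_leq_card; apply/fintype.subsetP => k.
rewrite inE => /andP[/= ki kB]; rewrite inE.
have rle := imax k kB.
move: (kB : k \in B); rewrite !inE => /andP[/andP[kJ /andP[ckj _]] /eqP ck].
move: cij ckj; rewrite /cand => /and3P[_ ji aij] /and3P[_ jk akj].
have /andP[aik nle] : a i k && ~~ le i j k.
  by apply: (Hcol j) => //; [rewrite eq_sym|rewrite eq_sym|rewrite eq_sym|rewrite ci ck].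
by rewrite kJ ki aik.
Qed.

(** The points of B with at most one candidate inside B form a tournament in which all
    out-degrees are at most one, hence there are at most three of them.  Any other point of B has two
    candidates in B, and its edge, being among the two best, is not longer than one of these. *)
Lemma crowded_edge2 J (B : {set 'I_n}) : B \subset J ->
  (forall i k, i \in B -> k \in B -> i != k -> a i k || a k i) ->
  exists2 E : {set 'I_n}, (#|E| <= 3)%N &
    forall i j, i \in B -> i \notin E -> edge2 J i j ->
      exists2 k, k \in B & le i j k.
Proof.
move=> BJ tot.
pose E := [set i in B | (#|[set k in B | (k != i) && a i k]| <= 1)%N].
exists E.
  have H : (\sum_(i in E) \sum_(k in E) ((k != i) && a i k) <= #|E|)%N.
    rewrite -sum1_card; apply: leq_sum => i.
    rewrite inE => /andP[iB /(leq_trans _)]; apply.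
    rewrite -sum1_card big_mkcond [leqRHS]big_mkcond; apply: leq_sum => k _.
    by rewrite !inE; case: (k \in B) => //=; case: ifP => //; case: (_ && _).
  have H' : (#|E| * #|E| <= #|E| + 2 * \sum_(i in E) \sum_(k in E) ((k != i) && a i k))%N.
    rewrite mul2n -addnn [X in (_ + (X + _))%N]exchange_big /=.
    rewrite -big_split /= -{3}sum1_card -big_split /= -sum_nat_const.
    apply: leq_sum => i iE; rewrite -big_split /= -[leqLHS]sum1_card.
    rewrite (bigD1 i)//= leq_add2l.
    rewrite [leqRHS](bigD1 i)//=; apply: leq_trans (leq_addl _ _).
    apply: leq_sum => k /andP[kE ki]; rewrite ki eq_sym ki /=.
    move: iE kE; rewrite !inE => /andP[iB _] /andP[kB _].
    by have := tot i k iB kB; rewrite eq_sym => /(_ ki); case: (a i k); case: (a k i).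
  move: (leq_trans H' (leq_add (leqnn _) (leq_mul (leqnn 2) H))).
  rewrite -{3}(mul1n #|E|) -mulnDl.
  by case: (posnP #|E|) => [->//|E0]; rewrite leq_pmul2r.
move=> i j iB; rewrite inE iB -ltnNge => big /andP[cij ci1].
apply/exists_inP; apply: contraLR big; rewrite negb_exists_in => /forall_inP H.
rewrite -leqNgt; apply: leq_trans ci1; apply: subset_leq_card.
apply/fintype.subsetP => k; rewrite !inE => /and3P[kB ki aik].
by rewrite /cand ki aik (fintype.subsetP BJ)//= H.
Qed.

End Preferences.

(** * Neighbour rules in R^d *)

Section FiniteTables.
Context {dT : measure_display} {T : measurableType dT}.

(** A random choice among finitely many outcomes that depends on finitely many random
    bits is measurable whatever the rule is; this covers the neighbour index with its tie breaking. *)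
Lemma measurable_table (K : finType) (b : K -> T -> bool) (G : {ffun K -> bool} -> bool) :
  (forall k, measurable_fun setT (b k)) ->
  measurable_fun setT (fun w => G [ffun k => b k w]).
Proof.
move=> mb; apply: (measurable_fun_bool true); rewrite setTI.
rewrite (_ : _ @^-1` _ = \bigcup_(t in [set t | G t])
    \bigcap_(k in [set: K]) [set w | b k w = t k]).
  apply: fin_bigcup_measurable => [|t _]; [exact: finite_finset|]; apply: fin_bigcap_measurable => // k _.
  rewrite (_ : [set w | _] = setT `&` (b k @^-1` [set t k])); last by rewrite setTI.
  exact: mb.
apply/seteqP; split => w /=.
  by move=> Gw; exists [ffun k => b k w] => // k _ /=; rewrite ffunE.
move=> [t Gt wt]; rewrite (_ : [ffun k => b k w] = t)//.
by apply/ffunP => k; rewrite ffunE; exact: wt.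
Qed.

End FiniteTables.

(** What the proof needs of a rule that picks, for each point u, the allowed v of smallest
    gap.  The finitely many colours stand for cones: by [gap_cone], of two points that see u in the
    same cone, the farther one is closer to the nearer one than to u.  [allowed_total] says that of
    two points one is always a candidate for the other, and the last two fields compare the gap with
    the coordinates. *)
Record neighbor_rule (R : realType) (d : nat) := NeighborRule {
  allowed : d.-tuple R -> d.-tuple R -> bool;
  gap : d.-tuple R -> d.-tuple R -> R;
  color_type : finType;
  color : d.-tuple R -> d.-tuple R -> color_type;
  measurable_allowed :
    measurable_fun setT (fun u : d.-tuple R * d.-tuple R => allowed u.1 u.2);
  measurable_gap :
    measurable_fun setT (fun u : d.-tuple R * d.-tuple R => gap u.1 u.2);
  gap_cone : forall u v w : d.-tuple R, u`_0 != v`_0 -> u`_0 != w`_0 ->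
    v`_0 != w`_0 -> allowed v u -> allowed w u -> color u v = color u w ->
    gap w u <= gap v u -> allowed v w && (gap v w < gap v u);
  allowed_total : forall u v : d.-tuple R, u`_0 != v`_0 -> allowed u v || allowed v u;
  gap_ge : forall u v k, allowed u v -> `|tnth u k - tnth v k| <= gap u v;
  gap_le : forall (u v : d.-tuple R) (e : R),
    (forall k, `|tnth u k - tnth v k| <= e) -> gap u v <= d%:R * e
}.

Section Neighbors.
Context {R : realType} {d : nat} (rho : neighbor_rule R d) {n : nat}.
Implicit Types (x : 'I_n -> d.-tuple R) (J : {set 'I_n}) (i j k : 'I_n).

Definition arel x : rel 'I_n := fun i j => allowed rho (x i) (x j).
Definition lrel x : 'I_n -> rel 'I_n :=
  fun i j k => gap rho (x i) (x j) <= gap rho (x i) (x k).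

Definition nbr J x i := nb (arel x) (lrel x) J i.
Definition nbr2 J x i := nb2 (arel x) (lrel x) J i.

(** Almost surely true of a sample, and enough to exclude ties. *)
Definition first_distinct x := forall i j, i != j -> (x i)`_0 != (x j)`_0.

Lemma lrel_refl x i : reflexive (lrel x i). Proof. by move=> j; exact: lexx. Qed.
Lemma lrel_trans x i : transitive (lrel x i).
Proof. by move=> j k l; exact: le_trans. Qed.
Lemma lrel_total x i : total (lrel x i).
Proof. by move=> j k; exact: le_total. Qed.

Lemma nbr_in J x i : i \in J -> nbr J x i \in J.
Proof. exact: nb_in (lrel_refl x) (@lrel_trans x) (lrel_total x) J i. Qed.

Lemma nbr_del J x i j : nbr J x i != j -> nbr (J :\ j)%SET x i = nbr J x i.
Proof. exact: nb_del (lrel_refl x) (@lrel_trans x) (lrel_total x) J i j. Qed.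

Lemma nbr2_del J x i j : nbr J x i != j -> nbr2 J x i != j ->
  nbr2 (J :\ j)%SET x i = nbr2 J x i.
Proof. exact: nb2_del (lrel_refl x) (@lrel_trans x) (lrel_total x) J i j. Qed.

Lemma nbr2E J x i : nbr2 J x i = nbr (J :\ nbr J x i)%SET x i.
Proof. by []. Qed.

Lemma nbr2_in J x i : i \in J -> nbr2 J x i \in J.
Proof.
move=> iJ; rewrite nbr2E; have [E|E] := eqVneq (nbr J x i) i.
  by rewrite E /nbr nb_self; exact: nbr_in.
have : i \in (J :\ nbr J x i)%SET by rewrite in_setD1 eq_sym E.
by move=> /(nbr_in x); rewrite in_setD1 => /andP[].
Qed.

Definition Kdeg := (2 * #|color_type rho|).+1.

(** Without ties, colours are the cones of the rule and the gap plays the part of the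
    distance. *)
Lemma edge2_deg J x j : first_distinct x ->
  (#|[set i in J | edge2 (arel x) (lrel x) J i j]%SET| < Kdeg)%N.
Proof.
move=> sx; rewrite ltnS.
apply: (@edge2_indegree n _ _ R _
  (fun j i => color rho (x j) (x i)) (fun i j => gap rho (x i) (x j))).
move=> {}j i k ik ij kj aij akj cc rr.
have := @gap_cone _ _ rho (x j) (x i) (x k).
rewrite /arel /lrel -ltNge; apply => //; apply: sx => //; by rewrite eq_sym.
Qed.

Lemma nbr_deg J x j : first_distinct x -> (#|[set i in J | nbr J x i == j]%SET| <= Kdeg)%N.
Proof.
move=> sx; apply: leq_trans (_ : #|([set j] :|: [set i in J | edge2 (arel x) (lrel x) J i j])%SET| <= _)%N.
  apply: subset_leq_card; apply/fintype.subsetP => i; rewrite !inE => /andP[iJ /eqP <-].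
  have [E|E] := eqVneq (nbr J x i) i; first by [].
  by rewrite iJ /=; exact: nb_edge2 (lrel_refl x) (@lrel_trans x) (lrel_total x) J i E.
by apply: leq_trans (leq_card_setU _ _) _; rewrite cards1 add1n; exact: edge2_deg.
Qed.

Lemma nbr2_deg J x j : first_distinct x -> (#|[set i in J | nbr2 J x i == j]%SET| <= Kdeg)%N.
Proof.
move=> sx; apply: leq_trans (_ : #|([set j] :|: [set i in J | edge2 (arel x) (lrel x) J i j])%SET| <= _)%N.
  apply: subset_leq_card; apply/fintype.subsetP => i; rewrite !inE => /andP[iJ /eqP <-].
  have [E|E] := eqVneq (nbr2 J x i) i; first by [].
  by rewrite iJ /=; exact: nb2_edge2 (lrel_refl x) (@lrel_trans x) (lrel_total x) J i E.
by apply: leq_trans (leq_card_setU _ _) _; rewrite cards1 add1n; exact: edge2_deg.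
Qed.

Lemma nbr_ext J x x' i : i \in J -> {in J, x =1 x'} -> nbr J x i = nbr J x' i.
Proof.
move=> iJ xx'; rewrite /nbr /nb; congr odflt.
have cE k : cand (arel x) J i k = cand (arel x') J i k.
  by rewrite /cand /arel; case kJ : (k \in J) => //=; rewrite !xx'.
apply: eq_pick => k /=; rewrite cE; case ck : (cand _ _ _ _) => //=.
apply: eq_forallb => l; rewrite cE; case cl : (cand _ _ _ _) => //=.
move: ck cl; rewrite /cand => /and3P[kJ _ _] /and3P[lJ _ _].
by rewrite /lrel !xx'.
Qed.

Lemma nbr2_ext J x x' i : i \in J -> {in J, x =1 x'} -> nbr2 J x i = nbr2 J x' i.
Proof.
move=> iJ xx'; rewrite !nbr2E (nbr_ext iJ xx').
have [E|E] := eqVneq (nbr J x' i) i.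
  by rewrite E /nbr !nb_self; exact: nbr_ext.
apply: nbr_ext; first by rewrite in_setD1 eq_sym E.
by move=> k; rewrite in_setD1 => /andP[_]; exact: xx'.
Qed.

(** The neighbour index depends on the sample through finitely many comparisons. *)
Lemma measurable_pref dT (T : measurableType dT) (f : T -> 'I_n -> d.-tuple R)
    (H : rel 'I_n -> ('I_n -> rel 'I_n) -> bool) :
  (forall i, measurable_fun setT (fun w => f w i)) ->
  measurable_fun setT (fun w => H (arel (f w)) (lrel (f w))).
Proof.
move=> mf; pose K : finType := ('I_n * 'I_n + 'I_n * 'I_n * 'I_n)%type.
pose b (k : K) (w : T) := match k with
  | inl (i, j) => arel (f w) i j | inr (i, j, k) => lrel (f w) i j k end.
pose G (t : {ffun K -> bool}) :=
  H (fun i j => t (inl (i, j))) (fun i j k => t (inr (i, j, k))).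
have mp i j : measurable_fun setT (fun w => (f w i, f w j)).
  exact: measurable_fun_pair.
have mg i j : measurable_fun setT (fun w => gap rho (f w i) (f w j)).
  exact: (measurableT_comp (@measurable_gap _ _ rho) (mp i j)).
have -> : (fun w => H (arel (f w)) (lrel (f w))) = fun w => G [ffun k => b k w].
  apply/funext => w; rewrite /G; congr H.
    by apply/funext => i; apply/funext => j; rewrite ffunE.
  by apply/funext => i; apply/funext => j; apply/funext => k; rewrite ffunE.
apply: measurable_table => -[[i j]|[[i j] k]] /=.
  exact: (measurableT_comp (@measurable_allowed _ _ rho) (mp i j)).
by apply: measurable_fun_ler.
Qed.

End Neighbors.

(** * Variance of local sums *)

Lemma sum_cst_ord (R : pzRingType) n (x : R) : \sum_(i < n) x = n%:R * x.
Proof. by rewrite sumr_const card_ord mulr_natl. Qed.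

Lemma leq_card_bigcup (I K : finType) (A : {set I}) (F : I -> {set K}) b :
  (forall i, i \in A -> (#|F i| <= b)%N) ->
  (#|(\bigcup_(i in A) F i)%SET| <= #|A| * b)%N.
Proof.
move=> Fb; rewrite -sum_nat_const.
elim/big_rec2: _ => [|i s B iA IH]; first by rewrite cards0.
by apply: leq_trans (leq_card_setU _ _) _; rewrite leq_add// Fb.
Qed.

Lemma bmf_select (R : realType) dT (T : measurableType dT) (K : finType)
    (c : T -> K) (F : K -> T -> R) :
  (forall r, measurable_fun setT (fun w => c w == r)) ->
  (forall r, bmf (F r)) -> bmf (fun w => F (c w) w).
Proof.
move=> mc bF; rewrite (_ : (fun w => _) = fun w => \sum_r (c w == r)%:R * F r w).
  by apply: bmf_sum => r; apply: bmfM => //; exact: bmf_bool.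
apply/funext => w; rewrite (bigD1 (c w))//= eqxx mul1r big1 ?addr0// => r.
by rewrite eq_sym => /negbTE ->; rewrite mul0r.
Qed.

Section LocalSums.
Context {dT : measure_display} {T : measurableType dT} {R : realType}.
Variable P : probability T R.
Context {d : nat}.
Local Notation S := (d.-tuple R * R)%type.
Variables (Z : nat -> T -> S) (Z0 : T -> S).
Hypothesis mZ : forall i, measurable_fun setT (Z i).
Hypothesis mZ0 : measurable_fun setT Z0.
Hypothesis copies : forall i, identically_distributed P (Z i) Z0.
Hypothesis indep : mutually_independent P Z.
Variable rho : neighbor_rule R d.

Local Notation EZ := (En P Z).
Local Notation K := (Kdeg rho).

Definition xs n (z : n.-tuple S) (i : 'I_n) : d.-tuple R := (tnth z i).1.
Definition sep n (z : n.-tuple S) := first_distinct (xs z).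

Hypothesis sep_ae : forall n, {ae P, forall w, sep (sample Z n w)}.

Definition nn n J (z : n.-tuple S) i := nbr rho J (xs z) i.
Definition nn2 n J (z : n.-tuple S) i := nbr2 rho J (xs z) i.
Local Notation N := nn.
Local Notation N2 := nn2.

Lemma xs_upd_notin n (J : {set 'I_n}) (z : n.-tuple S) j s : j \notin J ->
  {in J, xs (upd z j s) =1 xs z}.
Proof.
by move=> jJ i iJ; rewrite /xs tnth_upd; case: eqP => // ij; rewrite -ij iJ in jJ.
Qed.

Lemma N_local n (J : {set 'I_n}) (z : n.-tuple S) i j s : i \in J -> j \notin J ->
  N J (upd z j s) i = N J z i.
Proof. by move=> iJ jJ; apply: nbr_ext => //; exact: xs_upd_notin. Qed.

Lemma N2_local n (J : {set 'I_n}) (z : n.-tuple S) i j s : i \in J -> j \notin J ->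
  N2 J (upd z j s) i = N2 J z i.
Proof. by move=> iJ jJ; apply: nbr2_ext => //; exact: xs_upd_notin. Qed.

Lemma xs_upd_same n (z : n.-tuple S) j s : s.1 = xs z j -> xs (upd z j s) = xs z.
Proof.
by move=> sE; apply/funext => i; rewrite /xs tnth_upd; case: eqP => // ->.
Qed.

Lemma measurable_xs n i : measurable_fun setT (fun z : n.-tuple S => xs z i).
Proof. by apply: measurableT_comp => //; exact: measurable_tnth. Qed.

Lemma measurable_N n J i r : measurable_fun setT (fun z : n.-tuple S => N J z i == r).
Proof.
apply: (measurable_pref rho (fun a le => nb a le J i == r)) => k.
exact: measurable_xs.
Qed.

Lemma measurable_N2 n J i r : measurable_fun setT (fun z : n.-tuple S => N2 J z i == r).
Proof.
apply: (measurable_pref rho (fun a le => nb2 a le J i == r)) => k.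
exact: measurable_xs.
Qed.

Lemma bmf_tnth n (f : S -> R) i : bmf f -> bmf (fun z : n.-tuple S => f (tnth z i)).
Proof. by move=> bf; apply: bmf_comp => //; exact: measurable_tnth. Qed.

Lemma bmf_tnth2 n (f : S -> S -> R) i j : bmf (fun u : S * S => f u.1 u.2) ->
  bmf (fun z : n.-tuple S => f (tnth z i) (tnth z j)).
Proof.
move=> bf; apply: (bmf_comp (g := fun z : n.-tuple S => (tnth z i, tnth z j)) bf).
by apply: measurable_fun_pair; exact: measurable_tnth.
Qed.

(** Deleting j removes one term and alters at most m others, each by at most 2c. *)
Lemma local_sum_del n (th : {set 'I_n} -> 'I_n -> R) (j : 'I_n) (c : R) (m : nat) :
  (forall (J : {set 'I_n}) i, i \in J -> `|th J i| <= c) ->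
  (#|[set i in [set~ j] | th [set: 'I_n] i != th [set~ j] i]%SET| <= m)%N ->
  `|\sum_i th [set: 'I_n]%SET i - \sum_(i in [set~ j]%SET) th [set~ j]%SET i|
    <= c + (c + c) * m%:R.
Proof.
move=> thc cardm.
have c0 : 0 <= c by apply: le_trans (thc [set: 'I_n]%SET j _); rewrite ?finset.in_setT.
rewrite (bigD1 j)//= (eq_bigl (fun i => i \in [set~ j]%SET)); last first.
  by move=> i; rewrite !inE.
rewrite -addrA -sumrB (le_trans (ler_normD _ _))// lerD ?thc ?finset.in_setT//.
set A := [set i in _ | _]%SET in cardm.
rewrite (bigID (fun i => i \in A))/= addrC big1 ?add0r; last first.
  move=> i /andP[ij]; rewrite inE ij /= negbK => /eqP ->; exact: subrr.
apply: le_trans (ler_norm_sum _ _ _) _.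
apply: (@le_trans _ _ (\sum_(i in A) (c + c))).
  rewrite [leLHS](eq_bigl (fun i => i \in A)); last first.
    by move=> i; rewrite !inE; case: (i == j).
  apply: ler_sum => i; rewrite inE => /andP[ij _].
  by rewrite (le_trans (ler_normB _ _))// lerD// thc ?finset.in_setT.
rewrite sumr_const -(mulr_natr (c + c)) ler_wpM2l ?addr_ge0//. by rewrite ler_nat.
Qed.

Definition local_bound (c : R) (m : nat) := c + (c + c) * m%:R.

(** The sum that is rebuilt from scratch without the point j does not depend on it, and
    it differs from the full sum by a constant; this is the Efron-Stein inequality with that choice.
    The terms th J i are indexed by the set J of points present. *)
Lemma Var_local_sum n (th : {set 'I_n} -> 'I_n -> n.-tuple S -> R) (c : R) (m : nat) :
  0 <= c ->
  (forall J i, bmf (th J i)) ->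
  (forall (J : {set 'I_n}) i j, i \in J -> j \notin J -> indep_of j (th J i)) ->
  (forall z, sep z -> forall (J : {set 'I_n}) i, i \in J -> `|th J i z| <= c) ->
  (forall z, sep z -> forall j,
    (#|[set i in [set~ j] | th [set: 'I_n] i z != th [set~ j] i z]%SET| <= m)%N) ->
  Var P (fun w => \sum_i th [set: 'I_n]%SET i (sample Z n w)) <=
    n%:R * local_bound c m ^+ 2.
Proof.
move=> c0 bth ith thc thm.
pose Phi z := \sum_i th [set: 'I_n]%SET i z.
pose D j z := \sum_(i in [set~ j]%SET) th [set~ j]%SET i z.
have bPhi : bmf Phi by apply: bmf_sum => i; exact: bth.
have bD j : bmf (D j) by apply: bmf_sum => i; exact: bth.
have iD j : indep_of j (D j).
  move=> z s; apply: eq_bigr => i ij; rewrite ith//.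
  by rewrite !inE eqxx.
apply: le_trans (efron_stein mZ mZ0 copies indep bPhi bD iD) _.
have -> : n%:R * local_bound c m ^+ 2 = \sum_(j < n) local_bound c m ^+ 2.
  by rewrite sumr_const card_ord mulr_natl.
apply: ler_sum => j _.
rewrite /En -[leRHS](Ex_cst P); apply: Ex_le_ae.
- by apply: bmfX; apply: bmfB; exact: bmf_sample.
- exact: bmf_cst.
apply: filterS (sep_ae n) => w sw.
rewrite -[leLHS]real_normK ?num_real// ler_sqr ?nnegrE//; last first.
  by rewrite addr_ge0// mulr_ge0// addr_ge0.
apply: (@local_sum_del n (fun J i => th J i (sample Z n w))).
  by move=> J i iJ; exact: thc.
exact: thm.
Qed.

Lemma N_deg n (J : {set 'I_n}) (z : n.-tuple S) j : sep z -> (#|[set i in J | N J z i == j]%SET| <= K)%N.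
Proof. exact: nbr_deg. Qed.

Lemma N2_deg n (J : {set 'I_n}) (z : n.-tuple S) j : sep z -> (#|[set i in J | N2 J z i == j]%SET| <= K)%N.
Proof. exact: nbr2_deg. Qed.

Lemma N_del n (J : {set 'I_n}) (z : n.-tuple S) i j : N J z i != j -> N (J :\ j)%SET z i = N J z i.
Proof. exact: nbr_del. Qed.

Lemma N_delC n (z : n.-tuple S) i j : N [set: 'I_n]%SET z i != j ->
  N [set~ j]%SET z i = N [set: 'I_n]%SET z i.
Proof. by rewrite -finset.setTD; exact: N_del. Qed.

Lemma N2_delC n (z : n.-tuple S) i j : N [set: 'I_n]%SET z i != j ->
  N2 [set: 'I_n]%SET z i != j -> N2 [set~ j]%SET z i = N2 [set: 'I_n]%SET z i.
Proof. by rewrite -finset.setTD; exact: nbr2_del. Qed.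

(** The second neighbour is the neighbour after deletion of the first, which is what the
    points attached to a deleted point turn to. *)
Lemma N2E n (z : n.-tuple S) i :
  N2 [set: 'I_n]%SET z i = N [set~ N [set: 'I_n]%SET z i]%SET z i.
Proof. by rewrite /nn2 nbr2E -finset.setTD. Qed.

Lemma Var_chain_sum n (F : 'I_n -> 'I_n -> 'I_n -> n.-tuple S -> R) (c : R) :
  0 <= c -> (forall i r s, bmf (F i r s)) ->
  (forall i r s j, j != i -> j != r -> j != s -> indep_of j (F i r s)) ->
  (forall z, sep z -> forall i r s, `|F i r s z| <= c) ->
  Var P (fun w => let z := sample Z n w in
    \sum_i F i (N [set: 'I_n]%SET z i) (N2 [set: 'I_n]%SET z i) z) <=
  n%:R * local_bound c (K + K) ^+ 2.
Proof.
move=> c0 bF iF Fc.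
apply: (@Var_local_sum n (fun J i z => F i (N J z i) (N2 J z i) z)) => //.
- move=> J i.
  apply: (@bmf_select _ _ _ _ (N J ^~ i) (fun r z => F i r (N2 J z i) z)).
    by move=> r; exact: measurable_N.
  move=> r; apply: (@bmf_select _ _ _ _ (N2 J ^~ i) (fun s => F i r s)) => //.
  by move=> s; exact: measurable_N2.
- move=> J i j iJ jJ z s; rewrite N_local// N2_local//.
  have jk k : k \in J -> j != k by apply: contraTneq => <-.
  rewrite iF// jk//; first exact: nbr_in.
  exact: nbr2_in.
- by move=> z sz J i iJ; exact: Fc.
move=> z sz j.
apply: leq_trans (leq_add (N_deg [set: 'I_n]%SET j sz) (N2_deg [set: 'I_n]%SET j sz)).
apply: leq_trans (leq_card_setU _ _); apply: subset_leq_card.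
apply/fintype.subsetP => i; rewrite !inE => /andP[ij].
apply: contraR; rewrite negb_or => /andP[n1 n2].
by rewrite N_delC// N2_delC.
Qed.

End LocalSums.

(** * The Stein identity for sums over neighbour pairs *)

Section SteinIdentity.
Context {dT : measure_display} {T : measurableType dT} {R : realType}.
Variable P : probability T R.
Context {d : nat}.
Local Notation S := (d.-tuple R * R)%type.
Variables (Z : nat -> T -> S) (Z0 : T -> S).
Hypothesis mZ : forall i, measurable_fun setT (Z i).
Hypothesis mZ0 : measurable_fun setT Z0.
Hypothesis copies : forall i, identically_distributed P (Z i) Z0.
Hypothesis indep : mutually_independent P Z.
Variable rho : neighbor_rule R d.
Hypothesis sep_ae : forall n, {ae P, forall w, sep (sample Z n w)}.

Local Notation EZ := (En P Z).
Local Notation K := (Kdeg rho).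
Local Notation N := (nn rho).
Local Notation N2 := (nn2 rho).

(** Independence of the response of j alone: neighbours depend only on the covariates,
    so this survives where independence of the whole point j would not. *)
Definition indep_of_y n (j : 'I_n) (Phi : n.-tuple S -> R) :=
  forall z s, s.1 = xs z j -> Phi (upd z j s) = Phi z.

Variables (a : S -> S -> R) (l : S -> R) (c : R).
Hypothesis ba : bmf (fun u : S * S => a u.1 u.2).
Hypothesis bl : bmf l.
Hypothesis ac : forall s t, `|a s t| <= c.
Hypothesis lc : forall s, `|l s| <= c.
Hypothesis l0 : Ex P (fun w => l (Z0 w)) = 0.
Hypothesis a0 : forall n (i r : 'I_n) Psi, i != r -> bmf Psi ->
  indep_of_y i Psi -> indep_of_y r Psi ->
  EZ (fun z => a (tnth z i) (tnth z r) * Psi z) = 0.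

Let c0 : 0 <= c. Proof. exact: le_trans (lc point). Qed.

Section Terms.
Variable n : nat.
Implicit Types (J : {set 'I_n}) (z : n.-tuple S) (i j k : 'I_n).

(** A point without neighbour is its own neighbour; its pair term is set to 0. *)
Definition aij z i j := if j == i then 0 else a (tnth z i) (tnth z j).
Definition aN J z i := aij z i (N J z i).
Definition aN2 J z i := aij z i (N2 J z i).

(** The pairs {i, N i} and {k, N k} have a common point. *)
Definition sh J z i k := [|| k == i, k == N J z i, N J z k == i | N J z k == N J z i].

Lemma bmf_aij i j : bmf (fun z => aij z i j).
Proof. by rewrite /aij; case: eqP => _; [exact: bmf_cst|exact: bmf_tnth2]. Qed.

Lemma bmf_aN J i : bmf (fun z => aN J z i).
Proof.
apply: (@bmf_select _ _ _ _ (N J ^~ i) (fun r z => aij z i r)).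
  by move=> r; exact: measurable_N.
by move=> r; exact: bmf_aij.
Qed.

Lemma aij_le z i j : `|aij z i j| <= c.
Proof. by rewrite /aij; case: eqP => _; rewrite ?normr0. Qed.

Lemma aN_le J z i : `|aN J z i| <= c. Proof. exact: aij_le. Qed.

Lemma aij_indep i r j : j != i -> j != r -> indep_of j (fun z => aij z i r).
Proof.
move=> ji jr z s; rewrite /aij !tnth_upd.
by rewrite [i == j]eq_sym (negbTE ji) [r == j]eq_sym (negbTE jr).
Qed.

Lemma aN_local J i j s z : i \in J -> j \notin J -> aN J (upd z j s) i = aN J z i.
Proof.
move=> iJ jJ; rewrite /aN N_local//.
have jk k : k \in J -> j != k by apply: contraTneq => <-.
by rewrite aij_indep// jk// nbr_in.
Qed.

Lemma measurable_sh J i k : measurable_fun setT (fun z => sh J z i k).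
Proof.
apply: (measurable_pref rho (fun b le => [|| k == i, k == nb b le J i,
  nb b le J k == i | nb b le J k == nb b le J i])) => m.
exact: measurable_xs.
Qed.

Lemma sh_local J i k j s z : i \in J -> k \in J -> j \notin J ->
  sh J (upd z j s) i k = sh J z i k.
Proof. by move=> iJ kJ jJ; rewrite /sh !N_local. Qed.

Lemma sh_sym J z i k : sh J z i k = sh J z k i.
Proof.
rewrite /sh [k == i]eq_sym [N J z k == N J z i]eq_sym.
by rewrite [k == N J z i]eq_sym [N J z k == i]eq_sym; case: (i == k) => //=; rewrite orbCA.
Qed.

Definition Ksh := (2 + (K + K))%N.

(** A pair meeting {k, N k} either has its source among the two points or its target
    there, and in-degrees are at most K. *)
Lemma sh_deg J z k : sep z -> (#|[set i in J | sh J z i k]%SET| <= Ksh)%N.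
Proof.
move=> sz; pose A1 := [set k; N J z k]%SET.
pose A2 := ([set i in J | N J z i == k] :|: [set i in J | N J z i == N J z k])%SET.
apply: (@leq_trans #|(A1 :|: A2)%SET|).
  apply: subset_leq_card; apply/fintype.subsetP => i; rewrite !inE => /andP[iJ].
  rewrite iJ /= /sh [k == i]eq_sym [k == _]eq_sym [N J z k == i]eq_sym.
  rewrite [N J z k == _]eq_sym.
  by case: (i == k) => //=; case: (i == N J z k); rewrite ?orbT//= orbF.
apply: leq_trans (leq_card_setU _ _) _; apply: leq_add.
  by rewrite cards2; case: eqP.
by apply: leq_trans (leq_card_setU _ _) _; apply: leq_add; exact: N_deg.
Qed.

(** The part of H in which two pair terms meet; it looks at neighbours of neighbours, so its
    deletion count is the one of [th1_changed]. *)
Definition th1 J i z := aN J z i * \sum_(k in J) (sh J z i k)%:R * aN J z k.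

Lemma bmf_th1 J i : bmf (th1 J i).
Proof.
apply: bmfM; first exact: bmf_aN.
apply: bmf_sum => k; apply: bmfM; last exact: bmf_aN.
exact: bmf_bool (measurable_sh J i k).
Qed.

Lemma sh_sum_le J z i : sep z -> i \in J ->
  `|\sum_(k in J) (sh J z i k)%:R * aN J z k| <= Ksh%:R * c.
Proof.
move=> sz iJ; apply: le_trans (ler_norm_sum _ _ _) _.
apply: (@le_trans _ _ (\sum_(k in [set k in J | sh J z i k]%SET) c)).
  rewrite [leLHS](bigID (fun k => sh J z i k))/= addrC big1 ?add0r; last first.
    by move=> k /andP[_ /negbTE ->]; rewrite mul0r normr0.
  rewrite [leRHS](eq_bigl (fun k => (k \in J) && sh J z i k)); last first.
    by move=> k; rewrite inE.
  by apply: ler_sum => k /andP[_ ->]; rewrite mul1r aN_le.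
rewrite sumr_const -(mulr_natl c) ler_wpM2r// ler_nat.
apply: leq_trans (sh_deg J i sz); apply: subset_leq_card.
by apply/fintype.subsetP => k; rewrite !inE sh_sym.
Qed.

Definition th1_bound := (K + (1 + K) * (Ksh + Ksh))%N.

(** Deleting j changes the term at i only if i is attached to j, or meets a pair that is, or
    starts or stops meeting one of these. *)
Lemma th1_changed z j : sep z ->
  (#|[set i in [set~ j] | th1 [set: 'I_n] i z != th1 [set~ j] i z]%SET|
     <= th1_bound)%N.
Proof.
move=> sz; set J := [set: 'I_n]%SET; set J' := [set~ j]%SET.
pose Q := (j |: [set k in J | N J z k == j])%SET.
pose F k := ([set i in J | sh J z i k] :|: [set i in J' | sh J' z i k])%SET.
have KQ : (#|Q| <= 1 + K)%N.
  by apply: leq_trans (leq_card_setU _ _) _; rewrite cards1 leq_add2l; exact: N_deg.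
have KF k : k \in Q -> (#|F k| <= Ksh + Ksh)%N.
  by move=> _; apply: leq_trans (leq_card_setU _ _) _; apply: leq_add; exact: sh_deg.
apply: (@leq_trans #|([set i in J | N J z i == j] :|: \bigcup_(k in Q) F k)%SET|).
  apply: subset_leq_card; apply/fintype.subsetP => i.
  rewrite 2!inE => /andP[ij]; apply: contraR; rewrite inE negb_or.
  rewrite inE finset.in_setT /= => /andP[nij nF].
  have nsh k : k \in Q -> (sh J z i k = false) /\ (sh J' z i k = false).
    move=> kQ; have : i \notin F k.
      by apply: contra nF => iF; apply/finset.bigcupP; exists k.
    rewrite inE negb_or; rewrite inE finset.in_setT /= inE.
    by rewrite ?inE; move: ij; rewrite inE => -> /= /andP[/negbTE -> /negbTE ->].
  rewrite /th1 /aN (N_delC nij); apply/eqP; congr (_ * _).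
  rewrite big_mkcond [RHS]big_mkcond; apply: eq_bigr => k _.
  rewrite !inE /=; have [->|kj] := eqVneq k j.
    by rewrite (nsh j _).1 ?mul0r// !inE eqxx.
  have [Nk|Nk] := eqVneq (N J z k) j.
    have kQ : k \in Q by rewrite !inE Nk eqxx orbT.
    by rewrite (nsh k kQ).1 (nsh k kQ).2 !mul0r.
  by rewrite /sh (N_delC nij) (N_delC Nk).
apply: leq_trans (leq_card_setU _ _) _; apply: leq_add; first exact: N_deg.
by apply: leq_trans (leq_card_bigcup KF) _; rewrite leq_mul2r KQ orbT.
Qed.

Lemma Var_th1 : Var P (fun w => \sum_i th1 [set: 'I_n]%SET i (sample Z n w)) <=
  n%:R * local_bound (c * (Ksh%:R * c)) th1_bound ^+ 2.
Proof.
apply: (Var_local_sum mZ mZ0 copies indep sep_ae) => //.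
- by rewrite !mulr_ge0.
- exact: bmf_th1.
- move=> J i j iJ jJ z s; rewrite /th1 aN_local//; congr (_ * _).
  by apply: eq_bigr => k kJ; rewrite sh_local// aN_local.
- by move=> z sz J i iJ; rewrite /th1 normrM ler_pM// ?aN_le// sh_sum_le.
by move=> z sz j; exact: th1_changed.
Qed.

Definition th2 i r s z := aij z i r * (l (tnth z i) + l (tnth z r)) +
  l (tnth z i) * (aij z i r + l (tnth z i)) + l (tnth z r) * (aij z i r - aij z i s).

Definition c2 := 6%:R * (c * c).

Lemma th2_le i r s z : `|th2 i r s z| <= c2.
Proof.
have H (x y : R) : `|x| <= c -> `|y| <= c + c -> `|x * y| <= 2 * (c * c).
  move=> xc yc; rewrite normrM (_ : 2 * (c * c) = c * (c + c)); last by ring.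
  exact: ler_pM.
have D (x y : R) : `|x| <= c -> `|y| <= c -> `|x + y| <= c + c.
  by move=> xc yc; rewrite (le_trans (ler_normD _ _))// lerD.
rewrite /th2 /c2 (_ : 6%:R * _ = 2 * (c * c) + 2 * (c * c) + 2 * (c * c)); last by ring.
rewrite (le_trans (ler_normD _ _))// lerD//.
  rewrite (le_trans (ler_normD _ _))// lerD//; apply: H => //; rewrite ?aij_le//.
    exact: D.
  by apply: D => //; exact: aij_le.
by apply: H => //; apply: D; rewrite ?normrN aij_le.
Qed.

Lemma Var_th2 : Var P (fun w => let z := sample Z n w in
    \sum_i th2 i (N [set: 'I_n]%SET z i) (N2 [set: 'I_n]%SET z i) z) <=
  n%:R * local_bound c2 (K + K) ^+ 2.
Proof.
apply: (Var_chain_sum mZ mZ0 copies indep rho sep_ae (F := th2) (c := c2)) => //.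
- by rewrite /c2 !mulr_ge0.
- move=> i r s; apply: bmfD; [apply: bmfD|]; apply: bmfM.
  + exact: bmf_aij.
  + by apply: bmfD; exact: bmf_tnth.
  + exact: bmf_tnth.
  + by apply: bmfD; [exact: bmf_aij|exact: bmf_tnth].
  + exact: bmf_tnth.
  + by apply: bmfB; exact: bmf_aij.
- move=> i r s j ji jr js z t; rewrite /th2 !aij_indep// !tnth_upd.
  by rewrite [i == j]eq_sym [r == j]eq_sym (negbTE ji) (negbTE jr).
by move=> z _ i r s; exact: th2_le.
Qed.

Local Notation JT := [set: 'I_n]%SET.

Definition W z := \sum_i (aN JT z i + l (tnth z i)).
(** W rebuilt without the point j. *)
Definition Wdel j z := \sum_(i in [set~ j]%SET) (aN [set~ j]%SET z i + l (tnth z i)).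
(** W without all pieces that involve the response of i or of N i. *)
Definition Wnbh i z := \sum_k (~~ sh JT z i k)%:R * aN JT z k +
  \sum_k ((k != i) && (k != N JT z i))%:R * l (tnth z k).
(** The sum of the products of each term of W with the pieces of W that are removed for it;
    the form given here, by [H_eq] equal to that sum, is the one that shows it to be local. *)
Definition H z := \sum_i th1 JT i z + \sum_i th2 i (N JT z i) (N2 JT z i) z.

Lemma bmf_W : bmf W.
Proof. by apply: bmf_sum => i; apply: bmfD; [exact: bmf_aN|exact: bmf_tnth]. Qed.

Lemma bmf_Wdel j : bmf (Wdel j).
Proof. by apply: bmf_sum => i; apply: bmfD; [exact: bmf_aN|exact: bmf_tnth]. Qed.

Lemma bmf_Wnbh i : bmf (Wnbh i).
Proof.
apply: bmfD; apply: bmf_sum => k; apply: bmfM.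
- apply: bmf_bool; apply: (measurable_pref rho (fun b le => ~~ [|| k == i,
    k == nb b le JT i, nb b le JT k == i | nb b le JT k == nb b le JT i])) => m.
  exact: measurable_xs.
- exact: bmf_aN.
- apply: bmf_bool; apply: (measurable_pref rho (fun b le =>
    (k != i) && (k != nb b le JT i))) => m.
  exact: measurable_xs.
- exact: bmf_tnth.
Qed.

Lemma bmf_th1s : bmf (fun z => \sum_i th1 JT i z).
Proof. by apply: bmf_sum => i; exact: bmf_th1. Qed.

Lemma bmf_th2 i r s : bmf (th2 i r s).
Proof.
apply: bmfD; [apply: bmfD|]; apply: bmfM.
+ exact: bmf_aij.
+ by apply: bmfD; exact: bmf_tnth.
+ exact: bmf_tnth.
+ by apply: bmfD; [exact: bmf_aij|exact: bmf_tnth].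
+ exact: bmf_tnth.
+ by apply: bmfB; exact: bmf_aij.
Qed.

Lemma bmf_th2s : bmf (fun z => \sum_i th2 i (N JT z i) (N2 JT z i) z).
Proof.
apply: bmf_sum => i.
apply: (@bmf_select _ _ _ _ (N JT ^~ i) (fun r z => th2 i r (N2 JT z i) z)).
  by move=> r; exact: measurable_N.
move=> r; apply: (@bmf_select _ _ _ _ (N2 JT ^~ i) (fun s => th2 i r s)).
  by move=> s; exact: measurable_N2.
by move=> s; exact: bmf_th2.
Qed.

Lemma bmf_H : bmf H.
Proof. by apply: bmfD; [exact: bmf_th1s|exact: bmf_th2s]. Qed.

Lemma aN_del z i j : i != j ->
  aN JT z i - aN [set~ j]%SET z i = (N JT z i == j)%:R * (aN JT z i - aN2 JT z i).
Proof.
move=> ij; have [E|E] := eqVneq (N JT z i) j; last first.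
  by rewrite mul0r /aN (N_delC E) subrr.
by rewrite mul1r /aN2 N2E E.
Qed.

Lemma aN2_self z i : N JT z i = i -> aN2 JT z i = aN JT z i.
Proof.
move=> E; have E2 : N2 JT z i = i by exact: nb2_self.
by rewrite /aN2 /aN E2 E.
Qed.

Lemma W_del z j : W z - Wdel j z = aN JT z j + l (tnth z j) +
  \sum_i (N JT z i == j)%:R * (aN JT z i - aN2 JT z i).
Proof.
rewrite /W (bigD1 j)//= -addrA; congr (_ + _).
rewrite (eq_bigl (fun i => i \in [set~ j]%SET)); last by move=> i; rewrite !inE.
rewrite -sumrB [RHS](bigD1 j)//= [X in X + _](_ : _ = 0) ?add0r; last first.
  have [E|_] := eqVneq (N JT z j) j; last by rewrite mul0r.
  by rewrite aN2_self// subrr mulr0.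
rewrite [RHS](eq_bigl (fun i => i \in [set~ j]%SET)); last by move=> i; rewrite !inE.
apply: eq_bigr => i; rewrite !inE => ij; rewrite -aN_del//; lra.
Qed.

(** Exchanging the order of summation turns the points attached to j into the neighbour
    of i. *)
Lemma sum_l_W_del z : \sum_j l (tnth z j) * (W z - Wdel j z) =
  \sum_i (l (tnth z i) * (aN JT z i + l (tnth z i)) +
          l (tnth z (N JT z i)) * (aN JT z i - aN2 JT z i)).
Proof.
under eq_bigr do rewrite W_del mulrDr.
rewrite !big_split /=; congr (_ + _).
under eq_bigr do rewrite mulr_sumr.
rewrite exchange_big /=; apply: eq_bigr => i _.
rewrite (bigD1 (N JT z i))//= eqxx mul1r big1 ?addr0// => j.
by rewrite eq_sym => /negbTE ->; rewrite mul0r mulr0.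
Qed.

Lemma W_nbh z i : N JT z i != i -> W z - Wnbh i z =
  \sum_(k in JT) (sh JT z i k)%:R * aN JT z k + (l (tnth z i) + l (tnth z (N JT z i))).
Proof.
move=> Ni; rewrite /W /Wnbh big_split /= opprD addrACA -!sumrB; congr (_ + _).
  rewrite [RHS](eq_bigl predT); last by move=> k; rewrite !inE.
  by apply: eq_bigr => k _; case: (sh _ _ _ _); rewrite /= ?mul1r ?mul0r ?subrr ?subr0.
rewrite (bigD1 i)//= eqxx mul0r subr0; congr (_ + _).
rewrite (bigD1 (N JT z i))//= Ni eqxx /= mul0r subr0 big1 ?addr0// => k.
by move=> /andP[-> ->]; rewrite mul1r subrr.
Qed.

Lemma aN_W_nbh z i : aN JT z i * (W z - Wnbh i z) =
  th1 JT i z + aN JT z i * (l (tnth z i) + l (tnth z (N JT z i))).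
Proof.
have [E|E] := eqVneq (N JT z i) i; last by rewrite W_nbh// mulrDr.
by rewrite /th1 /aN /aij E eqxx !mul0r addr0.
Qed.

Lemma H_eq z : H z = \sum_i aN JT z i * (W z - Wnbh i z) +
  \sum_j l (tnth z j) * (W z - Wdel j z).
Proof.
rewrite sum_l_W_del /H; under [X in _ = X + _]eq_bigr do rewrite aN_W_nbh.
rewrite [X in _ = X + _]big_split /= -[RHS]addrA; congr (_ + _).
by rewrite -big_split /=; apply: eq_bigr => i _; rewrite /th2 -[LHS]addrA.
Qed.

Definition Ddel := local_bound (c + c) K.
Definition Dnbh := Ksh%:R * c + (c + c).

Lemma W_del_le z j : sep z -> `|W z - Wdel j z| <= Ddel.
Proof.
move=> sz; apply: (@local_sum_del _ _ (fun J i => aN J z i + l (tnth z i)) j (c + c) K).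
  by move=> J i _; rewrite (le_trans (ler_normD _ _))// lerD// aN_le.
apply: leq_trans (N_deg rho JT j sz); apply: subset_leq_card.
apply/fintype.subsetP => i; rewrite !inE => /andP[ij]; apply: contraR => E.
by rewrite /aN (N_delC E).
Qed.

Lemma W_nbh_le z i : sep z -> N JT z i != i -> `|W z - Wnbh i z| <= Dnbh.
Proof.
move=> sz Ni; rewrite W_nbh// (le_trans (ler_normD _ _))// lerD//.
  by apply: sh_sum_le => //; rewrite finset.in_setT.
by rewrite (le_trans (ler_normD _ _))// lerD.
Qed.

(** The other factor does not depend on the point j, and l has mean 0. *)
Lemma Ex_l_del j (f : R -> R) : bmf (fun z => f (Wdel j z)) ->
  EZ (fun z => l (tnth z j) * f (Wdel j z)) = 0.
Proof.
move=> bf; apply: (En_eq0 mZ mZ0 copies indep (j := j)).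
  by apply: bmfM => //; exact: bmf_tnth.
move=> z; transitivity (Ex P (fun w => l (Z0 w) * f (Wdel j z))); last first.
  rewrite ExZr ?l0 ?mul0r//; exact: bmf_comp.
apply: Ex_ext => w; rewrite tnth_upd eqxx; congr (_ * f _).
have jn : j \notin [set~ j]%SET by rewrite !inE eqxx.
apply: eq_bigr => i ij; rewrite (aN_local _ _ ij jn) tnth_upd.
by move: ij; rewrite !inE => /negbTE ->.
Qed.

Lemma N_upd_same z J i k s : s.1 = xs z k -> N J (upd z k s) i = N J z i.
Proof. by move=> sk; rewrite /nn xs_upd_same. Qed.

Lemma Wnbh_upd z i k s : s.1 = xs z k -> (k == i) || (k == N JT z i) ->
  Wnbh i (upd z k s) = Wnbh i z.
Proof.
move=> sk kin; rewrite /Wnbh; congr (_ + _); apply: eq_bigr => m _.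
  rewrite /sh /aN /aij !N_upd_same// !tnth_upd.
  have [->|mk] := eqVneq m k.
    by case/orP: kin => ->; rewrite ?orbT /= !mul0r.
  have [Em|//] := eqVneq (N JT z m) k.
  by case/orP: kin => /eqP kE; rewrite Em kE eqxx ?orbT /= !mul0r.
rewrite N_upd_same// tnth_upd; have [->|//] := eqVneq m k.
by case/orP: kin => ->; rewrite ?andbF /= !mul0r.
Qed.

(** Splitting according to the value r of N i, which the responses do not influence, the
    centering of a applies for each fixed r. *)
Lemma Ex_aN_nbh i (f : R -> R) : bmf (fun z => f (Wnbh i z)) ->
  EZ (fun z => aN JT z i * f (Wnbh i z)) = 0.
Proof.
move=> bf.
pose Psi r z := (N JT z i == r)%:R * f (Wnbh i z).
have bPsi r : bmf (Psi r).
  by apply: bmfM => //; exact: bmf_bool (measurable_N rho JT i r).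
have H0 r : r != i -> EZ (fun z => a (tnth z i) (tnth z r) * Psi r z) = 0.
  move=> ri; apply: a0; rewrite 1?eq_sym//.
    move=> z s si; rewrite /Psi N_upd_same//; case: eqP => [E|_]; last by rewrite !mul0r.
    by rewrite Wnbh_upd// eqxx.
  move=> z s sr; rewrite /Psi N_upd_same//; case: eqP => [E|_]; last by rewrite !mul0r.
  by rewrite Wnbh_upd// E eqxx orbT.
transitivity (\sum_(r | r != i) EZ (fun z => a (tnth z i) (tnth z r) * Psi r z));
  last by rewrite big1.
rewrite /En -Ex_sum; last first.
  move=> r; apply: (bmf_sample mZ (Phi := fun z => a (tnth z i) (tnth z r) * Psi r z)).
  by apply: bmfM => //; exact: bmf_tnth2.
apply: Ex_ext => w; set z := sample _ _ _.
rewrite /aN /aij; case: eqP => E.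
  rewrite mul0r big1// => r ri; rewrite /Psi E eq_sym (negbTE ri) mul0r mulr0//.
rewrite (bigD1 (N JT z i))/=; last exact/eqP.
rewrite /Psi eqxx mul1r big1 ?addr0// => r /andP[_].
by rewrite eq_sym => /negbTE ->; rewrite mul0r mulr0.
Qed.

End Terms.

Definition stein_const := c * Ddel ^+ 2 + c * Dnbh ^+ 2.

(** Each term of W is orthogonal to f of W with the touching pieces removed; what is left
    is a difference of values of f, and its first order part adds up to f prime of W times H. *)
Lemma stein_taylor n (f f' : R -> R) (L : R) : 0 <= L ->
  (forall Phi : n.-tuple S -> R, bmf Phi -> bmf (fun z => f (Phi z))) ->
  (forall Phi : n.-tuple S -> R, bmf Phi -> bmf (fun z => f' (Phi z))) ->
  (forall x y, `|f y - f x - f' x * (y - x)| <= L * (y - x) ^+ 2) ->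
  `|EZ (fun z : n.-tuple S => W z * f (W z)) - EZ (fun z : n.-tuple S => f' (W z) * H z)| <=
  n%:R * (L * stein_const).
Proof.
move=> L0 bf bf' taylor.
have b1 i : bmf (fun z : n.-tuple S => aN [set: 'I_n]%SET z i * (f (W z) - f (Wnbh i z))).
  apply: bmfM; first exact: bmf_aN.
  by apply: bmfB; apply: bf; [exact: bmf_W|exact: bmf_Wnbh].
have b2 j : bmf (fun z : n.-tuple S => l (tnth z j) * (f (W z) - f (Wdel j z))).
  apply: bmfM; first exact: bmf_tnth.
  by apply: bmfB; apply: bf; [exact: bmf_W|exact: bmf_Wdel].
have EE : EZ (fun z : n.-tuple S => W z * f (W z)) =
    EZ (fun z => \sum_i aN [set: 'I_n]%SET z i * (f (W z) - f (Wnbh i z)) +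
                 \sum_j l (tnth z j) * (f (W z) - f (Wdel j z))).
  have b3 i : bmf (fun z : n.-tuple S => aN [set: 'I_n]%SET z i * f (Wnbh i z)).
    by apply: bmfM; [exact: bmf_aN|apply: bf; exact: bmf_Wnbh].
  have b4 j : bmf (fun z : n.-tuple S => l (tnth z j) * f (Wdel j z)).
    by apply: bmfM; [exact: bmf_tnth|apply: bf; exact: bmf_Wdel].
  pose G z := \sum_i aN [set: 'I_n]%SET z i * f (Wnbh i z) +
              \sum_j l (tnth z j) * f (Wdel j z).
  have bG : bmf G by apply: bmfD; apply: bmf_sum.
  have G0 : EZ G = 0.
    rewrite /En /G ExD; last 2 first.
    - by apply: bmf_sum => i; exact: (bmf_sample mZ (b3 i)).
    - by apply: bmf_sum => i; exact: (bmf_sample mZ (b4 i)).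
    rewrite Ex_sum; last by move=> i; exact: (bmf_sample mZ (b3 i)).
    rewrite Ex_sum; last by move=> i; exact: (bmf_sample mZ (b4 i)).
    rewrite big1 ?add0r => [|i _].
      rewrite big1// => j _; apply: Ex_l_del; apply: bf; exact: bmf_Wdel.
    by apply: Ex_aN_nbh; apply: bf; exact: bmf_Wnbh.
  rewrite -[LHS]subr0 -[in LHS]G0 /En -ExB; last 2 first.
  - apply: (bmf_sample mZ (Phi := fun z => W z * f (W z))).
    by apply: bmfM; [exact: bmf_W|apply: bf; exact: bmf_W].
  - exact: (bmf_sample mZ bG).
  apply: Ex_ext => w; set z := sample _ _ _; rewrite /G {1}/W big_split /= mulrDl.
  rewrite opprD addrACA !mulr_suml -!sumrB.
  by congr (_ + _); apply: eq_bigr => i _; rewrite mulrBr.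
rewrite EE.
pose G1 z := \sum_i aN [set: 'I_n]%SET z i * (f (W z) - f (Wnbh i z)) +
             \sum_j l (tnth z j) * (f (W z) - f (Wdel j z)).
have bG1 : bmf G1 by apply: bmfD; apply: bmf_sum.
have bG2 : bmf (fun z : n.-tuple S => f' (W z) * H z).
  by apply: bmfM; [apply: bf'; exact: bmf_W|exact: bmf_H].
rewrite /En -ExB; [|exact: (bmf_sample mZ bG1)|exact: (bmf_sample mZ bG2)].
have bG : bmf (fun w => G1 (sample Z n w) - f' (W (sample Z n w)) * H (sample Z n w)).
  by apply: bmfB; [exact: (bmf_sample mZ bG1)|exact: (bmf_sample mZ bG2)].
apply: le_trans (Ex_normr P bG) _.
rewrite -[leRHS](Ex_cst P); apply: Ex_le_ae; [exact: bmf_norm|exact: bmf_cst|].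
apply: filterS (sep_ae n) => w sw; set z := sample _ _ _.
rewrite /G1 H_eq mulrDr opprD addrACA !mulr_sumr -!sumrB.
have rem V : `|f (W z) - f V - f' (W z) * (W z - V)| <= L * (W z - V) ^+ 2.
  rewrite -normrN -sqrrN (_ : - (f _ - _ - _) = f V - f (W z) - f' (W z) * (V - W z)).
    by rewrite opprB taylor.
  by ring.
have H0 (x V D : R) : `|x| <= c -> `|W z - V| <= D ->
    `|x * (f (W z) - f V) - f' (W z) * (x * (W z - V))| <= L * (c * D ^+ 2).
  move=> xc VD; rewrite (_ : _ - _ = x * (f (W z) - f V - f' (W z) * (W z - V))); last by ring.
  rewrite normrM mulrCA; apply: ler_pM => //.
  apply: le_trans (rem V) _; rewrite ler_wpM2l// -[leLHS]real_normK ?num_real//.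
  by rewrite ler_sqr// nnegrE (le_trans _ VD).
rewrite /stein_const mulrDr [X in _ <= n%:R * X]addrC mulrDr.
apply: le_trans (ler_normD _ _) _; apply: lerD.
  apply: le_trans (ler_norm_sum _ _ _) _.
  rewrite -sum_cst_ord; apply: ler_sum => i _.
  have [E|E] := eqVneq (nn rho [set: 'I_n]%SET z i) i.
    rewrite /aN /aij E eqxx !mul0r mulr0 subr0 normr0.
    by apply: mulr_ge0 => //; apply: mulr_ge0 => //; exact: sqr_ge0.
  by apply: H0; [exact: aN_le|exact: W_nbh_le].
apply: le_trans (ler_norm_sum _ _ _) _.
rewrite -sum_cst_ord; apply: ler_sum => i _.
by apply: H0; [exact: lc|exact: W_del_le].
Qed.

(** The case f = id, f prime = 1, L = 0 of the expansion. *)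
Lemma En_H n : EZ (fun z : n.-tuple S => H z) = EZ (fun z : n.-tuple S => W z ^+ 2).
Proof.
have := @stein_taylor n id (fun _ => 1) 0 (lexx 0).
rewrite mul0r mulr0 normr_le0 subr_eq0 => H0.
have /eqP E := H0 (fun Phi bPhi => bPhi) (fun _ _ => bmf_cst 1)
  (fun x y => ltac:(by rewrite mul0r mul1r /= subrr normr0)).
rewrite -[RHS]/(EZ (fun z => W z * W z)) E.
by apply: Ex_ext => w; rewrite mul1r.
Qed.

Definition stein_var := 2 * local_bound (c * (Ksh%:R * c)) th1_bound ^+ 2 +
  2 * local_bound c2 (K + K) ^+ 2.

Lemma Var_H n : Var P (fun w => H (sample Z n w)) <= n%:R * stein_var.
Proof.
apply: le_trans (Var_D_le P (bmf_sample mZ (@bmf_th1s n)) (bmf_sample mZ (@bmf_th2s n))) _.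
rewrite /stein_var mulrDr; apply: lerD.
  by rewrite mulrCA ler_wpM2l// Var_th1.
by rewrite mulrCA ler_wpM2l// Var_th2.
Qed.

(** Combine the expansion with the concentration of H around its mean. *)
Lemma stein_identity n (f f' : R -> R) (L c1 : R) : 0 <= L ->
  (forall Phi : n.-tuple S -> R, bmf Phi -> bmf (fun z => f (Phi z))) ->
  (forall Phi : n.-tuple S -> R, bmf Phi -> bmf (fun z => f' (Phi z))) ->
  (forall x y, `|f y - f x - f' x * (y - x)| <= L * (y - x) ^+ 2) ->
  (forall x, `|f' x| <= c1) ->
  `|EZ (fun z : n.-tuple S => W z * f (W z)) -
    EZ (fun z : n.-tuple S => f' (W z)) * EZ (fun z : n.-tuple S => W z ^+ 2)| <=
  n%:R * (L * stein_const) + c1 * Num.sqrt (n%:R * stein_var).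
Proof.
move=> L0 bf bf' taylor f'c.
have bf'W := bf' _ (@bmf_W n); have bHn := @bmf_H n.
rewrite -(subrKA (EZ (fun z : n.-tuple S => f' (W z) * H z))).
apply: le_trans (ler_normD _ _) _; apply: lerD; first exact: stein_taylor.
rewrite -En_H /En -ExZr; last exact: (bmf_sample mZ bf'W).
rewrite -ExB; last 2 first.
- exact: (bmf_sample mZ (bmfM bf'W bHn)).
- by apply: bmfM; [exact: (bmf_sample mZ bf'W)|exact: bmf_cst].
set EHn := Ex P (fun w => H (sample Z n w)).
have bD : bmf (fun w => H (sample Z n w) - EHn).
  by apply: bmfB; [exact: (bmf_sample mZ bHn)|exact: bmf_cst].
apply: le_trans (Ex_normr P _) _.
  apply: bmfB; first exact: (bmf_sample mZ (bmfM bf'W bHn)).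
  by apply: bmfM; [exact: (bmf_sample mZ bf'W)|exact: bmf_cst].
have c10 : 0 <= c1 by exact: le_trans (f'c 0).
apply: (@le_trans _ _ (Ex P (fun w => c1 * `|H (sample Z n w) - EHn|))).
  apply: Ex_le.
  - apply: bmf_norm; apply: bmfB; first exact: (bmf_sample mZ (bmfM bf'W bHn)).
    by apply: bmfM; [exact: (bmf_sample mZ bf'W)|exact: bmf_cst].
  - by apply: bmfM; [exact: bmf_cst|exact: bmf_norm].
  - by move=> w; rewrite -mulrBr normrM ler_wpM2r.
rewrite ExZ; last exact: bmf_norm.
rewrite ler_wpM2l// -(@ger0_norm _ (Ex P _)); last by apply: Ex_ge0 => w.
rewrite -sqrtr_sqr ler_wsqrtr//; apply: le_trans (Ex_CS_abs P bD) _.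
exact: Var_H.
Qed.

End SteinIdentity.

(** * Measurable functions at neighbouring points *)

Section Grid.
Context {R : realType}.

Lemma sum_ltn_ord m k : (\sum_(q < m) (q < k) = minn m k)%N.
Proof.
elim: m => [|m IH]; first by rewrite big_ord0 min0n.
by rewrite big_ord_recr /= IH; case: (ltnP m k) => mk; lia.
Qed.

(** u rounded down to a multiple of 1/(M+1), as a mean of indicators: in this form the grid
    value of a minimum is a sum of products. *)
Definition grid (M : nat) (u : R) : R :=
  M.+1%:R^-1 * \sum_(q < M.+1) (q.+1%:R / M.+1%:R <= u)%R%:R.

Lemma grid_bound M (u : R) : 0 <= u <= 1 -> 0 <= u - grid M u <= M.+1%:R^-1.
Proof.
move=> /andP[u0 u1]; have M0 : (0 : R) < M.+1%:R by rewrite ltr0n.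
pose t := M.+1%:R * u; have t0 : 0 <= t by rewrite mulr_ge0// ltW.
have gE : grid M u = M.+1%:R^-1 * (Num.truncn t)%:R.
  congr (_ * _).
  have qE (q : 'I_M.+1) : ((q.+1%:R / M.+1%:R : R) <= u) = leq q.+1 (Num.truncn t).
    by rewrite truncn_gt_nat ler_pdivrMr// mulrC.
  under eq_bigr do rewrite qE.
  have tM : (Num.truncn t <= M.+1)%N.
    by rewrite truncn_le_nat (@le_lt_trans _ _ M.+1%:R)// ?ltr_nat// /t ler_piMr// ltW.
  by rewrite -natr_sum sum_ltn_ord (minn_idPr tM).
have [t1 t2] := andP (truncn_itv t0).
have uE : u = M.+1%:R^-1 * t by rewrite /t mulKf// gt_eqF.
have -> : u - grid M u = M.+1%:R^-1 * (t - (Num.truncn t)%:R).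
  by rewrite gE mulrBr -uE.
apply/andP; split; first by rewrite mulr_ge0 ?invr_ge0 ?subr_ge0// ltW.
rewrite ler_piMr ?invr_ge0 ?(ltW M0)// lerBlDl.
by rewrite -natr1 in t2; exact: ltW.
Qed.

Lemma grid_min M (u v : R) : grid M (Num.min u v) =
  M.+1%:R^-1 * \sum_(q < M.+1) (q.+1%:R / M.+1%:R <= u)%R%:R * (q.+1%:R / M.+1%:R <= v)%R%:R.
Proof.
congr (_ * _); apply: eq_bigr => q _; rewrite le_min.
by case: (_ <= u); case: (_ <= v); rewrite ?mulr1 ?mulr0.
Qed.

End Grid.

Lemma prob_decreasing_eps d (T : measurableType d) (R : realType) (P : probability T R)
    (F : (set T)^nat) (e : R) : (forall n, measurable (F n)) -> nonincreasing_seq F ->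
  P (\bigcap_n F n) = 0%E -> 0 < e -> exists m, fine (P (F m)) <= e.
Proof.
move=> mF nF F0 e0.
have : P \o F @ \oo --> (0 : \bar R)%E.
  rewrite -F0; apply: (nonincreasing_cvg_mu (mu := P)) => //.
    by rewrite (le_lt_trans (probability_le1 P (mF 0%N)))// ltry.
  exact: bigcapT_measurable.
move=> /fine_cvg /cvgrPdist_le /(_ e e0)[m _ Hm]; exists m.
have := Hm m (leqnn m); rewrite /= sub0r normrN ger0_norm ?fine_ge0//.
Qed.

Section NearestApprox.
Context {dT : measure_display} {T : measurableType dT} {R : realType}.
Variable P : probability T R.
Context {d : nat}.
Local Notation S := (d.-tuple R * R)%type.
Variables (Z : nat -> T -> S) (Z0 : T -> S).
Hypothesis mZ : forall i, measurable_fun setT (Z i).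
Hypothesis mZ0 : measurable_fun setT Z0.
Hypothesis copies : forall i, identically_distributed P (Z i) Z0.
Hypothesis indep : mutually_independent P Z.
Variable rho : neighbor_rule R d.
Hypothesis sep_ae : forall n, {ae P, forall w, sep (sample Z n w)}.
Hypothesis atomless : forall (k : 'I_d) c, P [set w | tnth (Z0 w).1 k = c] = 0%E.

Local Notation EZ := (En P Z).
Local Notation K := (Kdeg rho).

(** The first or the second neighbour; both occur when one point is deleted. *)
Definition nsel n (b : bool) (z : n.-tuple S) (i : 'I_n) : 'I_n :=
  if b then nn rho [set: 'I_n]%SET z i else nn2 rho [set: 'I_n]%SET z i.

Lemma measurable_nsel n b i r : measurable_fun setT (fun z : n.-tuple S => nsel b z i == r).
Proof. by case: b; [exact: measurable_N|exact: measurable_N2]. Qed.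

Lemma nsel_deg n b (z : n.-tuple S) j : sep z -> (#|[set i | nsel b z i == j]%SET| <= K)%N.
Proof.
move=> sz; case: b.
  apply: leq_trans (N_deg rho [set: 'I_n]%SET j sz); apply: subset_leq_card.
  by apply/fintype.subsetP => i; rewrite !inE.
apply: leq_trans (N2_deg rho [set: 'I_n]%SET j sz); apply: subset_leq_card.
by apply/fintype.subsetP => i; rewrite !inE.
Qed.

Lemma nsel_edge2 n b (z : n.-tuple S) i : nsel b z i != i ->
  edge2 (arel rho (xs z)) (lrel rho (xs z)) [set: 'I_n]%SET i (nsel b z i).
Proof.
case: b => /= H; [apply: nb_edge2 => //|apply: nb2_edge2 => //];
  by [exact: lrel_refl|exact: lrel_trans|exact: lrel_total].
Qed.

Lemma En_tnth n (i : 'I_n) (f : S -> R) : bmf f ->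
  EZ (fun z => f (tnth z i)) = Ex P (fun w => f (Z0 w)).
Proof.
move=> bf; rewrite /En.
rewrite [LHS](@Ex_avg _ _ _ _ _ _ _ _ mZ mZ0 copies indep n i (fun z => f (tnth z i)));
  last exact: bmf_tnth.
rewrite -[RHS](Ex_cst P); apply: Ex_ext => w; apply: Ex_ext => w'.
by rewrite tnth_upd eqxx.
Qed.

Lemma bmf_xs n (phi : d.-tuple R -> R) i : bmf phi ->
  bmf (fun z : n.-tuple S => phi (xs z i)).
Proof. by move=> b; apply: bmf_comp => //; exact: measurable_xs. Qed.

Lemma bmf_nsel n b (phi : d.-tuple R -> R) i : bmf phi ->
  bmf (fun z : n.-tuple S => phi (xs z (nsel b z i))).
Proof.
move=> bp; apply: (@bmf_select _ _ _ _ (fun z => nsel b z i) (fun r z => phi (xs z r))).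
  by move=> r; exact: measurable_nsel.
by move=> r; exact: bmf_xs.
Qed.

Definition ndiff b (phi : d.-tuple R -> R) n :=
  EZ (fun z : n.-tuple S => \sum_i `|phi (xs z i) - phi (xs z (nsel b z i))|).

Lemma bmf_ndiff n b (phi : d.-tuple R -> R) : bmf phi ->
  bmf (fun z : n.-tuple S => \sum_i `|phi (xs z i) - phi (xs z (nsel b z i))|).
Proof.
move=> bp; apply: bmf_sum => i; apply: bmf_norm.
by apply: bmfB; [exact: bmf_xs|exact: bmf_nsel].
Qed.

(** Most neighbours are close to their point, but phi is only measurable, so continuity is
    replaced by smallness in the mean. *)
Definition nn_small phi := forall b e, 0 < e ->
  exists n0, forall n, (n0 <= n)%N -> ndiff b phi n <= e * n%:R.

(** Each point is selected at most K times. *)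
Lemma sum_nsel_le n b (z : n.-tuple S) (g : 'I_n -> R) : sep z ->
  (forall i, 0 <= g i) -> \sum_i g (nsel b z i) <= K%:R * \sum_i g i.
Proof.
move=> sz g0; rewrite (partition_big (nsel b z) predT)//= mulr_sumr.
apply: ler_sum => j _.
rewrite (eq_bigr (fun _ => g j)); last by move=> i /eqP ->.
rewrite sumr_const -[leLHS]mulr_natl ler_wpM2r// ler_nat.
apply: leq_trans (nsel_deg b j sz); apply: subset_leq_card.
by apply/fintype.subsetP => i; rewrite !inE.
Qed.

Lemma En_sum_tnth n (phi : d.-tuple R -> R) : bmf phi ->
  EZ (fun z : n.-tuple S => \sum_i phi (xs z i)) = n%:R * Ex P (fun w => phi (Z0 w).1).
Proof.
move=> bp; rewrite /En Ex_sum; last first.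
  by move=> i; apply: (bmf_sample mZ (Phi := fun z => phi (xs z i))); exact: bmf_xs.
rewrite (eq_bigr (fun _ => Ex P (fun w => phi (Z0 w).1))) ?sum_cst_ord// => i _.
by apply: (@En_tnth n i (fun s => phi s.1)); apply: bmf_comp.
Qed.

Lemma ndiff_le n b (phi : d.-tuple R -> R) : bmf phi ->
  ndiff b phi n <= (1 + K%:R) * (n%:R * Ex P (fun w => `|phi (Z0 w).1|)).
Proof.
move=> bp.
have bn : bmf (fun x => `|phi x|) by exact: bmf_norm.
have bs : bmf (fun z : n.-tuple S => \sum_i `|phi (xs z i)|).
  by apply: bmf_sum => i; apply: (@bmf_xs n (fun x => `|phi x|)).
rewrite -(@En_sum_tnth n _ bn) /ndiff /En -ExZ; last exact: (bmf_sample mZ bs).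
apply: Ex_le_ae.
- exact: (bmf_sample mZ (bmf_ndiff _ _ bp)).
- by apply: bmfM; [exact: bmf_cst|exact: (bmf_sample mZ bs)].
apply: filterS (sep_ae n) => w sw; set z := sample _ _ _.
rewrite mulrDl mul1r.
apply: (@le_trans _ _ (\sum_i (`|phi (xs z i)| + `|phi (xs z (nsel b z i))|))).
  by apply: ler_sum => i _; exact: ler_normB.
rewrite big_split /= lerD2l.
exact: (@sum_nsel_le n b z (fun i => `|phi (xs z i)|)).
Qed.

Lemma ndiffD n b (phi psi : d.-tuple R -> R) : bmf phi -> bmf psi ->
  ndiff b (fun x => phi x + psi x) n <= ndiff b phi n + ndiff b psi n.
Proof.
move=> bp bq; rewrite /ndiff /En -ExD; last 2 first.
- exact: (bmf_sample mZ (bmf_ndiff _ _ bp)).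
- exact: (bmf_sample mZ (bmf_ndiff _ _ bq)).
apply: Ex_le.
- exact: (bmf_sample mZ (bmf_ndiff _ _ (bmfD bp bq))).
- by apply: bmfD; [exact: (bmf_sample mZ (bmf_ndiff _ _ bp))|exact: (bmf_sample mZ (bmf_ndiff _ _ bq))].
move=> w; rewrite -big_split; apply: ler_sum => i _ /=.
by rewrite opprD addrACA ler_normD.
Qed.

Lemma nn_small_le (phi psi : d.-tuple R -> R) (C : R) : bmf phi -> bmf psi -> 0 <= C ->
  (forall x y, `|psi x - psi y| <= C * `|phi x - phi y|) ->
  nn_small phi -> nn_small psi.
Proof.
move=> bp bq C0 H sp b e e0.
have eC0 : 0 < e / (C + 1) by rewrite divr_gt0// ltr_wpDl.
have [n0 Hn] := sp b _ eC0; exists n0 => n n0n.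
apply: (@le_trans _ _ (C * ndiff b phi n)).
  rewrite /ndiff /En -ExZ; last exact: (bmf_sample mZ (bmf_ndiff _ _ bp)).
  apply: Ex_le.
  - exact: (bmf_sample mZ (bmf_ndiff _ _ bq)).
  - by apply: bmfM; [exact: bmf_cst|exact: (bmf_sample mZ (bmf_ndiff _ _ bp))].
  by move=> w; rewrite mulr_sumr; apply: ler_sum => i _.
apply: (@le_trans _ _ (C * (e / (C + 1) * n%:R))); first by rewrite ler_wpM2l// Hn.
rewrite mulrA ler_wpM2r// mulrCA ler_piMr ?ltW//.
by rewrite ltr_pdivrMr ?ltr_wpDl// mul1r ltrDl.
Qed.

Lemma nn_smallD (phi psi : d.-tuple R -> R) : bmf phi -> bmf psi -> nn_small phi -> nn_small psi ->
  nn_small (fun x => phi x + psi x).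
Proof.
move=> bp bq sp sq b e e0.
have e2 : 0 < e / 2 by rewrite divr_gt0.
have [n1 H1] := sp b _ e2; have [n2 H2] := sq b _ e2.
exists (maxn n1 n2) => n; rewrite geq_max => /andP[/H1 h1 /H2 h2].
apply: le_trans (ndiffD n b bp bq) _.
by rewrite (splitr e) mulrDl lerD.
Qed.

Lemma nn_small_cst (c : R) : nn_small (fun _ => c).
Proof.
move=> b e e0; exists 0%N => n _; rewrite /ndiff /En.
rewrite (@Ex_ext _ _ _ P _ (fun _ => 0)).
  by rewrite Ex_cst mulr_ge0// ltW.
by move=> w; rewrite big1// => i _; rewrite subrr normr0.
Qed.

(** Passing from phi to psi costs (1 + K) times the L1 distance per sample point, as each
    point is used once as source and at most K times as target.  So the class is closed in L1. *)
Lemma nn_small_approx (phi : d.-tuple R -> R) : bmf phi ->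
  (forall e, 0 < e -> exists psi, [/\ bmf psi, nn_small psi &
     Ex P (fun w => `|phi (Z0 w).1 - psi (Z0 w).1|) <= e]) -> nn_small phi.
Proof.
move=> bp H b e e0.
have K0 : 0 < 1 + K%:R :> R by rewrite ltr_pwDl.
have [psi [bq sq Hpsi]] := H (e / 2 / (1 + K%:R)) (divr_gt0 (divr_gt0 e0 (ltr0n _ 2)) K0).
have [n0 Hn] := sq b _ (divr_gt0 e0 (ltr0n _ 2)); exists n0 => n n0n.
have bd := bmfB bp bq.
have -> : phi = (fun x => (phi x - psi x) + psi x) by apply/funext => x; rewrite subrK.
apply: le_trans (ndiffD n b bd bq) _.
rewrite [e in leRHS](splitr e) mulrDl lerD//; last exact: Hn.
apply: le_trans (ndiff_le n b bd) _.
apply: (@le_trans _ _ ((1 + K%:R) * (n%:R * (e / 2 / (1 + K%:R))))).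
  by rewrite ler_wpM2l ?(ltW K0)// ler_wpM2l.
by rewrite mulrCA [(1 + _) * _]mulrC divfK ?gt_eqF// mulrC.
Qed.

Definition sind (A : set (d.-tuple R)) (x : d.-tuple R) : R := (x \in A)%:R.

Lemma bmf_sind A : measurable A -> bmf (sind A).
Proof.
move=> mA; apply: bmf_bool; apply: (measurable_fun_bool true).
rewrite setTI (_ : _ @^-1` _ = A)//.
by apply/seteqP; split => x /=; [exact: set_mem|exact: mem_set].
Qed.

Definition nn_set A := measurable A /\ nn_small (sind A).

Lemma nn_setC A : nn_set A -> nn_set (~` A).
Proof.
move=> [mA sA]; split; first exact: measurableC.
have mCA := measurableC mA.
apply: (nn_small_le (bmf_sind mA) (bmf_sind mCA) ler01 _ sA) => x y.
by rewrite mul1r /sind !in_setC; case: (x \in A); case: (y \in A);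
  rewrite /= ?subrr ?normr0// ?subr0 ?sub0r normrN normr1 ?normr1.
Qed.

Lemma nn_setI A B : nn_set A -> nn_set B -> nn_set (A `&` B).
Proof.
move=> [mA sA] [mB sB]; split; first exact: measurableI.
have mAB := measurableI _ _ mA mB.
have bA := bmf_sind mA; have bB := bmf_sind mB.
move=> b e e0; have e2 := divr_gt0 e0 (ltr0n R 2).
have [n1 H1] := sA b _ e2; have [n2 H2] := sB b _ e2.
exists (maxn n1 n2) => n; rewrite geq_max => /andP[/H1 h1 /H2 h2].
apply: (@le_trans _ _ (ndiff b (sind A) n + ndiff b (sind B) n)); last first.
  by rewrite (splitr e) mulrDl lerD.
rewrite /ndiff /En -ExD; last 2 first.
- exact: (bmf_sample mZ (bmf_ndiff n b bA)).
- exact: (bmf_sample mZ (bmf_ndiff n b bB)).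
apply: Ex_le.
- exact: (bmf_sample mZ (bmf_ndiff n b (bmf_sind mAB))).
- by apply: bmfD; [exact: (bmf_sample mZ (bmf_ndiff n b bA))|exact: (bmf_sample mZ (bmf_ndiff n b bB))].
move=> w; rewrite -big_split; apply: ler_sum => i _ /=.
rewrite /sind !in_setI; set x := xs _ _; set y := xs _ _.
by case: (x \in A); case: (y \in A); case: (x \in B); case: (y \in B);
  rewrite /= ?subrr ?subr0 ?sub0r ?normrN ?normr0 ?normr1 ?addr0 ?add0r ?lexx ?ler01// lerDl.
Qed.

Lemma nn_set_bigcup (F : (set (d.-tuple R))^nat) :
  (forall n, nn_set (F n)) -> nn_set (\bigcup_n F n).
Proof.
move=> FS; have mF n := (FS n).1.
have mU : measurable (\bigcup_n F n) by exact: bigcupT_measurable.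
split => //; apply: nn_small_approx; first exact: bmf_sind.
move=> e e0.
pose G m := \bigcup_(i < m) F i.
have mG m : measurable (G m) by apply: bigcup_measurable => i _.
have sG m : nn_small (sind (G m)).
  suff : nn_set (G m) by case.
  elim: m => [|m IH].
    rewrite /G bigcup_mkord big_ord0; split => //.
    rewrite (_ : sind set0 = fun _ => 0); first exact: nn_small_cst.
    by apply/funext => x; rewrite /sind in_set0.
  rewrite (_ : G m.+1 = ~` (~` G m `&` ~` F m)); last first.
    by rewrite setCI !setCK /G !bigcup_mkord big_ord_recr.
  by apply: nn_setC; apply: nn_setI; exact: nn_setC.
pose V m := [set w | (\bigcup_n F n) (Z0 w).1 /\ ~ G m (Z0 w).1].
have VE m : V m = (fun w => (Z0 w).1) @^-1` ((\bigcup_n F n) `\` G m).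
  by [].
have mX : measurable_fun setT (fun w => (Z0 w).1) by exact: measurableT_comp.
have mV m : measurable (V m).
  by rewrite VE -[X in measurable X]setTI; apply: mX => //; exact: measurableD.
have [m Hm] : exists m, fine (P (V m)) <= e.
  apply: prob_decreasing_eps => //.
    move=> i j ij; apply/subsetPset => w /= [Uw Gw]; split => //.
    by apply: contra_not Gw => -[k /= ki Fk]; exists k => //=; exact: leq_trans ij.
  rewrite (_ : \bigcap_n V n = set0) ?measure0//.
  apply/seteqP; split => // w Vw.
  have [[k _ Fk] _] := Vw 0%N I.
  by have [_] := Vw k.+1 I; apply; exists k => /=.
exists (sind (G m)); split; [exact: bmf_sind|exact: sG|].
rewrite (@Ex_ext _ _ _ P _ (\1_(V m))); first by rewrite Ex_indic.
move=> w; rewrite /sind indicE.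
have [xU|xU] := boolP ((Z0 w).1 \in \bigcup_n F n); have [xG|xG] := boolP ((Z0 w).1 \in G m).
- rewrite subrr normr0 memNset//= => -[_]; apply; exact: set_mem.
- rewrite subr0 normr1 mem_set//; split; first exact: set_mem.
  by move=> /mem_set; rewrite (negbTE xG).
- exfalso; move/negP: xU; apply; apply/mem_set.
  by have [k _ Fk] := set_mem xG; exists k.
- rewrite subrr normr0 memNset//= => -[/mem_set]; by rewrite (negbTE xU).
Qed.

Lemma nn_set_setT : nn_set setT.
Proof.
split => //; rewrite (_ : sind setT = fun _ => 1); first exact: nn_small_cst.
by apply/funext => x; rewrite /sind in_setT.
Qed.

(** The sets whose indicator is smooth along neighbours form a sigma-algebra. *)
Lemma nn_set_generated :
  (forall (k : 'I_d) c, nn_set [set x | c <= tnth x k]) ->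
  forall A, measurable A -> nn_set A.
Proof.
move=> H.
have sa : sigma_algebra setT nn_set.
  split.
  - by rewrite -setCT; apply: nn_setC; exact: nn_set_setT.
  - by move=> A sA; rewrite setTD; exact: nn_setC.
  - exact: nn_set_bigcup.
have Hk k (B : set R) : measurable B -> nn_set [set x | B (tnth x k)].
  pose L := [set B : set R | nn_set [set x | B (tnth x k)]].
  suff : @measurable _ R `<=` L by apply.
  rewrite [X in X `<=` _](RGenCInfty.measurableE R); apply: smallest_sub; last first.
    move=> _ [c ->]; rewrite /L /=.
    rewrite (_ : mkset _ = [set x | c <= tnth x k])//.
    by apply/seteqP; split => x /=; rewrite in_itv/= andbT.
  split.
  - by rewrite /L /= (_ : mkset _ = ~` setT); [apply: nn_setC; exact: nn_set_setT|rewrite setCT; apply/seteqP; split].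
  - move=> A LA; rewrite /L /= (_ : mkset _ = ~` [set x | A (tnth x k)]); first exact: nn_setC.
    by apply/seteqP; split => x /= => [[]|].
  - move=> F LF; rewrite /L /= (_ : mkset _ = \bigcup_n [set x | F n (tnth x k)]).
      exact: nn_set_bigcup.
    by apply/seteqP; split => x [n _ Fn]; exists n.
apply: smallest_sub => //.
rewrite -bigcup_seq => A [k _ [B mB <-]]; rewrite setTI.
exact: Hk.
Qed.

(** Bounded functions are uniform limits of combinations of indicators, by the grid. *)
Lemma nn_small_bmf (phi : d.-tuple R -> R) :
  (forall A, measurable A -> nn_set A) -> bmf phi -> nn_small phi.
Proof.
move=> Hset bp; have [mp [c Hc]] := bp.
pose C := `|c| + 1.
have C0 : 0 < C by rewrite ltr_wpDl.
have C2 : 0 < 2 * C by rewrite mulr_gt0.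
pose psi x := (phi x + C) / (2 * C).
have bpsi : bmf psi by apply: bmfM; [apply: bmfD => //|]; exact: bmf_cst.
have psi01 x : 0 <= psi x <= 1.
  have := le_trans (Hc x) (ler_norm c); rewrite ler_norml => /andP[h1 h2].
  rewrite /psi; apply/andP; split; last by rewrite ler_pdivrMr// mul1r /C; lra.
  by apply: divr_ge0; [rewrite /C; lra|exact: ltW].
suff sp : nn_small psi.
  apply: (nn_small_le bpsi bp (ltW C2) _ sp) => x y.
  rewrite -{1}(gtr0_norm C2) -normrM /psi -mulrBl [2 * C * _]mulrC divfK ?gt_eqF//.
  by rewrite opprD addrACA subrr addr0.
apply: nn_small_approx => // e e0.
pose M := Num.truncn e^-1.
have bg : bmf (fun x => grid M (psi x)).
  apply: bmfM; first exact: bmf_cst.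
  apply: bmf_sum => q; apply: bmf_bool; apply: measurable_fun_ler => //.
  exact: bpsi.1.
have Aq (q : R) : measurable [set x | q <= psi x].
  rewrite (_ : [set x | _] = psi @^-1` `[q, +oo[).
    by rewrite -[X in measurable X]setTI; apply: bpsi.1.
  by apply/seteqP; split => x /=; rewrite in_itv/= andbT.
exists (fun x => grid M (psi x)); split => //.
  have sq q : nn_small (fun x => (q <= psi x)%R%:R).
    have [_] := Hset _ (Aq q); congr nn_small.
    apply/funext => x; rewrite /sind; congr (_%:R); congr nat_of_bool.
    by apply/idP/idP => [/set_mem//|h]; apply/mem_set.
  have bq q : bmf (fun x => (q <= psi x)%R%:R : R).
    by apply: bmf_bool; apply: measurable_fun_ler => //; exact: bpsi.1.
  have ssum m : nn_small (fun x => \sum_(q < m) (q.+1%:R / M.+1%:R <= psi x)%R%:R).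
    elim: m => [|m IH].
      by under eq_fun do rewrite big_ord0; exact: nn_small_cst.
    under eq_fun do rewrite big_ord_recr/=.
    apply: nn_smallD; [|exact: bq|exact: IH|exact: sq].
    by apply: bmf_sum => q; exact: bq.
  have bsum : bmf (fun x => \sum_(q < M.+1) (q.+1%:R / M.+1%:R <= psi x)%R%:R : R).
    by apply: bmf_sum => q; exact: bq.
  apply: (@nn_small_le _ _ (M.+1%:R^-1) bsum bg _ _ (ssum M.+1)).
    by rewrite invr_ge0.
  by move=> x y; rewrite /grid -mulrBr normrM ger0_norm ?invr_ge0.
apply: Ex_le_cst.
  apply: (@bmf_comp _ _ _ _ _ (fun w => (Z0 w).1) (fun x => `|psi x - grid M (psi x)|)).
    by apply: bmf_norm; exact: bmfB.
  exact: measurableT_comp.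
move=> w; have /andP[g0 g1] := grid_bound M (psi01 (Z0 w).1).
rewrite ger0_norm// (le_trans g1)// -[leRHS]invrK lef_pV2 ?posrE ?invr_gt0//.
have ei : 0 <= e^-1 by rewrite invr_ge0 ltW.
by have /andP[_ /ltW] := truncn_itv ei.
Qed.

Definition inbox (L : nat) (x : d.-tuple R) := [forall k, `|tnth x k| <= L%:R].

Definition close (del : R) (x y : d.-tuple R) :=
  [forall k, `|tnth x k - tnth y k| <= del].

(** Cover the box by Q / 3 small cells.  In each cell all but three points have their
    neighbours within the diameter of the cell.  The count does not depend on n. *)
Lemma far_count (del : R) (L : nat) : 0 < del -> exists Q : nat,
  forall n b (z : n.-tuple S), sep z ->
    (#|[set i | ~~ close del (xs z i) (xs z (nsel b z i))]%SET| <=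
     #|[set i | ~~ inbox L (xs z i)]%SET| + Q)%N.
Proof.
move=> del0; pose eta := del / d.+1%:R.
have eta0 : 0 < eta by rewrite divr_gt0.
pose tr (u : R) := Num.truncn ((u + L%:R) / eta).
pose m := tr L%:R.
pose cell (x : d.-tuple R) : {ffun 'I_d -> 'I_m.+1} := [ffun k => inord (tr (tnth x k))].
have cellP x y : inbox L x -> inbox L y -> cell x = cell y ->
    forall k, `|tnth x k - tnth y k| <= eta.
  move=> /forallP bx /forallP by' exy k.
  have trm u : `|u| <= L%:R -> (tr u < m.+1)%N /\ 0 <= (u + L%:R) / eta.
    rewrite ler_norml => /andP[u1 u2]; split.
      by rewrite ltnS; apply: le_truncn; rewrite ler_pM2r ?invr_gt0// lerD2r.
    by rewrite divr_ge0 ?(ltW eta0)//; lra.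
  have [tx x0] := trm _ (bx k); have [ty y0] := trm _ (by' k).
  have : tr (tnth x k) = tr (tnth y k).
    move: exy => /ffunP/(_ k); rewrite !ffunE => /(congr1 val) /=.
    by rewrite !inordK.
  have /andP := truncn_itv x0; have /andP := truncn_itv y0.
  rewrite -/(tr _) -/(tr _) => -[y1 y2] [x1 x2] E; rewrite E in x1 x2.
  rewrite !ler_pdivlMr// in x1 y1; rewrite !ltr_pdivrMr// in x2 y2.
  rewrite -natr1 mulrDl mul1r in x2 y2; rewrite ler_norml; apply/andP; split; lra.
(* Three exceptional points per cell. *)
exists (#|{ffun 'I_d -> 'I_m.+1}| * 3)%N => n b z sz.
pose B C := [set i : 'I_n | inbox L (xs z i) && (cell (xs z i) == C)]%SET.
have /choice[E HE] : forall C, exists E : {set 'I_n}, (#|E| <= 3)%N /\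
    forall i j, i \in B C -> i \notin E ->
      edge2 (arel rho (xs z)) (lrel rho (xs z)) [set: 'I_n]%SET i j ->
      exists2 k, k \in B C & lrel rho (xs z) i j k.
  move=> C; have [||E E3 HE] := @crowded_edge2 n (arel rho (xs z)) (lrel rho (xs z))
    [set: 'I_n]%SET (B C); first exact: finset.subsetT.
    by move=> i k _ _ ik; exact: allowed_total (sz _ _ ik).
  by exists E.
apply: (@leq_trans #|([set i | ~~ inbox L (xs z i)] :|:
    \bigcup_(C in [set: {ffun 'I_d -> 'I_m.+1}]) E C)%SET|).
  apply: subset_leq_card; apply/fintype.subsetP => i.
  rewrite !inE; apply: contraR; rewrite negb_or negbK => /andP[bi nE].
  have iB : i \in B (cell (xs z i)) by rewrite inE bi eqxx.
  have iE : i \notin E (cell (xs z i)).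
    by apply: contra nE => iE; apply/finset.bigcupP; exists (cell (xs z i)); rewrite ?inE.
  apply/forallP => k; have [->|ns] := eqVneq (nsel b z i) i.
    by rewrite subrr normr0 ltW.
  have e2 := nsel_edge2 ns.
  have [l lB gl] := (HE (cell (xs z i))).2 i _ iB iE e2.
  have al : allowed rho (xs z i) (xs z (nsel b z i)) by case/andP: e2 => /and3P[].
  apply: le_trans (gap_ge k al) _; apply: le_trans gl _.
  apply: (@le_trans _ _ (d%:R * eta)).
    apply: gap_le; apply: cellP => //.
      by move: lB; rewrite inE => /andP[].
    by move: lB; rewrite inE => /andP[_ /eqP].
  rewrite /eta mulrCA ler_piMr ?ltW// ltr_pdivrMr ?ltr0n// mul1r ltr_nat//.
apply: leq_trans (leq_card_setU _ _) _; rewrite leq_add2l.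
apply: leq_trans (@leq_card_bigcup _ _ _ _ 3 _) _; first by move=> C _; exact: (HE C).1.
by rewrite leq_mul2r finset.cardsT leqnn orbT.
Qed.

Lemma measurable_coord k : measurable_fun setT (fun w => tnth (Z0 w).1 k).
Proof.
apply: (@measurableT_comp _ _ _ _ _ _ (fun x : d.-tuple R => tnth x k)).
  exact: measurable_tnth.
exact: measurableT_comp.
Qed.

Lemma card_natr n (p : 'I_n -> bool) : \sum_i (p i)%:R = #|[set i | p i]%SET|%:R :> R.
Proof.
rewrite -natr_sum; congr (_%:R); rewrite -sum1_card [RHS]big_mkcond.
by apply: eq_bigr => i _; rewrite inE; case: (p i).
Qed.

(** The indicator differs at two close points only if the first is near the boundary of the
    half-space, which has small probability as the coordinates have no atoms. *)
Lemma nn_set_halfspace k c : nn_set [set x | c <= tnth x k].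
Proof.
have mA : measurable [set x : d.-tuple R | c <= tnth x k].
  rewrite (_ : mkset _ = setT `&` (fun x : d.-tuple R => tnth x k) @^-1` `[c, +oo[).
    exact: measurable_tnth.
  by apply/seteqP; split => x /=; rewrite in_itv/= andbT //; case.
split => // b e e0; have e3 : 0 < e / 3 by rewrite divr_gt0.
pose near_c (q : nat) (u : R) := `|u - c| <= q.+1%:R^-1.
have mnear q : measurable_fun setT (near_c q).
  apply: measurable_fun_ler => //; apply: measurableT_comp => //.
  by apply: measurable_funB => //; exact: measurable_cst.
have setb (f : T -> bool) : measurable_fun setT f -> measurable [set w | f w].
  move=> mf; rewrite (_ : mkset _ = setT `&` f @^-1` [set true]).
    exact: mf.
  by apply/seteqP; split => w /=; [|case].
have [q Hq] : exists q, fine (P [set w | near_c q (tnth (Z0 w).1 k)]) <= e / 3.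
  apply: prob_decreasing_eps => //.
  - move=> q; apply: (setb (fun w => near_c q (tnth (Z0 w).1 k))).
    by apply: measurableT_comp => //; exact: measurable_coord.
  - move=> i j ij; apply/subsetPset => w; rewrite /near_c /= => h.
    by apply: le_trans h _; rewrite lef_pV2 ?posrE// ler_nat ltnS.
  rewrite (_ : \bigcap_n _ = [set w | tnth (Z0 w).1 k = c]); first exact: atomless.
  apply/seteqP; split => w /= h; last first.
    by move=> q _; rewrite /near_c /= h subrr normr0 invr_ge0.
  apply/eqP; rewrite -subr_eq0 -normr_le0; apply/ler_addgt0Pl => eps eps0.
  rewrite addr0; have := h (Num.truncn eps^-1) I; rewrite /near_c /= => /le_trans; apply.
  rewrite -[leRHS]invrK lef_pV2 ?posrE ?invr_gt0//.
  have ei : 0 <= eps^-1 by rewrite invr_ge0 ltW.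
  by have /andP[_ /ltW] := truncn_itv ei.
have mbox L : measurable_fun setT (inbox L).
  have := @measurable_table _ (d.-tuple R) ('I_d : finType)
    (fun k x => `|tnth x k| <= L%:R) (fun t => [forall k, t k]).
  rewrite (_ : (fun w => [forall k, [ffun k => _] k]) = inbox L).
    apply=> j; apply: measurable_fun_ler => //.
    apply: measurableT_comp => //; exact: measurable_tnth.
  by apply/funext => x; apply: eq_forallb => j; rewrite ffunE.
(* Outside a large box there is little mass; inside it, few neighbours are far. *)
have [L HL] : exists L, fine (P [set w | ~~ inbox L (Z0 w).1]) <= e / 3.
  apply: prob_decreasing_eps => //.
  - move=> L; apply: (setb (fun w => ~~ inbox L (Z0 w).1)).
    apply: measurable_neg; apply: measurableT_comp => //; exact: measurableT_comp.
  - move=> i j ij; apply/subsetPset => w /=; apply: contra => /forallP h.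
    by apply/forallP => l; apply: le_trans (h l) _; rewrite ler_nat.
  rewrite (_ : \bigcap_n _ = set0) ?measure0//; apply/seteqP; split => // w h.
  pose M := \sum_(l < d) `|tnth (Z0 w).1 l|.
  have := h (Num.truncn M).+1 I; rewrite /= => /negP; apply; apply/forallP => l.
  have M0 : 0 <= M by apply: sumr_ge0.
  have /andP[_ /ltW] := truncn_itv M0; apply: le_trans.
  by rewrite /M (bigD1 l)//= lerDl; apply: sumr_ge0.
have del0 : 0 < q.+1%:R^-1 :> R by rewrite invr_gt0.
have [Q HQ] := far_count L del0.
exists (Num.truncn (Q%:R / (e / 3))).+1 => n n0n.
have bA := bmf_sind mA.
have bb1 : bmf (fun x : d.-tuple R => (near_c q (tnth x k))%:R : R).
  by apply: bmf_bool; apply: measurableT_comp => //; exact: measurable_tnth.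
have bb2 : bmf (fun x : d.-tuple R => (~~ inbox L x)%:R : R).
  by apply: bmf_bool; exact: measurable_neg.
have bs1 : bmf (fun z : n.-tuple S => \sum_i (near_c q (tnth (xs z i) k))%:R : R).
  by apply: bmf_sum => i; exact: (@bmf_xs n _ i bb1).
have bs2 : bmf (fun z : n.-tuple S => \sum_i (~~ inbox L (xs z i))%:R : R).
  by apply: bmf_sum => i; exact: (@bmf_xs n _ i bb2).
have EI (f : T -> bool) : measurable_fun setT f ->
    Ex P (fun w => (f w)%:R) = fine (P [set w | f w]).
  move=> mf; rewrite -(Ex_indic P (setb _ mf)); apply: Ex_ext => w.
  by rewrite indicE; congr (_%:R); congr nat_of_bool; apply/idP/idP => [h|/set_mem//]; apply/mem_set.
have E1 := En_sum_tnth n bb1; have E2 := En_sum_tnth n bb2.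
rewrite EI in E1; last first.
  by apply: (measurableT_comp (mnear q)); exact: measurable_coord.
rewrite EI in E2; last first.
  by apply: measurable_neg; apply: (measurableT_comp (mbox L)); exact: measurableT_comp.
apply: (@le_trans _ _ (e / 3 * n%:R + (e / 3 * n%:R + e / 3 * n%:R))); last by lra.
apply: (@le_trans _ _ (EZ (fun z : n.-tuple S => \sum_i (near_c q (tnth (xs z i) k))%:R) +
   (EZ (fun z : n.-tuple S => \sum_i (~~ inbox L (xs z i))%:R) + Q%:R))); last first.
  rewrite E1 E2; apply: lerD; last apply: lerD.
  - by rewrite mulrC ler_wpM2r.
  - by rewrite mulrC ler_wpM2r.
  rewrite mulrC -ler_pdivrMr//; apply: ltW.
  have q0 : 0 <= Q%:R / (e / 3) by rewrite divr_ge0// ltW.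
  have /andP[_ h] := truncn_itv q0; apply: lt_le_trans h _.
  by rewrite ler_nat.
rewrite /ndiff /En -(Ex_cst P Q%:R) -ExD; [|exact: (bmf_sample mZ bs2)|exact: bmf_cst].
rewrite -ExD; [|exact: (bmf_sample mZ bs1)|
  by apply: bmfD; [exact: (bmf_sample mZ bs2)|exact: bmf_cst]].
apply: Ex_le_ae.
- exact: (bmf_sample mZ (bmf_ndiff n b bA)).
- apply: bmfD; first exact: (bmf_sample mZ bs1).
  by apply: bmfD; [exact: (bmf_sample mZ bs2)|exact: bmf_cst].
apply: filterS (sep_ae n) => w sw; set z := sample _ _ _.
apply: (@le_trans _ _ (\sum_i (near_c q (tnth (xs z i) k))%:R +
   \sum_i (~~ close q.+1%:R^-1 (xs z i) (xs z (nsel b z i)))%:R)); last first.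
  rewrite lerD2l (@card_natr n (fun i => ~~ inbox L (xs z i))).
  by rewrite (@card_natr n (fun i => ~~ close _ (xs z i) (xs z (nsel b z i)))) -natrD ler_nat HQ.
rewrite -big_split /=; apply: ler_sum => i _.
rewrite /sind; set x := xs z i; set y := xs z _.
have [/forallP /(_ k) cl|_] := boolP (close _ x y); last first.
  rewrite (@le_trans _ _ 1)// ?lerDr//.
  by case: (x \in _); case: (y \in _); rewrite /= ?subrr ?subr0 ?sub0r ?normrN ?normr0 ?normr1.
rewrite addr0 /near_c.
have [xy|xy] := eqVneq (x \in [set x | c <= tnth x k]) (y \in [set x | c <= tnth x k]).
  by rewrite xy subrr normr0.
have -> : `|tnth x k - c| <= q.+1%:R^-1.
  move: cl xy; rewrite !ler_norml => /andP[c1 c2].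
  have [/set_mem/= cx|/negP cx] := boolP (x \in _); have [/set_mem/= cy|/negP cy] := boolP (y \in _) => // _.
    have {}cy : tnth y k < c by rewrite ltNge; apply/negP => h; apply: cy; exact/mem_set.
    by move: c1 c2 (ltW del0); set D := q.+1%:R^-1 => c1 c2 D0; apply/andP; split; lra.
  have {}cx : tnth x k < c by rewrite ltNge; apply/negP => h; apply: cx; exact/mem_set.
  by move: c1 c2 (ltW del0); set D := q.+1%:R^-1 => c1 c2 D0; apply/andP; split; lra.
by case: (x \in _); case: (y \in _); rewrite /= ?subrr ?subr0 ?sub0r ?normrN ?normr0 ?normr1.
Qed.

Lemma nn_small_all (phi : d.-tuple R -> R) : bmf phi -> nn_small phi.
Proof.
move=> bp; apply: nn_small_bmf => //; apply: nn_set_generated.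
exact: nn_set_halfspace.
Qed.

End NearestApprox.

(** * Calculus on the line and the Mills ratio *)

Section Calculus.
Context {R : realType}.
Implicit Types (f g df : R -> R) (a b x y : R).

Lemma der_eq f (x d1 d2 : R) : is_derive x 1 f d1 -> d1 = d2 -> is_derive x 1 f d2.
Proof. by move=> H <-. Qed.

Lemma derD f g (x a b : R) : is_derive x 1 f a -> is_derive x 1 g b ->
  is_derive x 1 (fun y => f y + g y) (a + b).
Proof. by move=> fa gb; exact: is_deriveD. Qed.

Lemma derB f g (x a b : R) : is_derive x 1 f a -> is_derive x 1 g b ->
  is_derive x 1 (fun y => f y - g y) (a - b).
Proof. by move=> fa gb; exact: is_deriveB. Qed.

Lemma derM f g (x a b : R) : is_derive x 1 f a -> is_derive x 1 g b ->
  is_derive x 1 (fun y => f y * g y) (a * g x + f x * b).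
Proof.
move=> fa gb; apply: der_eq (is_deriveM fa gb) _.
by rewrite /GRing.scale/= addrC mulrC.
Qed.

Lemma derV f (x a : R) : is_derive x 1 f a -> f x != 0 ->
  is_derive x 1 (fun y => (f y)^-1) (- a / f x ^+ 2).
Proof.
move=> fa f0; apply: der_eq (is_deriveV f0 fa) _.
by rewrite /GRing.scale/= mulrC mulrN mulNr.
Qed.

Lemma derC (c x : R) : is_derive x 1 (fun _ : R => c) 0.
Proof. exact: is_derive_cst. Qed.

Lemma derI (x : R) : is_derive x 1 (fun y : R => y) 1.
Proof. exact: is_derive_id. Qed.

Lemma derSq f (x a : R) : is_derive x 1 f a ->
  is_derive x 1 (fun y => f y ^+ 2) (2 * f x * a).
Proof. by move=> fa; apply: der_eq (derM fa fa) _; ring. Qed.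

Lemma mvt f df a b : a < b ->
  (forall x, a <= x <= b -> is_derive x 1 f (df x)) ->
  exists2 c, a <= c <= b & f b - f a = df c * (b - a).
Proof.
move=> ab fd; have [x||c cab E] := @MVT R f df a b ab.
- by rewrite in_itv/= => /andP[ax xb]; apply: fd; rewrite !ltW.
- apply: derivable_within_continuous => x; rewrite in_itv/= => xab.
  by case: (fd x xab).
by exists c => //; move: cab; rewrite in_itv/= => /andP[/ltW -> /ltW ->].
Qed.

(** A nonincreasing function that is nonnegative in the limit is nonnegative; inequalities
    between tails are proved by differentiating them. *)
Lemma decay_ge0 f df A : (forall x, A <= x -> is_derive x 1 f (df x)) ->
  (forall x, A <= x -> df x <= 0) ->
  (forall e, 0 < e -> exists B, forall y, B <= y -> - e <= f y) ->
  forall x, A <= x -> 0 <= f x.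
Proof.
move=> fd fn f0 x Ax; apply/ler_addgt0Pl => e e0.
have [B HB] := f0 e e0; pose y := Num.max B (x + 1).
have xy : x < y by rewrite lt_max ltrDl ltr01 orbT.
have := HB y; rewrite le_max lexx => /(_ isT) fy.
have [c /andP[xc cy] E] : exists2 c, x <= c <= y & f y - f x = df c * (y - x).
  by apply: mvt => // u /andP[xu _]; apply: fd; exact: le_trans xu.
have : df c * (y - x) <= 0.
  by rewrite mulr_le0_ge0 ?fn ?subr_ge0 ?(ltW xy)//; exact: le_trans xc.
by rewrite -E; lra.
Qed.

Lemma lipschitz_der f df C : (forall x, is_derive x 1 f (df x)) ->
  (forall x, `|df x| <= C) -> forall x y, `|f y - f x| <= C * `|y - x|.
Proof.
move=> fd dC x y.
wlog xy : x y / x < y => [H|].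
  case: (ltgtP x y) => [|yx|->]; first exact: H.
    by rewrite distrC (distrC y x); exact: H.
  by rewrite !subrr normr0 mulr0.
have [c _ ->] := mvt xy (fun u _ => fd u).
by rewrite normrM ler_wpM2r.
Qed.

Lemma taylor_lipschitz f df L : (forall x, is_derive x 1 f (df x)) ->
  (forall x y, `|df y - df x| <= L * `|y - x|) ->
  forall x y, `|f y - f x - df x * (y - x)| <= L * (y - x) ^+ 2.
Proof.
move=> fd dL x y.
have L0 : 0 <= L.
  by have := dL 0 1; rewrite subr0 normr1 mulr1; apply: le_trans.
have main a b c : (a <= c <= b) ->
    `|df c - df a| * `|b - a| <= L * (b - a) ^+ 2 /\
    `|df c - df b| * `|b - a| <= L * (b - a) ^+ 2.
  move=> /andP[ac cb]; rewrite -[(b - a) ^+ 2]real_normK ?num_real// expr2 mulrA.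
  have ab := le_trans ac cb.
  split; apply: ler_wpM2r => //; apply: le_trans (dL _ _) _; apply: ler_wpM2l => //.
    by rewrite !ger0_norm ?subr_ge0// lerD2r.
  by rewrite distrC !ger0_norm ?subr_ge0// lerD2l lerN2.
case: (ltgtP x y) => [xy|yx|->].
- have [c cab ->] := mvt xy (fun u _ => fd u).
  by rewrite -mulrBl normrM; exact: (main _ _ _ cab).1.
- have [c cab E] := mvt yx (fun u _ => fd u).
  have -> : f y - f x - df x * (y - x) = - ((df c - df x) * (x - y)).
    by rewrite mulrBl -E; ring.
  by rewrite normrN normrM -[(y - x) ^+ 2]sqrrN opprB; exact: (main _ _ _ cab).2.
- by rewrite !subrr mulr0 subrr normr0 expr0n mulr0.
Qed.

Lemma bounded_on_itv f a b : continuous f ->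
  exists C, forall x, a <= x <= b -> `|f x| <= C.
Proof.
move=> cf; have [ab|ba] := leP a b; last first.
  by exists 0 => x /andP[ax xb]; have := le_lt_trans (le_trans ax xb) ba; rewrite ltxx.
have cn : {within `[a, b], continuous (fun x => `|f x|)}.
  apply: continuous_subspaceT => x; apply: continuous_comp; first exact: cf.
  exact: norm_continuous.
have [c _ Hc] := EVT_max ab cn; exists `|f c| => x xab.
by apply: Hc; rewrite in_itv.
Qed.

Lemma bounded_of_tails f A C : continuous f ->
  (forall x, A <= `|x| -> `|f x| <= C) -> exists C', forall x, `|f x| <= C'.
Proof.
move=> cf ft; have [D HD] := bounded_on_itv (- A) A cf.
exists (Num.max C D) => x; rewrite le_max; case: (leP A `|x|) => [/ft ->//|/ltW xA].
by rewrite HD ?orbT// -ler_norml.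
Qed.

End Calculus.

Section MillsRatio.
Context {R : realType}.
Variable p : R -> R.
Hypothesis p0 : forall x, 0 < p x.
Hypothesis dp : forall x : R, is_derive x 1 p (- x * p x).
Variable C : R.
Hypothesis pC : forall x, p x <= C.

Let inv_decay e : 0 < e -> exists2 B, 1 <= B & forall y, B <= y -> C / y <= e.
Proof.
have C0 : 0 < C := lt_le_trans (p0 0) (pC 0).
move=> e0; exists (Num.max 1 (C / e)); first by rewrite le_max lexx.
move=> y; rewrite ge_max => /andP[y1 yC]; have y0 : 0 < y := lt_le_trans ltr01 y1.
by rewrite ler_pdivrMr// mulrC -ler_pdivrMr.
Qed.

(** J plays the part of m times the normal tail; the two bounds come from differentiating
    their products with the density. *)
Lemma mills (J : R -> R) (m A : R) : 0 <= m -> 1 <= A ->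
  (forall x, A <= x -> is_derive x 1 J (- m * p x)) ->
  (forall e, 0 < e -> exists B, forall y, B <= y -> `|J y| <= e) ->
  forall x, A <= x ->
    m * (x / (1 + x ^+ 2)) <= J x / p x /\ J x / p x <= m / x.
Proof.
move=> m0 A1 dJ J0 x Ax.
have pos y : A <= y -> 0 < y by move=> Ay; exact: lt_le_trans ltr01 (le_trans A1 Ay).
have pos2 y : 0 < 1 + y ^+ 2 :> R by rewrite ltr_pwDl// sqr_ge0.
have pn0 y : p y != 0 by rewrite gt_eqF.
have Jx0 e : 0 < e -> exists2 B, A <= B & forall y, B <= y -> `|J y| <= e / 2 /\ m * (C / y) <= e / 2.
  move=> e0; have e2 : 0 < e / 2 by rewrite divr_gt0.
  have [B1 H1] := J0 _ e2.
  have m1 : 0 < m + 1 by rewrite ltr_wpDl.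
  have [B2 B21 H2] := inv_decay (divr_gt0 e2 m1).
  exists (Num.max A (Num.max B1 B2)); first by rewrite le_max lexx.
  move=> y; rewrite !ge_max => /and3P[Ay /H1 h1 /H2 h2]; split => //.
  apply: (@le_trans _ _ ((m + 1) * (C / y))).
    apply: ler_wpM2r; last by rewrite lerDl.
    by apply: divr_ge0; apply: ltW; [exact: lt_le_trans (p0 0) (pC 0)|exact: pos].
  by rewrite mulrC -ler_pdivlMr.
split.
  rewrite ler_pdivlMr// -subr_ge0.
  apply: (@decay_ge0 _ (fun y => J y - m * (y / (1 + y ^+ 2)) * p y)
      (fun y => - m * p y * (2 / (1 + y ^+ 2) ^+ 2)) A) => // [y Ay|y Ay|e e0].
  - have n0 : 1 + y ^+ 2 != 0 by rewrite gt_eqF.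
    have d1 := derD (derC 1 y) (derSq (derI y)).
    have d2 := derM (derI y) (derV d1 n0).
    have d3 := derB (dJ y Ay) (derM (derM (derC m y) d2) (dp y)).
    apply: (der_eq d3).
    by field.
  - rewrite !mulNr oppr_le0; apply: mulr_ge0; first by apply: mulr_ge0 => //; exact: ltW.
    by apply: divr_ge0 => //; exact: sqr_ge0.
  have [B AB HB] := Jx0 e e0; exists B => y By; have [h1 h2] := HB y By.
  have y0 := pos y (le_trans AB By).
  have : m * (y / (1 + y ^+ 2)) * p y <= m * (C / y).
    rewrite -mulrA ler_wpM2l// mulrC; apply: ler_pM => //; first exact: ltW.
      by rewrite divr_ge0 ?ltW.
    by rewrite -[y^-1]mul1r ler_pdivrMr// mulrAC ler_pdivlMr// mul1r -expr2 lerDr.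
  by move: h1; rewrite ler_norml => /andP[]; lra.
rewrite ler_pdivrMr// -subr_ge0.
apply: (@decay_ge0 _ (fun y => m * y^-1 * p y - J y)
    (fun y => - m * p y * (y ^- 2)) A) => // [y Ay|y Ay|e e0].
- have n0 : y != 0 by rewrite gt_eqF// pos.
  apply: (der_eq (derB (derM (derM (derC m y) (derV (derI y) n0)) (dp y)) (dJ y Ay))).
  by field.
- rewrite !mulNr oppr_le0; apply: mulr_ge0; first by apply: mulr_ge0 => //; exact: ltW.
  by rewrite invr_ge0 sqr_ge0.
have [B AB HB] := Jx0 e e0; exists B => y By; have [h1 h2] := HB y By.
have y0 := pos y (le_trans AB By).
have : 0 <= m * y^-1 * p y by rewrite !mulr_ge0// ?invr_ge0 ltW.
by move: h1; rewrite ler_norml => /andP[]; lra.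
Qed.

End MillsRatio.

(** * The Stein equation for the normal law *)

Section SteinEquation.
Context {R : realType}.
Local Notation mu := (@lebesgue_measure R).
Local Notation NP := (normal_prob (0 : R) 1).
Local Notation p := (normal_pdf (0 : R) 1).

Lemma normal_pdf01E (x : R) : p x = normal_peak (1 : R) * expR (- (x ^+ 2) / 2).
Proof. by rewrite normal_pdfE ?oner_eq0// /normal_fun subr0 expr1n. Qed.

Lemma normal_pdf01_gt0 (x : R) : 0 < p x.
Proof. by rewrite normal_pdf01E mulr_gt0 ?expR_gt0// normal_peak_gt0// oner_eq0. Qed.

Lemma normal_pdf01_even (x : R) : p (- x) = p x.
Proof. by rewrite !normal_pdf01E sqrrN. Qed.

Lemma derive_normal_pdf01 (x : R) : is_derive x 1 p (- x * p x).
Proof.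
have -> : p = fun y => normal_peak (1 : R) * expR ((y * y) * (- 2^-1)).
  by apply/funext => y; rewrite normal_pdf01E; congr (_ * expR _); rewrite expr2; field.
have d1 := derM (derM (derI x) (derI x)) (derC (- 2^-1) x).
have d2 := @is_derive1_comp _ expR (fun y => y * y * (- 2^-1)) x _ _ (is_derive_expR _) d1.
apply: (der_eq (derM (derC (normal_peak (1 : R)) x) d2)).
by field.
Qed.

Lemma measurable_lipschitz (g : R -> R) (L : R) :
  (forall x y, `|g x - g y| <= L * `|x - y|) -> continuous g.
Proof.
move=> gL x; apply/cvgrPdist_le => e e0.
have L1 : 0 < `|L| + 1 by rewrite ltr_wpDl.
have e1 : 0 < e / (`|L| + 1) by rewrite divr_gt0.
have /cvgrPdist_le/(_ _ e1) cv : y @[y --> x] --> x by exact: cvg_id.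
near=> y; apply: le_trans (gL x y) _.
apply: (@le_trans _ _ ((`|L| + 1) * (e / (`|L| + 1)))); last first.
  by rewrite mulrC divfK// gt_eqF.
apply: (@le_trans _ _ ((`|L| + 1) * `|x - y|)).
  by rewrite ler_wpM2r// (le_trans (ler_norm L))// lerDl.
apply: ler_wpM2l; first exact: ltW.
by near: y.
Unshelve. all: by end_near. Qed.

Variables (g : R -> R) (Lg A : R).
Hypothesis g01 : forall x, 0 <= g x <= 1.
Hypothesis gL : forall x y, `|g x - g y| <= Lg * `|x - y|.
Hypothesis gl : forall x, x <= - A -> g x = 1.
Hypothesis gr : forall x, A <= x -> g x = 0.

Let cg : continuous g. Proof. exact: measurable_lipschitz gL. Qed.
Let mg : measurable_fun [set: measurableTypeR R] g. Proof. exact: continuous_measurable_fun. Qed.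
Let cp : continuous p. Proof. by apply: continuous_normal_pdf; rewrite oner_eq0. Qed.
Let mp : measurable_fun [set: measurableTypeR R] p. Proof. exact: measurable_normal_pdf. Qed.

Let ip (B : set (measurableTypeR R)) : measurable B -> mu.-integrable B (EFin \o p).
Proof.
by move=> mB; apply: (integrableS measurableT) => //; exact: integrable_normal_pdf.
Qed.

Let ihp (h : R -> R) (B : set (measurableTypeR R)) : measurable B -> measurable_fun [set: measurableTypeR R] h ->
  (forall x, `|h x| <= 1) -> mu.-integrable B (EFin \o (fun x => h x * p x)).
Proof.
move=> mB mh h1; apply: (le_integrable _ _ _ (ip mB)) => //.
  by apply/measurable_EFinP; apply: measurable_funTS; apply: measurable_funM.
move=> x _ /=; rewrite lee_fin normrM ler_piMl// .
Qed.

Let hp_le (h : R -> R) (B : set (measurableTypeR R)) : measurable B -> measurable_fun [set: measurableTypeR R] h ->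
  (forall x, `|h x| <= 1) -> `|\int[mu]_(x in B) (h x * p x)| <= fine (NP B).
Proof.
move=> mB mh h1; have H := le_normr_Rintegral mB (ihp mB mh h1).
apply: (le_trans H).
rewrite -[leRHS]/(\int[mu]_(x in B) p x); apply: le_Rintegral => //.
- have := ihp mB mh h1 => /integrable_norm; apply: eq_integrable => //.
- exact: ip.
by move=> x _; rewrite normrM (ger0_norm (ltW (normal_pdf01_gt0 x))) ler_piMl// ltW// normal_pdf01_gt0.
Qed.

(** E g(N) for a standard normal N. *)
Definition stein_mean := \int[mu]_x (g x * p x).
Local Notation m := stein_mean.

Let g1 x : `|g x| <= 1.
Proof. by have /andP[h0 h1] := g01 x; rewrite ger0_norm. Qed.

Let pT : \int[mu]_x p x = 1.
Proof. by rewrite /Rintegral integral_normal_pdf. Qed.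

Lemma stein_mean_ge t : (forall x, x <= t -> g x = 1) -> fine (NP `]-oo, t]%classic) <= m.
Proof.
move=> gt; rewrite -[leLHS]/(\int[mu]_(x in `]-oo, t]) p x).
rewrite Rintegral_mkcond; apply: le_Rintegral => //.
- have -> : EFin \o (p \_ `]-oo, t]%classic) = (EFin \o p) \_ `]-oo, t]%classic.
    by rewrite restrict_EFin.
  by rewrite -integrable_mkcond//; exact: ip.
- exact: ihp.
move=> x _; rewrite patchE; case: ifPn => [/set_mem/=|_].
  by rewrite in_itv/= => /gt ->; rewrite mul1r.
by have /andP[h0 _] := g01 x; rewrite mulr_ge0// ltW// normal_pdf01_gt0.
Qed.

Lemma stein_mean_le t : (forall x, t < x -> g x = 0) -> m <= fine (NP `]-oo, t]%classic).
Proof.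
move=> gt; rewrite -[leRHS]/(\int[mu]_(x in `]-oo, t]) p x).
rewrite [leRHS]Rintegral_mkcond; apply: le_Rintegral => //.
- exact: ihp.
- have -> : EFin \o (p \_ `]-oo, t]%classic) = (EFin \o p) \_ `]-oo, t]%classic.
    by rewrite restrict_EFin.
  by rewrite -integrable_mkcond//; exact: ip.
move=> x _; rewrite patchE; case: ifPn => [_|/negP xt].
  by have /andP[h0 h1] := g01 x; rewrite ler_piMl// ltW// normal_pdf01_gt0.
rewrite gt ?mul0r// ltNge; apply/negP => h; apply: xt; apply/mem_set => /=.
by rewrite in_itv/=.
Qed.

Let m01 : 0 <= m <= 1.
Proof.
apply/andP; split.
  apply: Rintegral_ge0 => x _; have /andP[h0 _] := g01 x.
  by rewrite mulr_ge0// ltW// normal_pdf01_gt0.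
rewrite -[leRHS]pT; apply: le_Rintegral => //; [exact: ihp|exact: ip|].
by move=> x _; have /andP[h0 h1] := g01 x; rewrite ler_piMl// ltW// normal_pdf01_gt0.
Qed.

Let h x := g x - m.
Let h1 x : `|h x| <= 1.
Proof.
have /andP[a0 a1] := g01 x; have /andP[b0 b1] := m01.
by rewrite /h ler_norml; apply/andP; split; lra.
Qed.
Let mh : measurable_fun [set: measurableTypeR R] h.
Proof. by apply: measurable_funB => //; exact: measurable_cst. Qed.

Let I (x : R) : R := \int[mu]_(u in `]-oo, x]) (h u * p u).

Let dI (x : R) : is_derive x 1 I (h x * p x).
Proof.
have chp : {for x, continuous (fun u => h u * p u)}.
  apply: continuousM; last exact: cp.
  by apply: continuousB; [exact: cg|exact: cst_continuous].
have x1 : x < x + 1 by rewrite ltrDl.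
have it : mu.-integrable `]-oo, x + 1] (EFin \o (fun u => h u * p u)) by exact: ihp.
have [d1 d2] := continuous_FTC1 x1 it (ltNyr x) chp.
apply: DeriveDef; first exact: d1.
by rewrite -derive1E d2.
Qed.

Let hT : \int[mu]_x (h x * p x) = 0.
Proof.
rewrite /h; under eq_Rintegral do rewrite mulrBl.
rewrite RintegralB//; [|exact: ihp|]; last first.
  by apply: (ihp (h := fun _ => m)) => //; have /andP[b0 b1] := m01 => _; rewrite ger0_norm.
by rewrite RintegralZl ?pT ?mulr1 ?subrr//; exact: ip.
Qed.

Let I_cdf (F : nat -> set (measurableTypeR R)) e : 0 < e ->
  (forall n, measurable (F n)) -> nonincreasing_seq F -> \bigcap_n F n = set0 ->
  exists n, forall B, measurable B -> B `<=` F n ->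
    `|\int[mu]_(u in B) (h u * p u)| <= e.
Proof.
move=> e0 mF nF F0.
have PF0 : NP (\bigcap_n F n) = 0%E by rewrite F0 measure0.
have [n Hn] := prob_decreasing_eps mF nF PF0 e0.
exists n => B mB BF; apply: le_trans Hn; apply: le_trans (hp_le mB mh h1) _.
apply: fine_le; [exact: fin_num_measure|exact: fin_num_measure|].
by apply: le_measure => //; rewrite inE.
Qed.

Let nat_above (x : R) : x < (Num.truncn `|x|).+1%:R.
Proof.
by have /andP[_] := truncn_itv (normr_ge0 x); apply: le_lt_trans; exact: ler_norm.
Qed.

Let I_Ny (e : R) : 0 < e -> exists B, forall y, B <= y -> `|I (- y)| <= e.
Proof.
move=> e0; have [|||n Hn] := @I_cdf (fun n => `]-oo, - (n%:R : R)]%classic) e e0.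
- by move=> n; exact: measurable_itv.
- move=> i j ij; apply/subsetPset => x; rewrite /= !in_itv/= => /le_trans; apply.
  by rewrite lerN2 ler_nat.
- apply/seteqP; split => // x H.
  have := H _ (Logic.I : [set: nat] (Num.truncn `|- x|).+1); rewrite /= in_itv/=.
  by have := nat_above (- x); lra.
exists n%:R => y ny; apply: Hn; first exact: measurable_itv.
by move=> x; rewrite /= !in_itv/= => /le_trans; apply; rewrite lerN2.
Qed.

Let I_right x : I x = - \int[mu]_(u in `]x, +oo[) (h u * p u).
Proof.
apply/eqP; rewrite -addr_eq0; apply/eqP; rewrite -[RHS]hT.
have mA : measurable (`]-oo, x]%classic : set (measurableTypeR R)) by exact: measurable_itv.
have mB : measurable (`]x, +oo[%classic : set (measurableTypeR R)) by exact: measurable_itv.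
have -> : [set: R] = `]-oo, x]%classic `|` `]x, +oo[%classic.
  by rewrite -itv_bndbnd_setU//= set_itvE.
rewrite (Rintegral_setU mA mB); [by []| |].
- exact: ihp (measurableU _ _ mA mB) mh h1.
- by apply/disj_setPS => u; rewrite /= !in_itv/= andbT => -[/le_lt_trans h2 /h2]; rewrite ltxx.
Qed.

Let I_y (e : R) : 0 < e -> exists B, forall y, B <= y -> `|I y| <= e.
Proof.
move=> e0; have [|||n Hn] := @I_cdf (fun n => `](n%:R : R), +oo[%classic) e e0.
- by move=> n; exact: measurable_itv.
- move=> i j ij; apply/subsetPset => x; rewrite /= !in_itv/= !andbT.
  by apply: le_lt_trans; rewrite ler_nat.
- apply/seteqP; split => // x H.
  have := H _ (Logic.I : [set: nat] (Num.truncn `|x|).+1); rewrite /= in_itv/= andbT.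
  by have := nat_above x; lra.
exists n%:R => y ny; rewrite I_right normrN; apply: Hn; first exact: measurable_itv.
by move=> x; rewrite /= !in_itv/= !andbT; exact: le_lt_trans.
Qed.

Let f (x : R) := I x / p x.
Let f' (x : R) := x * f x + g x - m.

Let pn0 (x : R) : p x != 0. Proof. by rewrite gt_eqF// normal_pdf01_gt0. Qed.

Let df (x : R) : is_derive x 1 f (f' x).
Proof.
apply: (der_eq (derM (dI x) (derV (derive_normal_pdf01 x) (pn0 x)))).
by rewrite /f' /f /h; field; exact: pn0.
Qed.

Let A1 := Num.max 1 A.

Let tail_right (x : R) : A1 <= x ->
  m * (x / (1 + x ^+ 2)) <= f x /\ f x <= m / x.
Proof.
have pC y : p y <= normal_peak (1 : R) by apply: normal_pdf_ub; rewrite oner_eq0.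
rewrite /f; move: x; apply: (@mills R p normal_pdf01_gt0 derive_normal_pdf01 _ pC I m A1).
- by case/andP: m01.
- by rewrite le_max lexx.
- move=> y; rewrite ge_max => /andP[_ Ay]; apply: (der_eq (dI y)).
  by rewrite /h gr// sub0r.
- exact: I_y.
Qed.

Let tail_left (x : R) : A1 <= x ->
  (1 - m) * (x / (1 + x ^+ 2)) <= f (- x) /\ f (- x) <= (1 - m) / x.
Proof.
have pC y : p y <= normal_peak (1 : R) by apply: normal_pdf_ub; rewrite oner_eq0.
rewrite /f normal_pdf01_even; move: x.
apply: (@mills R p normal_pdf01_gt0 derive_normal_pdf01 _ pC (fun y => I (- y)) (1 - m) A1).
- by case/andP: m01 => _; rewrite subr_ge0.
- by rewrite le_max lexx.
- move=> y; rewrite ge_max => /andP[_ Ay].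
  have d1 := @is_derive1_comp _ I (fun y => - y) y _ _ (dI (- y)) (is_deriveN (is_derive_id y 1)).
  by apply: (der_eq d1); rewrite /h gl ?lerN2// normal_pdf01_even; ring.
- exact: I_Ny.
Qed.

(* On a tail, f lies between the two sides of the Mills bound. *)
Let tail_bound (q x y : R) : 0 <= q <= 1 -> 1 <= x ->
  q * (x / (1 + x ^+ 2)) <= y -> y <= q / x ->
  `|y| <= 1 /\ `|x * (x * y - q)| <= 1.
Proof.
move=> /andP[q0 q1] x1 y1 y2; have x0 : 0 < x := lt_le_trans ltr01 x1.
have x2 : 0 < 1 + x ^+ 2 by rewrite ltr_pwDl// sqr_ge0.
have y0 : 0 <= y.
  by apply: le_trans y1; rewrite mulr_ge0// divr_ge0 ?ltW.
split.
  rewrite ger0_norm// (le_trans y2)// ler_pdivrMr// mul1r (le_trans q1)//.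
have u1 : x * y <= q by rewrite mulrC -ler_pdivlMr.
have u2 : q - q / (1 + x ^+ 2) <= x * y.
  apply: le_trans (ler_wpM2l (ltW x0) y1); rewrite le_eqVlt; apply/orP; left; apply/eqP.
  by field; rewrite gt_eqF.
rewrite normrM ger0_norm ?(ltW x0)// distrC ger0_norm ?subr_ge0//.
apply: (@le_trans _ _ (x * (q / (1 + x ^+ 2)))).
  by rewrite ler_wpM2l ?(ltW x0)//; lra.
rewrite mulrA ler_pdivrMr// mul1r.
apply: (@le_trans _ _ x); first by rewrite ler_piMr// ltW.
by have := sqr_ge0 (x - 1); rewrite sqrrB1 mulr2n; lra.
Qed.

Let tail_facts (x : R) : A1 <= `|x| -> `|f x| <= 1 /\ `|x * f' x| <= 1.
Proof.
have /andP[m0 m1] := m01.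
have [x0|x0] := leP 0 x.
  rewrite ger0_norm// => Ax; have [t1 t2] := tail_right Ax.
  have [Ax1 Ax2] : 1 <= x /\ A <= x by move: Ax; rewrite ge_max => /andP[].
  have [h2 h3] := tail_bound m01 Ax1 t1 t2; split => //.
  by rewrite /f' gr// addr0.
rewrite ltr0_norm// => Ax; have [t1 t2] := tail_left Ax.
have [Ax1 Ax2] : 1 <= - x /\ A <= - x by move: Ax; rewrite ge_max => /andP[].
have q01 : 0 <= 1 - m <= 1 by apply/andP; split; lra.
have [h2 h3] := tail_bound q01 Ax1 t1 t2; rewrite opprK in h2 h3; split => //.
rewrite /f' gl; last by rewrite lerNr.
rewrite (_ : x * (x * f x + 1 - m) = - x * (- x * f x - (1 - m))); last by ring.
exact: h3.
Qed.

Let cf : continuous f.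
Proof.
by move=> x; apply: differentiable_continuous; apply/derivable1_diffP; case: (df x).
Qed.

Let cf' : continuous f'.
Proof.
move=> x; apply: cvgB; last exact: cvg_cst.
by apply: cvgD; [apply: cvgM; [exact: cvg_id|exact: cf]|exact: cg].
Qed.

(** The solution is f = I / p with p the normal density and I the integral of (g - m) p up to
    x.  Where g is constant, I is a multiple of a normal tail, so the Mills bounds control f and
    x f prime; on the remaining compact interval continuity is enough.  As g is Lipschitz, so is
    f prime, which gives the Taylor bound. *)
Theorem stein_solution : exists F F' c1 L, [/\ 0 <= L,
  (forall x : R, `|F x| <= c1) /\ (forall x : R, `|F' x| <= c1),
  forall x : R, F' x = x * F x + g x - m,
  forall x y : R, `|F y - F x - F' x * (y - x)| <= L * (y - x) ^+ 2 &
  continuous F /\ continuous F'].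
Proof.
have [c Hc] := bounded_of_tails cf (fun x Ax => (tail_facts Ax).1).
have cxf' : continuous (fun x : R => x * f' x).
  by move=> x; apply: cvgM; [exact: cvg_id|exact: cf'].
have [c' Hc'] := bounded_of_tails cxf' (fun x Ax => (tail_facts Ax).2).
have f'tail (x : R) : A1 <= `|x| -> `|f' x| <= 1.
  move=> Ax; have [_] := tail_facts Ax; rewrite normrM; apply: le_trans.
  by rewrite ler_peMl// (le_trans _ Ax)// le_max lexx.
have [c'' Hc''] := bounded_of_tails cf' f'tail.
have dk (x : R) : is_derive x 1 (fun y => y * f y) (f x + x * f' x).
  by apply: (der_eq (derM (derI x) (df x))); rewrite mul1r.
have kL := lipschitz_der dk (C := c + c').
have f'L x y : `|f' y - f' x| <= (c + c' + Lg) * `|y - x|.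
  rewrite /f' (_ : _ - _ = (y * f y - x * f x) + (g y - g x)); last by ring.
  rewrite mulrDl (le_trans (ler_normD _ _))// lerD// kL// => u.
  by rewrite (le_trans (ler_normD _ _))// lerD.
have L0 : 0 <= c + c' + Lg.
  by have := f'L 0 1; rewrite subr0 normr1 mulr1; apply: le_trans.
exists f, f', (Num.max c c''), (c + c' + Lg); split => //.
- by split => x; rewrite le_max ?Hc ?Hc'' ?orbT.
- exact: taylor_lipschitz df f'L.
Qed.

End SteinEquation.

(** * Conditional expectation as a function of X *)

Section ConditionalExpectation.
Context {dT : measure_display} {T : measurableType dT} {R : realType}.
Variable P : probability T R.
Context {dU : measure_display} {U : measurableType dU}.

Section DensityMeasure.
Variables (X : T -> U) (b : T -> R).
Hypotheses (mX : measurable_fun setT X) (bb : bmf b) (b0 : forall w, 0 <= b w).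

(** The measure of density b with respect to P, pushed forward by X. *)
Definition density_law (A : set U) : \bar R := (\int[P]_(w in X @^-1` A) (b w)%:E)%E.

Let density_law0 : density_law set0 = 0%E.
Proof. by rewrite /density_law preimage_set0 integral_set0. Qed.

Let density_law_ge0 A : (0 <= density_law A)%E.
Proof. by apply: integral_ge0 => w _; rewrite lee_fin. Qed.

Let density_law_sigma_additive : semi_sigma_additive density_law.
Proof.
move=> F mF tF mUF; rewrite /density_law preimage_bigcup.
apply: (@semi_sigma_additive_nng_induced _ _ _ P (fun w => (b w)%:E)).
- by apply/measurable_EFinP; case: bb.
- by move=> w; rewrite lee_fin.
- by move=> n; rewrite -[X in measurable X]setTI; exact: mX.
- apply/trivIsetP => /= i j _ _ ij; rewrite -preimage_setI.
  by move/trivIsetP : tF => /(_ _ _ _ _ ij) ->//; rewrite preimage_set0.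
- by rewrite -preimage_bigcup -[X in measurable X]setTI; exact: mX.
Qed.

HB.instance Definition _ := isMeasure.Build _ _ _ density_law
  density_law0 density_law_ge0 density_law_sigma_additive.

Let density_law_finite : fin_num_fun density_law.
Proof.
move=> A mA; have mXA : measurable (X @^-1` A).
  by rewrite -[Y in measurable Y]setTI; exact: mX.
apply: integrable_fin_num => //.
by apply: (integrableS measurableT) => //; exact: (bmf_integrable P bb).
Qed.

HB.instance Definition _ := @Measure_isFinite.Build _ _ _ density_law density_law_finite.

End DensityMeasure.

Variable X : T -> U.
Hypothesis mX : measurable_fun setT X.

Let meas_pre (A : set U) : measurable A -> measurable (X @^-1` A).
Proof. by move=> mA; rewrite -[Y in measurable Y]setTI; exact: mX. Qed.

(** beta(X) is E[b | X], tested against bounded functions of X. *)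
Definition cexp_of (b : T -> R) (beta : U -> R) := bmf beta /\
  forall phi : U -> R, bmf phi -> Ex P (fun w => b w * phi (X w)) =
                         Ex P (fun w => beta (X w) * phi (X w)).

Let ind (A : set U) (x : U) : R := \1_A x.

Let bind (A : set U) : measurable A -> bmf (ind A).
Proof.
move=> mA; apply: (@bmf_le _ _ _ _ 1); first exact: measurable_indic.
by move=> x; rewrite /ind indicE; case: (_ \in _); rewrite ?normr1 ?normr0.
Qed.

Let Ex_ind (g : T -> R) (A : set U) : bmf g -> measurable A ->
  (Ex P (fun w => g w * ind A (X w)))%:E = (\int[P]_(w in X @^-1` A) (g w)%:E)%E.
Proof.
move=> bg mA; rewrite EFin_Ex; last by apply: bmfM => //; apply: bmf_comp => //; exact: bind.
rewrite [RHS]integral_mkcond; apply: eq_integral => w _.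
rewrite patchE /ind indicE.
rewrite (_ : (w \in X @^-1` A) = (X w \in A)); last first.
  by apply/idP/idP => /set_mem h; exact/mem_set.
by case: (X w \in A); rewrite ?mulr1 ?mulr0.
Qed.

Let int_law (gam : U -> R) (A : set U) : bmf gam -> measurable A ->
  (\int[density_law X (fun _ => 1%R)]_(x in A) (gam x)%:E)%E =
  (Ex P (fun w => gam (X w) * ind A (X w)))%:E.
Proof.
move=> bg mA; have bgX : bmf (fun w => gam (X w)) by exact: bmf_comp.
rewrite Ex_ind// -(@integral_pushforward _ _ _ _ _ _ mX P A (EFin \o gam)) //; first last.
- apply: (integrableS measurableT) => //; first exact: meas_pre.
  exact: (bmf_integrable P bgX).
- by apply/measurable_EFinP; case: bg.
have c0 (w : T) : (0 : R) <= 1 by exact: ler01.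
have bc : bmf (fun _ : T => 1 : R) by exact: bmf_cst.
apply: eq_measure_integral => // B mB _.
by rewrite /= /density_law integral_cst ?mul1e//; exact: meas_pre.
Qed.

(** The law of X weighted by b is dominated by the law of X; its density, which is at most 1
    almost everywhere, is cut at 1 so that the bounds hold everywhere. *)
Lemma cexp_indic (b : T -> R) : bmf b -> (forall w, 0 <= b w <= 1) ->
  exists beta, [/\ bmf beta, forall x, 0 <= beta x <= 1 & forall A, measurable A ->
    Ex P (fun w => b w * ind A (X w)) = Ex P (fun w => beta (X w) * ind A (X w))].
Proof.
move=> bb b01; have b0 w : 0 <= b w by case/andP: (b01 w).
have c0 (w : T) : (0 : R) <= 1 by exact: ler01.
have bc : bmf (fun _ : T => 1 : R) by exact: bmf_cst.
have lawE A : measurable A -> density_law X (fun _ => 1) A = P (X @^-1` A).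
  by move=> mA; rewrite /density_law integral_cst ?mul1e//; exact: meas_pre.
have dom : density_law X b `<< density_law X (fun _ => 1).
  apply/null_content_dominatesP => A mA H.
  have PA0 : P (X @^-1` A) = 0%E by rewrite -lawE.
  change (\int[P]_(w in X @^-1` A) (b w)%:E = 0)%E.
  apply: null_set_integral => //; first exact: meas_pre.
  apply: measurable_funTS; apply/measurable_EFinP; by case: bb.
have [f [f0 ffin intf fE]] :=
  @radon_nikodym_sigma_finite _ U R (density_law X (fun _ => 1)) (density_law X b)
  dom.
have mf : measurable_fun setT f by exact: measurable_int intf.
have mff : measurable_fun setT (fun x => fine (f x)) by exact: measurableT_comp.
pose beta x := Num.min (fine (f x)) 1.
have beta01 x : 0 <= beta x <= 1.
  by rewrite /beta ge_min lexx orbT andbT le_min ler01 andbT fine_ge0.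
have bbeta : bmf beta.
  apply: (@bmf_le _ _ _ _ 1); first by apply: measurable_minr => //; exact: measurable_cst.
  by move=> x; have /andP[h0 h1] := beta01 x; rewrite ger0_norm.
exists beta; split => // A mA.
pose E := [set x | 1 < fine (f x)].
have mE : measurable E.
  rewrite (_ : E = (fun x => fine (f x)) @^-1` `]1, +oo[%classic).
    by rewrite -[Y in measurable Y]setTI; exact: mff.
  by apply/seteqP; split => x; rewrite /E /= in_itv/= andbT.
have bX1 B : measurable B -> bmf (fun w => b w * ind B (X w)).
  by move=> mB; apply: bmfM => //; apply: bmf_comp => //; exact: bind.
have bX2 B : measurable B -> bmf (fun w => beta (X w) * ind B (X w)).
  by move=> mB; apply: bmfM; apply: bmf_comp => //; exact: bind.
have mAE : measurable (A `&` E) by exact: measurableI.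
have mAD : measurable (A `\` E) by exact: measurableD.
have splitE (g : T -> R) : bmf g -> Ex P (fun w => g w * ind A (X w)) =
    Ex P (fun w => g w * ind (A `&` E) (X w)) + Ex P (fun w => g w * ind (A `\` E) (X w)).
  move=> bg; rewrite -ExD.
  - apply: Ex_ext => w; rewrite -mulrDr /ind !indicE in_setD in_setI; congr (_ * _).
    by case: (_ \in A); case: (_ \in E); rewrite /= ?addr0 ?add0r.
  - by apply: bmfM => //; apply: bmf_comp => //; exact: bind.
  - by apply: bmfM => //; apply: bmf_comp => //; exact: bind.
rewrite !splitE//; last exact: bmf_comp.
congr (_ + _).
  apply: le_anti; apply/andP; split.
    apply: Ex_le; [exact: bX1|exact: bX2|move=> w].
    rewrite /ind indicE; case: (boolP (X w \in _)) => [/set_mem[_ XE]|_]; last by rewrite !mulr0.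
    rewrite !mulr1 /beta (min_idPr _); first by case/andP: (b01 w).
    exact: ltW.
  rewrite -lee_fin [leRHS]Ex_ind// [leRHS](fE _ mAE) -int_law//.
  apply: le_integral => //.
  - apply: (integrableS measurableT) => //.
    have := @bmf_integrable _ _ _ P _ (bmf_comp bbeta mX).
    move=> _; apply: measurable_bounded_integrable => //; last 2 first.
    + exact: bbeta.1.
    + exists 1; split; first exact: num_real.
      move=> y y1 x _ /=; have /andP[h0 h1] := beta01 x.
      by rewrite ger0_norm// (le_trans h1)// ltW.
    have fin1 : (density_law X (fun=> 1%R) setT < +oo)%E.
      by rewrite lawE// preimage_setT probability_setT ltry.
    exact: fin1.
  - exact: integrableS intf.
  move=> x _; rewrite -[f x]fineK// lee_fin /beta ge_min lexx//.
apply: EFin_inj; rewrite [LHS]Ex_ind// [LHS](fE _ mAD) -int_law//.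
apply: eq_integral => x /set_mem[_ nE]; rewrite -[f x]fineK//; congr (_%:E).
by rewrite /beta (min_idPl _)// leNgt; apply/negP.
Qed.

(** Indicators suffice as test functions, by approximation on a grid. *)
Lemma cexp_exists01 (b : T -> R) : bmf b -> (forall w, 0 <= b w <= 1) ->
  exists2 beta, cexp_of b beta & forall x, 0 <= beta x <= 1.
Proof.
move=> bb b01; have [beta [bbeta beta01 H]] := cexp_indic bb b01.
exists beta => //; split => // phi bp.
have [mp [c Hc]] := bp.
pose C := `|c| + 1; have C0 : 0 < C by rewrite ltr_wpDl.
have C2 : 0 < 2 * C by rewrite mulr_gt0.
pose psi x := (phi x + C) / (2 * C).
have bpsi : bmf psi by apply: bmfM; [apply: bmfD => //|]; exact: bmf_cst.
have psi01 x : 0 <= psi x <= 1.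
  have := le_trans (Hc x) (ler_norm c); rewrite ler_norml => /andP[h1 h2].
  rewrite /psi; apply/andP; split; last by rewrite ler_pdivrMr// mul1r /C; lra.
  by apply: divr_ge0; [rewrite /C; lra|exact: ltW].
have bX (g : U -> R) : bmf g -> bmf (fun w => g (X w)) by move=> bg; exact: bmf_comp.
have bD : bmf (fun w => b w - beta (X w)) by apply: bmfB => //; exact: bX.
have D1 w : `|b w - beta (X w)| <= 1.
  have /andP[h0 h1] := b01 w; have /andP[h2 h3] := beta01 (X w).
  by rewrite ler_norml; apply/andP; split; lra.
have Hind A : measurable A -> Ex P (fun w => (b w - beta (X w)) * ind A (X w)) = 0.
  move=> mA; under Ex_ext do rewrite mulrBl.
  rewrite ExB ?H ?subrr//; apply: bmfM; try exact: bX; try exact: (bX _ (bind mA)).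
  by [].
have Hgrid M : Ex P (fun w => (b w - beta (X w)) * grid M (psi (X w))) = 0.
  pose A (q : nat) := [set x | q.+1%:R / M.+1%:R <= psi x].
  have mA q : measurable (A q).
    rewrite (_ : A q = psi @^-1` `[q.+1%:R / M.+1%:R, +oo[).
      by rewrite -[Y in measurable Y]setTI; apply: bpsi.1.
    by apply/seteqP; split => x /=; rewrite in_itv/= andbT.
  transitivity (M.+1%:R^-1 * \sum_(q < M.+1) Ex P (fun w => (b w - beta (X w)) * ind (A q) (X w))).
    rewrite -Ex_sum; last by move=> q; apply: bmfM => //; exact: (bX _ (bind (mA q))).
    rewrite -ExZ; last first.
      by apply: bmf_sum => q; apply: bmfM => //; exact: (bX _ (bind (mA q))).
    apply: Ex_ext => w; rewrite /grid mulrCA mulr_sumr; congr (_ * _).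
    apply: eq_bigr => q _; congr (_ * _); rewrite /ind indicE; congr (_%:R); congr nat_of_bool.
    by apply/idP/idP => [h|/set_mem//]; exact/mem_set.
  by rewrite big1 ?mulr0// => q _; exact: Hind.
have E0 : Ex P (fun w => (b w - beta (X w)) * psi (X w)) = 0.
  apply/eqP; rewrite -normr_le0; apply/ler_addgt0Pl => e e0; rewrite addr0.
  pose M := Num.truncn e^-1.
  have bg : bmf (fun x => grid M (psi x)).
    apply: bmfM; first exact: bmf_cst.
    by apply: bmf_sum => q; apply: bmf_bool; apply: measurable_fun_ler => //; exact: bpsi.1.
  rewrite -[Ex _ _]subr0 -(Hgrid M) -ExB; last 2 first.
  - by apply: bmfM => //; exact: (bX _ bpsi).
  - by apply: bmfM => //; exact: (bX _ bg).
  have b1 : bmf (fun w => (b w - beta (X w)) * psi (X w) -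
    (b w - beta (X w)) * grid M (psi (X w))).
    by apply: bmfB; (apply: bmfM => //); first [exact: bX | exact: (bX _ bg)].
  apply: le_trans (Ex_normr P b1) _; apply: Ex_le_cst; first exact: bmf_norm.
  move=> w; rewrite -mulrBr normrM.
  have /andP[g0 g1] := grid_bound M (psi01 (X w)).
  apply: (@le_trans _ _ (1 * M.+1%:R^-1)); first by apply: ler_pM => //; rewrite ger0_norm.
  rewrite mul1r -[leRHS]invrK lef_pV2 ?posrE ?invr_gt0//.
  have ei : 0 <= e^-1 by rewrite invr_ge0 ltW.
  by have /andP[_ /ltW] := truncn_itv ei.
have E1 : Ex P (fun w => b w - beta (X w)) = 0.
  rewrite -(Hind setT measurableT); apply: Ex_ext => w.
  by rewrite /ind indicE in_setT mulr1.
apply/eqP; rewrite -subr_eq0 -ExB; last 2 first.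
- by apply: bmfM => //; exact: bX.
- by apply: bmfM; exact: bX.
apply/eqP; transitivity (Ex P (fun w => 2 * C * ((b w - beta (X w)) * psi (X w)) -
    C * (b w - beta (X w)))).
  apply: Ex_ext => w; rewrite /psi; field.
  by rewrite gt_eqF//.
rewrite ExB; last 2 first.
- by apply: bmfM; [exact: bmf_cst|apply: bmfM => //; exact: bX].
- by apply: bmfM => //; exact: bmf_cst.
rewrite !ExZ ?E0 ?E1 ?mulr0 ?subrr//; apply: bmfM => //; exact: bX.
Qed.

End ConditionalExpectation.

(** * Decomposition of the statistic *)

(** Of two points one is a candidate for the other, so at most one point has no neighbour. *)
Lemma nbr_self_unique (R : realType) d (rho : neighbor_rule R d) n
    (x : 'I_n -> d.-tuple R) i j : first_distinct x ->
  nbr rho [set: 'I_n]%SET x i = i -> nbr rho [set: 'I_n]%SET x j = j -> i = j.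
Proof.
move=> dx; rewrite /nbr.
have self k : nb (arel rho x) (lrel rho x) [set: 'I_n]%SET k = k ->
    forall r, cand (arel rho x) [set: 'I_n]%SET k r = false.
  case: nbP => [|||s /and3P[_ sk _] _ E|//].
  - by move=> l; exact: lrel_refl.
  - by move=> l; exact: lrel_trans.
  - by move=> l; exact: lrel_total.
  by rewrite E eqxx in sk.
move=> /self ci /self cj; apply/eqP; apply/negPn/negP => ij.
have := allowed_total rho (dx _ _ ij).
have := ci j; have := cj i; rewrite /cand !finset.in_setT /= /arel [j == i]eq_sym ij /=.
by move=> -> ->.
Qed.

Section Decomposition.
Context {dT : measure_display} {T : measurableType dT} {R : realType}.
Variable P : probability T R.
Context {d : nat}.
Local Notation S := (d.-tuple R * R)%type.
Variables (Z : nat -> T -> S) (Z0 : T -> S).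
Hypothesis mZ : forall i, measurable_fun setT (Z i).
Hypothesis mZ0 : measurable_fun setT Z0.
Hypothesis copies : forall i, identically_distributed P (Z i) Z0.
Hypothesis indep : mutually_independent P Z.
Variable rho : neighbor_rule R d.
Hypothesis sep_ae : forall n, {ae P, forall w, sep (sample Z n w)}.

Local Notation EZ := (En P Z).
Local Notation K := (Kdeg rho).
Local Notation N := (nn rho [set: 'I_(_)]%SET).
Local Notation X0 := (fun w => (Z0 w).1).

Lemma indep_of_y_M n (j : 'I_n) (f g : n.-tuple S -> R) :
  indep_of_y j f -> indep_of_y j g -> indep_of_y j (fun z => f z * g z).
Proof. by move=> hf hg z s E; rewrite hf// hg. Qed.

Lemma indep_of_y_tnth n (j i : 'I_n) (b : S -> R) : i != j ->
  indep_of_y j (fun z => b (tnth z i)).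
Proof. by move=> ij z s E; rewrite tnth_upd (negbTE ij). Qed.

Lemma indep_of_y_xs n (j : 'I_n) (g : ('I_n -> d.-tuple R) -> R) :
  indep_of_y j (fun z => g (xs z)).
Proof. by move=> z s E; rewrite xs_upd_same. Qed.

(** Psi sees the point r only through its covariate, so averaging over the point r is an
    average of b against a function of the covariate. *)
Lemma En_cexp n (r : 'I_n) (b : S -> R) beta (Psi : n.-tuple S -> R) :
  bmf b -> cexp_of P X0 (fun w => b (Z0 w)) beta -> bmf Psi -> indep_of_y r Psi ->
  EZ (fun z => b (tnth z r) * Psi z) = EZ (fun z => beta (xs z r) * Psi z).
Proof.
move=> bb [bbeta H] bP iP; apply/eqP; rewrite -subr_eq0; apply/eqP.
have b1 : bmf (fun z => b (tnth z r) * Psi z) by apply: bmfM => //; exact: bmf_tnth.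
have b2 : bmf (fun z => beta (xs z r) * Psi z) by apply: bmfM => //; exact: bmf_xs.
rewrite /En -[LHS]ExB; last 2 first.
- exact: (bmf_sample mZ (Phi := fun z => b (tnth z r) * Psi z)).
- exact: (bmf_sample mZ (Phi := fun z => beta (xs z r) * Psi z)).
apply: (En_eq0 mZ mZ0 copies indep (j := r)
  (Phi := fun z => b (tnth z r) * Psi z - beta (xs z r) * Psi z)); first exact: bmfB.
move=> z; pose phi x := Psi (upd z r (x, 0)).
have PhiE s : Psi (upd z r s) = phi s.1.
  have := iP (upd z r s) (s.1, 0); rewrite upd_upd => <- //.
  by rewrite /xs tnth_upd eqxx.
have bphi : bmf phi.
  apply: (bmf_comp bP); apply: measurable_upd; first exact: measurable_cst.
  by apply: measurable_fun_pair => //; exact: measurable_cst.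
have mX0 : measurable_fun setT X0 by exact: measurableT_comp.
have bb0 : bmf (fun w => b (Z0 w)) by exact: bmf_comp.
have bp0 : bmf (fun w => phi (Z0 w).1) by exact: bmf_comp bphi mX0.
have be0 : bmf (fun w => beta (Z0 w).1) by exact: bmf_comp bbeta mX0.
transitivity (Ex P (fun w => b (Z0 w) * phi (Z0 w).1 - beta (Z0 w).1 * phi (Z0 w).1)).
  by apply: Ex_ext => w; rewrite !PhiE /xs tnth_upd eqxx.
by rewrite ExB ?H ?subrr//; exact: bmfM.
Qed.

(** The variation along neighbours, averaged over the levels. *)
Definition mean_ndiff M (g : 'I_M.+1 -> d.-tuple R -> R) b n :=
  M.+1%:R^-1 * \sum_k ndiff P Z rho b (g k) n.

Lemma En_mean_ndiff M (g : 'I_M.+1 -> d.-tuple R -> R) n b : (forall k, bmf (g k)) ->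
  EZ (fun z : n.-tuple S => \sum_i M.+1%:R^-1 *
    \sum_k `|g k (xs z i) - g k (xs z (nsel rho b z i))|) = mean_ndiff g b n.
Proof.
move=> bg; have bk k : bmf (fun z : n.-tuple S =>
    \sum_i `|g k (xs z i) - g k (xs z (nsel rho b z i))|) by exact: bmf_ndiff.
transitivity (EZ (fun z : n.-tuple S => M.+1%:R^-1 *
    \sum_k \sum_i `|g k (xs z i) - g k (xs z (nsel rho b z i))|)).
  by apply: Ex_ext => w; rewrite -mulr_sumr exchange_big.
rewrite /En ExZ ?Ex_sum//.
- by move=> k; exact: (bmf_sample mZ (bk k)).
- exact: (bmf_sample mZ (Phi := fun z : n.-tuple S => \sum_k \sum_i
    `|g k (xs z i) - g k (xs z (nsel rho b z i))|) (bmf_sum _ _ bk)).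
Qed.

Section OneGrid.
Variables (v h : R -> R).
Hypotheses (mv : measurable_fun setT v) (mh : measurable_fun setT h).
Hypotheses (v01 : forall y, 0 <= v y <= 1) (h01 : forall y, 0 <= h y <= 1).

Definition stat n (z : n.-tuple S) :=
  \sum_i Num.min (v (tnth z i).2) (v (tnth z (N z i)).2) + \sum_i h (tnth z i).2.

Lemma bmf_v : bmf (fun s : S => v s.2).
Proof.
apply: (@bmf_le _ _ _ _ 1); first exact: measurableT_comp.
by move=> s; have /andP[v0 v1] := v01 s.2; rewrite ger0_norm.
Qed.

Lemma bmf_h : bmf (fun s : S => h s.2).
Proof.
apply: (@bmf_le _ _ _ _ 1); first exact: measurableT_comp.
by move=> s; have /andP[v0 v1] := h01 s.2; rewrite ger0_norm.
Qed.

Lemma bmf_min dU (U : measurableType dU) (f g : U -> R) : bmf f -> bmf g ->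
  bmf (fun z => Num.min (f z) (g z)).
Proof.
move=> [mf [c1 H1]] [mg [c2 H2]]; split; first exact: measurable_minr.
by exists (Num.max c1 c2) => w; rewrite le_max; case: (leP (f w) (g w)) => _;
  rewrite ?H1 ?H2 ?orbT.
Qed.

Lemma bmf_stat n : bmf (@stat n).
Proof.
apply: bmfD; apply: bmf_sum => i; last exact: (bmf_tnth i bmf_h).
apply: (@bmf_select _ _ _ _ (fun z => N z i)
  (fun r (z : n.-tuple S) => Num.min (v (tnth z i).2) (v (tnth z r).2))).
  by move=> r; exact: measurable_N.
by move=> r; apply: bmf_min; [exact: (bmf_tnth i bmf_v)|exact: (bmf_tnth r bmf_v)].
Qed.

Variable M : nat.
Local Notation q := (M.+1%:R : R).

(** The indicator of the k-th grid level of V; pb k is its conditional probability. *)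
Definition lev (k : 'I_M.+1) (s : S) : R := (k.+1%:R / M.+1%:R <= v s.2)%R%:R.

Lemma bmf_lev k : bmf (lev k).
Proof.
apply: bmf_bool; apply: measurable_fun_ler; first exact: measurable_cst.
exact: (bmf_v).1.
Qed.

Lemma lev01 k s : 0 <= lev k s <= 1.
Proof. by rewrite /lev; case: (_ / _ <= _); rewrite /= ?lexx ?ler01. Qed.

Variable pb : 'I_M.+1 -> d.-tuple R -> R.
Hypothesis pbP : forall k, cexp_of P X0 (fun w => lev k (Z0 w)) (pb k).
Hypothesis pb01 : forall k x, 0 <= pb k x <= 1.

Let bpb k : bmf (pb k). Proof. by case: (pbP k). Qed.
Let bpb1 k : bmf (fun s : S => pb k s.1).
Proof. by apply: bmf_comp (bpb k) _. Qed.

Lemma mean_le (F : 'I_M.+1 -> R) c : (forall k, `|F k| <= c) -> `|q^-1 * \sum_k F k| <= c.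
Proof.
move=> Fc; rewrite normrM gtr0_norm ?invr_gt0// ler_pdivrMl//.
apply: le_trans (ler_norm_sum _ _ _) _.
by rewrite -sum_cst_ord; exact: ler_sum.
Qed.

(** The kernel of W: the grid value of the minimum of two copies of V, minus its
    conditional mean given the two covariates. *)
Definition pair_part (s t : S) : R :=
  q^-1 * \sum_k (lev k s * lev k t - pb k s.1 * pb k t.1).
Definition point_raw (s : S) : R := q^-1 * \sum_k pb k s.1 ^+ 2 + h s.2.
Definition point_part (s : S) : R := point_raw s - Ex P (fun w => point_raw (Z0 w)).

Lemma bmf_point_raw : bmf point_raw.
Proof.
apply: bmfD; last exact: bmf_h.
by apply: bmfM; [exact: bmf_cst|apply: bmf_sum => k; apply: bmfX].
Qed.

Lemma bmf_point_part : bmf point_part.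
Proof. by apply: bmfB; [exact: bmf_point_raw|exact: bmf_cst]. Qed.

Lemma bmf_pair_part : bmf (fun u : S * S => pair_part u.1 u.2).
Proof.
apply: bmfM; first exact: bmf_cst.
apply: bmf_sum => k; apply: bmfB; apply: bmfM.
- by apply: bmf_comp (bmf_lev k) _.
- by apply: bmf_comp (bmf_lev k) _.
- by apply: bmf_comp (bpb1 k) _.
- by apply: bmf_comp (bpb1 k) _.
Qed.

Lemma pair_part_le s t : `|pair_part s t| <= 2.
Proof.
apply: mean_le => k; have /andP[a0 a1] := lev01 k s; have /andP[b0 b1] := lev01 k t.
have /andP[c0 c1] := pb01 k s.1; have /andP[d0 d1] := pb01 k t.1.
have ? : 0 <= lev k s * lev k t <= 1 by rewrite mulr_ge0//= mulr_ile1.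
have ? : 0 <= pb k s.1 * pb k t.1 <= 1 by rewrite mulr_ge0//= mulr_ile1.
by rewrite ler_norml; apply/andP; split; lra.
Qed.

Lemma point_raw_bounds s : 0 <= point_raw s <= 2.
Proof.
have /andP[h0 h1] := h01 s.2; rewrite /point_raw.
have m0 : 0 <= q^-1 * \sum_k pb k s.1 ^+ 2.
  by rewrite mulr_ge0// sumr_ge0// => k _; exact: sqr_ge0.
have := @mean_le (fun k => pb k s.1 ^+ 2) 1.
rewrite (ger0_norm m0) => H; have {}H : q^-1 * \sum_k pb k s.1 ^+ 2 <= 1.
  apply: H => k; have /andP[c0 c1] := pb01 k s.1.
  by rewrite ger0_norm ?sqr_ge0// expr_le1.
by rewrite addr_ge0//= -[2]/(1 + 1) lerD.
Qed.

Lemma point_part_le s : `|point_part s| <= 2.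
Proof.
have b0 : bmf (fun w => point_raw (Z0 w)) by exact: bmf_comp bmf_point_raw mZ0.
have e0 : 0 <= Ex P (fun w => point_raw (Z0 w)).
  by apply: Ex_ge0 => w; case/andP: (point_raw_bounds (Z0 w)).
have e2 : Ex P (fun w => point_raw (Z0 w)) <= 2.
  by apply: Ex_le_cst => // w; case/andP: (point_raw_bounds (Z0 w)).
have /andP[p0 p2] := point_raw_bounds s.
by rewrite /point_part ler_norml; apply/andP; split; lra.
Qed.

Lemma point_part_mean0 : Ex P (fun w => point_part (Z0 w)) = 0.
Proof.
rewrite /point_part ExB ?Ex_cst ?subrr//; last exact: bmf_cst.
exact: bmf_comp bmf_point_raw mZ0.
Qed.

(** Replace the two indicators by their conditional probabilities one at a time. *)
Lemma pair_part_mean0 n (i r : 'I_n) Psi : i != r -> bmf Psi ->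
  indep_of_y i Psi -> indep_of_y r Psi ->
  EZ (fun z => pair_part (tnth z i) (tnth z r) * Psi z) = 0.
Proof.
move=> ir bP iPi iPr.
pose D k z := lev k (tnth z i) * (lev k (tnth z r) * Psi z) -
  pb k (xs z i) * (pb k (xs z r) * Psi z).
have bl k j : bmf (fun z : n.-tuple S => lev k (tnth z j)) by exact: (bmf_tnth j (bmf_lev k)).
have bx k j : bmf (fun z : n.-tuple S => pb k (xs z j)) by exact: bmf_xs.
have b1 k : bmf (fun z => lev k (tnth z i) * (lev k (tnth z r) * Psi z)).
  by do 2 apply: bmfM => //.
have b2 k : bmf (fun z => pb k (xs z i) * (pb k (xs z r) * Psi z)).
  by do 2 apply: bmfM => //.
have bD k : bmf (D k) by exact: bmfB.
transitivity (EZ (fun z => q^-1 * \sum_k D k z)).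
  apply: Ex_ext => w; rewrite /pair_part -mulrA mulr_suml; congr (_ * _).
  by apply: eq_bigr => k _; rewrite /D /xs; ring.
rewrite /En ExZ; last exact: (bmf_sample mZ (Phi := fun z => \sum_k D k z) (bmf_sum _ _ bD)).
rewrite Ex_sum ?big1 ?mulr0// => k; last first.
  exact: (bmf_sample mZ (Phi := D k)).
move=> _; rewrite /D ExB; last 2 first.
- exact: (bmf_sample mZ (b1 k)).
- exact: (bmf_sample mZ (b2 k)).
apply/eqP; rewrite subr_eq0; apply/eqP.
rewrite [LHS](@En_cexp n i (lev k) (pb k) (fun z => lev k (tnth z r) * Psi z))//; last 3 first.
- exact: bmf_lev.
- by apply: bmfM.
- by apply: indep_of_y_M => //; apply: indep_of_y_tnth; rewrite eq_sym.
transitivity (EZ (fun z => lev k (tnth z r) * (pb k (xs z i) * Psi z))).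
  by apply: Ex_ext => w; ring.
rewrite (@En_cexp n r (lev k) (pb k) (fun z => pb k (xs z i) * Psi z))//; last 3 first.
- exact: bmf_lev.
- by apply: bmfM.
- by apply: indep_of_y_M => //; apply: (@indep_of_y_xs n r (fun x => pb k (x i))).
by apply: Ex_ext => w; ring.
Qed.

(** The error made when pb_k at the neighbour is replaced by pb_k at the point. *)
Definition drift (x y : d.-tuple R) : R := q^-1 * \sum_k pb k x * (pb k y - pb k x).
Definition drift_pair (s t : S) : R := drift s.1 t.1.

Lemma bmf_drift_pair : bmf (fun u : S * S => drift_pair u.1 u.2).
Proof.
apply: bmfM; first exact: bmf_cst.
apply: bmf_sum => k; apply: bmfM; last apply: bmfB.
- by apply: bmf_comp (bpb1 k) _.
- by apply: bmf_comp (bpb1 k) _.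
- by apply: bmf_comp (bpb1 k) _.
Qed.

Lemma drift_le x y : `|drift x y| <= q^-1 * \sum_k `|pb k x - pb k y|.
Proof.
rewrite normrM gtr0_norm ?invr_gt0// ler_wpM2l ?invr_ge0//.
apply: le_trans (ler_norm_sum _ _ _) _; apply: ler_sum => k _.
have /andP[c0 c1] := pb01 k x.
by rewrite normrM distrC ler_piMl// ger0_norm.
Qed.

Lemma drift_le1 x y : `|drift x y| <= 1.
Proof.
apply: mean_le => k; have /andP[c0 c1] := pb01 k x; have /andP[d0 d1] := pb01 k y.
rewrite normrM mulr_ile1// ?(ger0_norm c0)//.
by rewrite ler_norml; apply/andP; split; lra.
Qed.

Let zero (s : S) : R := 0.
Let bzero : bmf zero. Proof. exact: bmf_cst. Qed.
Let zero_le (s : S) : `|zero s| <= 1. Proof. by rewrite normr0. Qed.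
Let driftp_le (s t : S) : `|drift_pair s t| <= 1. Proof. exact: drift_le1. Qed.

Definition drift_sum n (z : n.-tuple S) := W rho drift_pair zero z.

(** The drift sum has the shape of W with no point part, so the deletion formulas for W apply;
    one of the two factors of each squared increment is bounded, the other is a variation along
    neighbours. *)
Lemma Var_drift n : Var P (fun w => drift_sum (sample Z n w)) <=
  Ddel rho 1 * (2 * mean_ndiff pb true n + mean_ndiff pb false n).
Proof.
have bW : bmf (@drift_sum n) by exact: (bmf_W rho bmf_drift_pair bzero).
have bD j : bmf (@Wdel _ _ rho drift_pair zero n j).
  exact: (bmf_Wdel rho bmf_drift_pair bzero).
apply: le_trans (efron_stein mZ mZ0 copies indep bW bD _) _.
  move=> j z s; apply: eq_bigr => i; rewrite !inE => ij.
  by rewrite aN_local ?inE ?eqxx.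
have Dd0 : 0 <= Ddel rho (1 : R).
  by rewrite /Ddel /local_bound !addr_ge0// mulr_ge0.
pose u b (z : n.-tuple S) i := q^-1 * \sum_k `|pb k (xs z i) - pb k (xs z (nsel rho b z i))|.
have u0 b z i : 0 <= u b z i.
  by rewrite mulr_ge0// sumr_ge0.
have bu b i : bmf (fun z => u b z i).
  apply: bmfM; first exact: bmf_cst.
  apply: bmf_sum => k; apply: bmf_norm; apply: bmfB; first exact: bmf_xs.
  exact: bmf_nsel.
have bus b : bmf (fun z => \sum_i u b z i) by apply: bmf_sum.
rewrite -(En_mean_ndiff n true bpb) -(En_mean_ndiff n false bpb) [leRHS](_ : _ = EZ (fun z : n.-tuple S =>
    Ddel rho 1 * (2 * \sum_i u true z i + \sum_i u false z i))); last first.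
  have b1 := bmf_sample mZ (bus true); have b2 := bmf_sample mZ (bus false).
  rewrite /En ExZ; last by apply: bmfD => //; apply: bmfM => //; exact: bmf_cst.
  rewrite ExD//; last by apply: bmfM => //; exact: bmf_cst.
  by rewrite ExZ.
have bE j : bmf (fun z => (@drift_sum n z - Wdel rho drift_pair zero j z) ^+ 2).
  by apply: bmfX; apply: bmfB.
rewrite /En -Ex_sum; last by move=> j; exact: (bmf_sample mZ (bE j)).
apply: Ex_le_ae.
- by apply: bmf_sum => j; exact: (bmf_sample mZ (bE j)).
- apply: (bmf_sample mZ (Phi := fun z : n.-tuple S =>
    Ddel rho 1 * (2 * \sum_i u true z i + \sum_i u false z i))).
  apply: bmfM; first exact: bmf_cst.
  by apply: bmfD => //; apply: bmfM => //; exact: bmf_cst.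
apply: filterS (sep_ae n) => w sw; set z := sample Z n w in sw *.
have at_ i : `|aN rho drift_pair [set: 'I_n]%SET z i| <= u true z i.
  rewrite /aN /aij; case: eqP => _; first by rewrite normr0.
  exact: drift_le.
have af i : `|aN2 rho drift_pair [set: 'I_n]%SET z i| <= u false z i.
  rewrite /aN2 /aij; case: eqP => _; first by rewrite normr0.
  exact: drift_le.
apply: (@le_trans _ _ (\sum_j Ddel rho 1 * (u true z j +
    \sum_i (N z i == j)%:R * (u true z i + u false z i)))).
  apply: ler_sum => j _.
  rewrite -[leLHS]real_normK ?num_real// expr2 ler_pM//.
    by apply: W_del_le.
  rewrite /drift_sum W_del /zero addr0 (le_trans (ler_normD _ _))// lerD//.
  apply: le_trans (ler_norm_sum _ _ _) _; apply: ler_sum => i _.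
  rewrite normrM normr_nat ler_wpM2l// (le_trans (ler_normB _ _))// lerD//.
rewrite -mulr_sumr ler_wpM2l// big_split /= exchange_big /=.
rewrite [X in _ + X](eq_bigr (fun i => u true z i + u false z i)); last first.
  move=> i _; rewrite (bigD1 (N z i))//= eqxx mul1r big1 ?addr0// => j.
  by rewrite eq_sym => /negbTE ->; rewrite mul0r.
by rewrite big_split /=; lra.
Qed.

Definition rounding n (z : n.-tuple S) := \sum_i
  (Num.min (v (tnth z i).2) (v (tnth z (N z i)).2) -
   grid M (Num.min (v (tnth z i).2) (v (tnth z (N z i)).2))).

(** The contribution of a point without neighbour, if there is one. *)
Definition isolated n (z : n.-tuple S) := \sum_i (N z i == i)%:R *
  (grid M (v (tnth z i).2) - q^-1 * \sum_k pb k (xs z i) ^+ 2).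

Lemma stat_split n (z : n.-tuple S) :
  stat z = W rho pair_part point_part z + rounding z + drift_sum z + isolated z +
           n%:R * Ex P (fun w => point_raw (Z0 w)).
Proof.
rewrite -sum_cst_ord /stat /W /rounding /drift_sum /W /isolated -!big_split /=.
apply: eq_bigr => i _; rewrite /point_part /point_raw /zero addr0 /aN /aij.
have [E|E] := eqVneq (N z i) i.
  rewrite E minxx mul1r /xs; set A := q^-1 * \sum_k pb k (tnth z i).1 ^+ 2.
  by move: (Ex P _) A => e A; lra.
rewrite mul0r grid_min /pair_part /drift_pair /drift.
suff -> : q^-1 * (\sum_(k < M.+1) ((k.+1%:R / M.+1%:R <= v (tnth z i).2)%R%:R *
    (k.+1%:R / M.+1%:R <= v (tnth z (N z i)).2)%R%:R)) =
  q^-1 * \sum_k (lev k (tnth z i) * lev k (tnth z (N z i)) -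
     pb k (tnth z i).1 * pb k (tnth z (N z i)).1) +
  q^-1 * \sum_k pb k (tnth z i).1 ^+ 2 +
  q^-1 * \sum_k pb k (tnth z i).1 * (pb k (tnth z (N z i)).1 - pb k (tnth z i).1).
  set A := q^-1 * \sum_k pb k _ ^+ 2; set B := q^-1 * \sum_k (lev _ _ * _ - _).
  set C := q^-1 * \sum_k pb k _ * _.
  by move: (Ex P _) A B C => e A B C; lra.
rewrite -!mulrDr -!big_split /=; congr (_ * _); apply: eq_bigr => k _.
by rewrite /lev; ring.
Qed.

Lemma bmf_grid dU (U : measurableType dU) (f : U -> R) : bmf f -> bmf (fun x => grid M (f x)).
Proof.
move=> bf; apply: bmfM; first exact: bmf_cst.
by apply: bmf_sum => k; apply: bmf_bool; apply: measurable_fun_ler => //; exact: bf.1.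
Qed.

Lemma Var_rounding n : Var P (fun w => rounding (sample Z n w)) <=
  n%:R * local_bound q^-1 (K + K) ^+ 2.
Proof.
pose F i r (s : 'I_n) (z : n.-tuple S) := Num.min (v (tnth z i).2) (v (tnth z r).2) -
   grid M (Num.min (v (tnth z i).2) (v (tnth z r).2)).
apply: (Var_chain_sum mZ mZ0 copies indep rho sep_ae (F := F) (c := q^-1)).
- by rewrite invr_ge0.
- move=> i r s; have b : bmf (fun z : n.-tuple S => Num.min (v (tnth z i).2) (v (tnth z r).2)).
    by apply: bmf_min; [exact: (bmf_tnth i bmf_v)|exact: (bmf_tnth r bmf_v)].
  by apply: bmfB => //; exact: bmf_grid.
- move=> i r s j ji jr js z t; rewrite /F !tnth_upd.
  by rewrite [i == j]eq_sym [r == j]eq_sym (negbTE ji) (negbTE jr).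
move=> z sz i r s; rewrite /F.
have /andP[g0 g1] : 0 <= Num.min (v (tnth z i).2) (v (tnth z r).2) -
   grid M (Num.min (v (tnth z i).2) (v (tnth z r).2)) <= q^-1.
  apply: grid_bound; have /andP[a0 a1] := v01 (tnth z i).2.
  have /andP[b0 b1] := v01 (tnth z r).2.
  by rewrite le_min a0 b0 ge_min a1.
by rewrite ger0_norm.
Qed.

Lemma bmf_isolated n : bmf (@isolated n).
Proof.
apply: bmf_sum => i; apply: bmfM; first by apply: bmf_bool; exact: measurable_N.
apply: bmfB; first exact: bmf_grid (bmf_tnth i bmf_v).
apply: bmfM; first exact: bmf_cst.
by apply: bmf_sum => k; apply: bmfX; exact: bmf_xs.
Qed.

Lemma isolated_le n (z : n.-tuple S) : sep z -> `|isolated z| <= 1.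
Proof.
move=> sz; have tb i : `|grid M (v (tnth z i).2) - q^-1 * \sum_k pb k (xs z i) ^+ 2| <= 1.
  have /andP[g0 g1] : 0 <= grid M (v (tnth z i).2) <= 1.
    rewrite /grid mulr_ge0 ?sumr_ge0//=.
    apply: le_trans (ler_norm _) _; apply: mean_le => k.
    by rewrite normr_nat; case: (_ / _ <= _); rewrite ?lexx ?ler01.
  have p0 : 0 <= q^-1 * \sum_k pb k (xs z i) ^+ 2.
    by rewrite mulr_ge0// sumr_ge0// => k _; exact: sqr_ge0.
  have p1 : q^-1 * \sum_k pb k (xs z i) ^+ 2 <= 1.
    apply: le_trans (ler_norm _) _; apply: mean_le => k.
    have /andP[c0 c1] := pb01 k (xs z i).
    by rewrite ger0_norm ?sqr_ge0// expr_le1.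
  move: g0 g1 p0 p1; move: (grid _ _) (_ * \sum_k _) => A B *.
  by rewrite ler_norml; apply/andP; split; lra.
rewrite /isolated; case: (pickP (fun i => N z i == i)) => [i0 /eqP E|none]; last first.
  by rewrite big1 ?normr0// => i _; rewrite none mul0r.
rewrite (bigD1 i0)//= [X in _ + X]big1 ?addr0; first by rewrite E eqxx mul1r.
move=> i ii0; case: eqP => [Ei|_]; last by rewrite mul0r.
have := nbr_self_unique (rho := rho) sz Ei E => ie.
by rewrite ie eqxx in ii0.
Qed.

Lemma Var_rem n : Var P (fun w => stat (sample Z n w) -
    W rho pair_part point_part (sample Z n w)) <=
  2 * (n%:R * local_bound q^-1 (K + K) ^+ 2) +
  4 * (Ddel rho 1 * (2 * mean_ndiff pb true n + mean_ndiff pb false n)) + 4.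
Proof.
pose e := n%:R * Ex P (fun w => point_raw (Z0 w)).
have bG : bmf (fun w => rounding (sample Z n w)).
  apply: (bmf_sample mZ (Phi := @rounding n)); apply: bmf_sum => i.
  apply: (@bmf_select _ _ _ _ (fun z => N z i) (fun r (z : n.-tuple S) =>
   Num.min (v (tnth z i).2) (v (tnth z r).2) -
   grid M (Num.min (v (tnth z i).2) (v (tnth z r).2)))); first by move=> r; exact: measurable_N.
  move=> r; have b : bmf (fun z : n.-tuple S => Num.min (v (tnth z i).2) (v (tnth z r).2)).
    by apply: bmf_min; [exact: (bmf_tnth i bmf_v)|exact: (bmf_tnth r bmf_v)].
  by apply: bmfB => //; exact: bmf_grid.
have bC : bmf (fun w => drift_sum (sample Z n w)).
  apply: (bmf_sample mZ (Phi := @drift_sum n)).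
  exact: (bmf_W rho bmf_drift_pair bzero).
have bI : bmf (fun w => isolated (sample Z n w)).
  exact: (bmf_sample mZ (@bmf_isolated n)).
have bIe : bmf (fun w => isolated (sample Z n w) + e).
  by apply: bmfD => //; exact: bmf_cst.
rewrite (_ : (fun w => _) = fun w => rounding (sample Z n w) +
    (drift_sum (sample Z n w) + (isolated (sample Z n w) + e))); last first.
  by apply/funext => w; rewrite stat_split -/e; lra.
apply: le_trans (Var_D_le P bG (bmfD bC bIe)) _.
have := Var_D_le P bC bIe.
have := Var_rounding n; have := Var_drift n.
move: (local_bound _ _) (mean_ndiff _ _ _) (mean_ndiff _ _ _) => lb m1 m2.
set a1 := Var P (fun w => drift_sum (sample Z n w)).
set a2 := Var P (fun w => rounding (sample Z n w)).
set a3 := Var P (fun w => drift_sum (sample Z n w) + (isolated (sample Z n w) + e)).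
suff : Var P (fun w => isolated (sample Z n w) + e) <= 1.
  move: (n%:R * lb ^+ 2) (Ddel _ _ * _) (Var P _) a1 a2 a3 => b1 b2 b3 a1 a2 a3.
  by lra.
apply: le_trans (Var_le_sqr P e bIe) _.
rewrite -[leRHS](Ex_cst P); apply: Ex_le_ae; [|exact: bmf_cst|].
  by apply: bmfX; apply: bmfB => //; exact: bmf_cst.
apply: filterS (sep_ae n) => w sw; rewrite addrK.
rewrite -[leLHS]real_normK ?num_real// expr_le1//.
exact: isolated_le.
Qed.

End OneGrid.
End Decomposition.

(** * Approximation by a pair sum of small remainder *)

Section Moments.
Context {dT : measure_display} {T : measurableType dT} {R : realType}.
Variable P : probability T R.

Definition Cov (f g : T -> R) := Ex P (fun w => f w * g w) - Ex P f * Ex P g.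

Lemma Var_quad (f g : T -> R) (x : R) : bmf f -> bmf g ->
  Var P (fun w => f w - x * g w) = Var P f - 2 * x * Cov f g + x ^+ 2 * Var P g.
Proof.
move=> bf bg; have bxg : bmf (fun w => x * g w) by apply: bmfM => //; exact: bmf_cst.
rewrite !VarE//; last exact: bmfB.
have bfg : bmf (fun w => f w * g w) by exact: bmfM.
have bf2 : bmf (fun w => f w ^+ 2) by exact: bmfX.
have bg2 : bmf (fun w => g w ^+ 2) by exact: bmfX.
rewrite ExB// ExZ// (@Ex_ext _ _ _ P _ (fun w => f w ^+ 2 + (x ^+ 2 * g w ^+ 2 -
  2 * x * (f w * g w)))); last by move=> w; ring.
have c1 : bmf (fun w => x ^+ 2 * g w ^+ 2) by apply: bmfM => //; exact: bmf_cst.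
have c2 : bmf (fun w => 2 * x * (f w * g w)) by apply: bmfM => //; exact: bmf_cst.
rewrite ExD//; last exact: bmfB.
by rewrite ExB// !ExZ// /Cov; ring.
Qed.

(** The discriminant argument applied to the variance of f - x g. *)
Lemma Cov_sqr_le (f g : T -> R) : bmf f -> bmf g -> Cov f g ^+ 2 <= Var P f * Var P g.
Proof.
move=> bf bg; have [g0|g0] := eqVneq (Var P g) 0.
  rewrite g0 mulr0; have [->|c0] := eqVneq (Cov f g) 0; first by rewrite expr0n.
  have := Var_ge0 P (fun w => f w - (Var P f + 1) / (2 * Cov f g) * g w).
  rewrite Var_quad// g0 mulr0 addr0.
  rewrite (_ : 2 * _ * Cov f g = Var P f + 1); first lra.
  by field; rewrite c0.
have gp : 0 < Var P g by rewrite lt_neqAle eq_sym g0 Var_ge0.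
have := Var_ge0 P (fun w => f w - Cov f g / Var P g * g w).
rewrite Var_quad// => H.
have {H} := mulr_ge0 H (ltW gp).
rewrite (_ : (_ - _ + _) * _ = Var P f * Var P g - Cov f g ^+ 2); last by field; rewrite g0.
by rewrite subr_ge0.
Qed.

End Moments.

Section SplitStatistic.
Context {dT : measure_display} {T : measurableType dT} {R : realType}.
Variable P : probability T R.
Context {d : nat}.
Local Notation S := (d.-tuple R * R)%type.
Variables (Z : nat -> T -> S) (Z0 : T -> S).
Hypothesis mZ : forall i, measurable_fun setT (Z i).
Hypothesis mZ0 : measurable_fun setT Z0.
Hypothesis copies : forall i, identically_distributed P (Z i) Z0.
Hypothesis indep : mutually_independent P Z.
Variable rho : neighbor_rule R d.
Hypothesis sep_ae : forall n, {ae P, forall w, sep (sample Z n w)}.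
Hypothesis atomless : forall (k : 'I_d) c, P [set w | tnth (Z0 w).1 k = c] = 0%E.
Variables (v h : R -> R).
Hypotheses (mv : measurable_fun setT v) (mh : measurable_fun setT h).
Hypotheses (v01 : forall y, 0 <= v y <= 1) (h01 : forall y, 0 <= h y <= 1).

Local Notation EZ := (En P Z).
Local Notation K := (Kdeg rho).
Local Notation N := (nn rho [set: 'I_(_)]%SET).
Local Notation X0 := (fun w => (Z0 w).1).

Let mX0 : measurable_fun setT X0. Proof. exact: measurableT_comp. Qed.

Lemma level_cexp M : exists2 pb : 'I_M.+1 -> d.-tuple R -> R,
  forall k, cexp_of P X0 (fun w => lev v k (Z0 w)) (pb k) &
  forall k x, 0 <= pb k x <= 1.
Proof.
have H k : exists beta : d.-tuple R -> R,
    cexp_of P X0 (fun w => lev v (k : 'I_M.+1) (Z0 w)) beta /\ forall x, 0 <= beta x <= 1.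
  have bl : bmf (fun w => lev v k (Z0 w)) by exact: bmf_comp (bmf_lev mv v01 k) mZ0.
  have [beta b1 b2] := cexp_exists01 P mX0 bl (fun w => lev01 v k (Z0 w)).
  by exists beta.
have [pb pbP] := choice H.
by exists pb => k; [case: (pbP k)|move=> x; case: (pbP k)].
Qed.

Lemma mean_ndiff_small M (g : 'I_M.+1 -> d.-tuple R -> R) b e : (forall k, bmf (g k)) -> 0 < e ->
  exists n0, forall n, (n0 <= n)%N -> mean_ndiff P Z rho g b n <= e * n%:R.
Proof.
move=> bg e0.
have H k : exists n0, forall n, (n0 <= n)%N -> ndiff P Z rho b (g k) n <= e * n%:R.
  exact: (nn_small_all mZ mZ0 copies indep rho sep_ae atomless (bg k) b e0).
have [n0 n0P] := choice H.
exists (\max_k n0 k)%N => n nn; rewrite /mean_ndiff ler_pdivrMl// -sum_cst_ord.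
apply: ler_sum => k _; apply: n0P; apply: leq_trans nn; exact: leq_bigmax.
Qed.

(** The rounding error is made small by the choice of M; then the drift, which is o(n), and
    the isolated point are negligible for large n. *)
Lemma split_statistic e : 0 < e -> exists (a : S -> S -> R) (l : S -> R) (n0 : nat),
  [/\ bmf (fun u : S * S => a u.1 u.2) /\ bmf l,
      (forall s t, `|a s t| <= 2) /\ (forall s, `|l s| <= 2),
      Ex P (fun w => l (Z0 w)) = 0,
      forall n (i r : 'I_n) Psi, i != r -> bmf Psi ->
        indep_of_y i Psi -> indep_of_y r Psi ->
        EZ (fun z => a (tnth z i) (tnth z r) * Psi z) = 0 &
      forall n, (n0 <= n)%N ->
        Var P (fun w => stat rho v h (sample Z n w) - W rho a l (sample Z n w)) <= e * n%:R].
Proof.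
(* L is [local_bound 1 (K + K)]; M makes the rounding variance at most n e / 8. *)
move=> e0; pose L := (1 + 2 * (K + K)%:R : R).
have L0 : 0 < L by rewrite /L ltr_pwDl// mulr_ge0.
pose M := Num.truncn (8 * L ^+ 2 / e).
have [pb pbP pb01] := level_cexp M.
exists (pair_part v pb), (point_part P Z0 h pb).
pose D := Ddel rho (1 : R).
have D0 : 0 <= D by rewrite /D /Ddel /local_bound !addr_ge0// mulr_ge0.
pose e' := e / (48 * (D + 1)).
have e'0 : 0 < e' by rewrite divr_gt0// mulr_gt0// ltr_wpDl.
have bpb k : bmf (pb k) by case: (pbP k).
have [n1 n1P] := mean_ndiff_small true bpb e'0.
have [n2 n2P] := mean_ndiff_small false bpb e'0.
exists (maxn (maxn n1 n2) (Num.truncn (16 / e)).+1); split.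
- by split; [exact: (bmf_pair_part mv v01 pbP)|exact: (bmf_point_part mh h01 pbP)].
- by split; [exact: (pair_part_le v pb01)|exact: (point_part_le mZ0 mh h01 pbP pb01)].
- exact: (point_part_mean0 mZ0 mh h01 pbP).
- by move=> n i r Psi; exact: (pair_part_mean0 mZ mZ0 copies indep mv v01 pbP).
move=> n; rewrite !geq_max => /andP[/andP[/n1P s1 /n2P s2] nl].
apply: le_trans (Var_rem mZ mZ0 copies indep rho sep_ae h mv v01 pbP pb01 n) _.
have q0 : (0 : R) < M.+1%:R by rewrite ltr0n.
have qM : 8 * L ^+ 2 / e <= M.+1%:R.
  have p : 0 <= 8 * L ^+ 2 / e by rewrite divr_ge0 ?(ltW e0)// mulr_ge0// sqr_ge0.
  by have /andP[_ /ltW] := truncn_itv p.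
have t1 : local_bound (M.+1%:R^-1 : R) (K + K) ^+ 2 <= e / 8.
  rewrite (_ : local_bound _ _ = L / M.+1%:R); last first.
    by rewrite /local_bound /L; field; rewrite gt_eqF.
  rewrite expr_div_n ler_pdivrMr ?exprn_gt0//.
  apply: (@le_trans _ _ (e / 8 * M.+1%:R)).
    by rewrite mulrAC ler_pdivlMr// mulrC -ler_pdivrMl// [leLHS]mulrC.
  have q1 : (1 : R) <= M.+1%:R by rewrite ler1n.
  apply: ler_wpM2l; first by rewrite divr_ge0 ?(ltW e0).
  by rewrite expr2 ler_peMr// ltW.
have t3 : 4 <= e / 4 * n%:R :> R.
  have p : 0 <= 16 / e by rewrite divr_ge0 ?(ltW e0).
  have /andP[_ /ltW h1] := truncn_itv p.
  have : 16 / e <= n%:R by rewrite (le_trans h1)// ler_nat.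
  by rewrite ler_pdivrMr//; lra.
have t2 : 4 * (D * (2 * mean_ndiff P Z rho pb true n + mean_ndiff P Z rho pb false n)) <=
    e / 4 * n%:R.
  apply: (@le_trans _ _ (4 * (D * (3 * (e' * n%:R))))).
    rewrite ler_wpM2l// ler_wpM2l//.
    move: s1 s2; move: (mean_ndiff _ _ _ _ _ _) (mean_ndiff _ _ _ _ _ _) (e' * _).
    by move=> *; lra.
  have -> : 4 * (D * (3 * (e' * n%:R))) = D / (D + 1) * (e / 4 * n%:R).
    by rewrite /e'; field; rewrite gt_eqF// ltr_wpDl.
  rewrite ler_piMl ?mulr_ge0 ?divr_ge0 ?(ltW e0)//.
  by rewrite ler_pdivrMr ?ltr_wpDl// mul1r lerDl.
have t1' : 2 * (n%:R * local_bound (M.+1%:R^-1 : R) (K + K) ^+ 2) <= e / 4 * n%:R.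
  apply: (@le_trans _ _ (2 * (n%:R * (e / 8)))); first by rewrite !ler_wpM2l.
  by lra.
apply: le_trans (lerD (lerD t1' t2) t3) _.
have : 0 <= e * n%:R by rewrite mulr_ge0 ?(ltW e0).
by lra.
Qed.

End SplitStatistic.

(** * Linear growth of the variance *)

Section VarianceLowerBound.
Context {dT : measure_display} {T : measurableType dT} {R : realType}.
Variable P : probability T R.
Context {d : nat}.
Local Notation S := (d.-tuple R * R)%type.
Variables (Z : nat -> T -> S) (Z0 : T -> S).
Hypothesis mZ : forall i, measurable_fun setT (Z i).
Hypothesis mZ0 : measurable_fun setT Z0.
Hypothesis copies : forall i, identically_distributed P (Z i) Z0.
Hypothesis indep : mutually_independent P Z.
Variable rho : neighbor_rule R d.
Hypothesis sep_ae : forall n, {ae P, forall w, sep (sample Z n w)}.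
Hypothesis atomless : forall (k : 'I_d) c, P [set w | tnth (Z0 w).1 k = c] = 0%E.
Variables (v h : R -> R).
Hypotheses (mv : measurable_fun setT v) (mh : measurable_fun setT h).
Hypotheses (v01 : forall y, 0 <= v y <= 1) (h01 : forall y, 0 <= h y <= 1).

Local Notation EZ := (En P Z).
Local Notation K := (Kdeg rho).
Local Notation N := (nn rho [set: 'I_(_)]%SET).
Local Notation X0 := (fun w => (Z0 w).1).

Let mX0 : measurable_fun setT X0. Proof. exact: measurableT_comp. Qed.

Variable reg : d.-tuple R -> R.
Hypothesis regP : cexp_of P X0 (fun w => v (Z0 w).2) reg.
Hypothesis reg01 : forall x, 0 <= reg x <= 1.

(** The part of V that the covariate does not explain. *)
Definition res (s : S) : R := v s.2 - reg s.1.
Hypothesis res_pos : 0 < Ex P (fun w => res (Z0 w) ^+ 2).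

Let breg : bmf reg. Proof. by case: regP. Qed.
Let bv : bmf (fun s : S => v s.2). Proof. exact: bmf_v. Qed.

Lemma bmf_res : bmf res.
Proof. by apply: bmfB => //; apply: bmf_comp breg _. Qed.

Lemma res_le s : `|res s| <= 1.
Proof.
have /andP[a0 a1] := v01 s.2; have /andP[b0 b1] := reg01 s.1.
by rewrite /res ler_norml; apply/andP; split; lra.
Qed.

Let bvt n (i : 'I_n) : bmf (fun z : n.-tuple S => v (tnth z i).2).
Proof. exact: (bmf_tnth i bv). Qed.
Let brt n (i : 'I_n) : bmf (fun z : n.-tuple S => res (tnth z i)).
Proof. exact: (bmf_tnth i bmf_res). Qed.

Lemma En_res n (j : 'I_n) Psi : bmf Psi -> indep_of_y j Psi ->
  EZ (fun z => res (tnth z j) * Psi z) = 0.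
Proof.
move=> bP iP; have := En_cexp mZ mZ0 copies indep (b := fun s => v s.2) bv regP bP iP.
move=> /eqP; rewrite -subr_eq0 => /eqP <-.
have b1 : bmf (fun z => v (tnth z j).2 * Psi z) by exact: bmfM.
have b2 : bmf (fun z => reg (xs z j) * Psi z) by apply: bmfM => //; exact: bmf_xs.
rewrite /En -[RHS]ExB.
- by apply: Ex_ext => w; rewrite /res mulrBl.
- exact: (bmf_sample mZ b1).
- exact: (bmf_sample mZ b2).
Qed.

Definition sel n (z : n.-tuple S) (i s : 'I_n) : R := (N z i == s)%:R.

Let bsel n (i s : 'I_n) : bmf (fun z : n.-tuple S => sel z i s).
Proof. by apply: bmf_bool; exact: measurable_N. Qed.

Let isel n (i s j : 'I_n) : indep_of_y j (fun z : n.-tuple S => sel z i s).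
Proof. by move=> z t E; rewrite /sel N_upd_same. Qed.

Lemma sum_sel n (z : n.-tuple S) i (g : 'I_n -> R) : \sum_s sel z i s * g s = g (N z i).
Proof.
rewrite (bigD1 (N z i))//= /sel eqxx mul1r big1 ?addr0// => s.
by rewrite eq_sym => /negbTE ->; rewrite mul0r.
Qed.

Definition edge_test n (z : n.-tuple S) (j r : 'I_n) : R :=
  sel z j r * (res (tnth z j) * res (tnth z r)).

Let bet n (j r : 'I_n) : bmf (fun z : n.-tuple S => edge_test z j r).
Proof. by apply: bmfM => //; exact: bmfM. Qed.

(** The sum with which the statistic is shown to be correlated.  It has mean 0 and a variance
    of order n. *)
Definition pair_test n (z : n.-tuple S) := \sum_j \sum_(r | r != j) edge_test z j r.

Lemma bmf_pair_test n : bmf (@pair_test n).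
Proof. by do 2 apply: bmf_sum => ?. Qed.

(** The residual of either endpoint can be averaged out. *)
Lemma En_edge_test n (j r : 'I_n) Q : r != j -> bmf Q ->
  indep_of_y j Q \/ indep_of_y r Q -> EZ (fun z => edge_test z j r * Q z) = 0.
Proof.
move=> rj bQ [iQ|iQ].
  transitivity (EZ (fun z => res (tnth z j) * (sel z j r * res (tnth z r) * Q z))).
    by apply: Ex_ext => w; rewrite /edge_test; ring.
  apply: En_res; first by apply: bmfM => //; exact: bmfM.
  do 2 apply: indep_of_y_M => //; exact: indep_of_y_tnth.
transitivity (EZ (fun z => res (tnth z r) * (sel z j r * res (tnth z j) * Q z))).
  by apply: Ex_ext => w; rewrite /edge_test; ring.
apply: En_res; first by apply: bmfM => //; exact: bmfM.
by do 2 apply: indep_of_y_M => //; apply: indep_of_y_tnth; rewrite eq_sym.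
Qed.

Lemma En_pair_test n : EZ (@pair_test n) = 0.
Proof.
rewrite /En /pair_test Ex_sum; last first.
  move=> j; apply: (bmf_sample mZ (Phi := fun z : n.-tuple S => \sum_(r | r != j) edge_test z j r)).
  by apply: bmf_sum.
apply: big1 => j _; rewrite Ex_sum; last by move=> r; exact: (bmf_sample mZ (@bet n j r)).
apply: big1 => r rj; rewrite -[RHS](@En_edge_test n j r (fun=> 1) rj).
- by apply: Ex_ext => w; rewrite mulr1.
- exact: bmf_cst.
- by left.
Qed.

Lemma Var_pair_test n : Var P (fun w => pair_test (sample Z n w)) <=
  n%:R * local_bound 1 (K + K) ^+ 2.
Proof.
pose F i r (s : 'I_n) (z : n.-tuple S) := (r != i)%:R * (res (tnth z i) * res (tnth z r)).
have H := Var_chain_sum mZ mZ0 copies indep rho sep_ae (n := n) (F := F) (c := 1).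
rewrite (_ : (fun w => _) = (fun w => let z := sample Z n w in
    \sum_i F i (N z i) (nn2 rho [set: 'I_n]%SET z i) z)).
  apply: H => //.
  - by move=> i r s; apply: bmfM; [exact: bmf_cst|exact: bmfM].
  - move=> i r s j ji jr js z t; rewrite /F !tnth_upd.
    by rewrite [i == j]eq_sym [r == j]eq_sym (negbTE ji) (negbTE jr).
  move=> z sz i r s; rewrite /F !normrM normr_nat.
  rewrite mulr_ile1//; first by case: (_ != _); rewrite ?ler01.
  by rewrite mulr_ile1// res_le.
apply/funext => w /=; apply: eq_bigr => i _; rewrite big_mkcond /=.
set z := sample Z n w.
rewrite -[RHS](@sum_sel n z i (fun r => F i r (nn2 rho [set: 'I_n]%SET z i) z)).
apply: eq_bigr => r _; rewrite /F /edge_test.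
by case: (r != i); rewrite ?mul1r// mul0r mulr0.
Qed.

Let vmin n (z : n.-tuple S) i s := Num.min (v (tnth z i).2) (v (tnth z s).2).
Let bvmin n i s : bmf (fun z : n.-tuple S => vmin z i s).
Proof. exact: bmf_min. Qed.

(** Only the terms of the statistic that involve both endpoints of the edge survive: the
    term of j if r is its neighbour, and the term of r if j is its neighbour. *)
Lemma En_edge_test_stat n (j r : 'I_n) : r != j ->
  EZ (fun z => edge_test z j r * stat rho v h z) =
  EZ (fun z => sel z j r * (1 + sel z r j) * (vmin z j r * (res (tnth z j) * res (tnth z r)))).
Proof.
move=> rj; have jr : j != r by rewrite eq_sym.
pose E i s := EZ (fun z => edge_test z j r * (sel z i s * vmin z i s)).
have bE i s : bmf (fun z : n.-tuple S => edge_test z j r * (sel z i s * vmin z i s)).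
  by apply: bmfM => //; exact: bmfM.
have bH i : bmf (fun z : n.-tuple S => edge_test z j r * h (tnth z i).2).
  by apply: bmfM => //; exact: (bmf_tnth i (bmf_h mh h01)).
transitivity (\sum_i \sum_s E i s + \sum_i EZ (fun z => edge_test z j r * h (tnth z i).2)).
  have b1 i : bmf (fun z : n.-tuple S => \sum_s edge_test z j r * (sel z i s * vmin z i s)).
    by apply: bmf_sum.
  rewrite (eq_bigr (fun i => EZ (fun z : n.-tuple S =>
      \sum_s edge_test z j r * (sel z i s * vmin z i s)))); last first.
    by move=> i _; rewrite /E /En Ex_sum// => s; exact: (bmf_sample mZ (bE i s)).
  rewrite /En -[X in _ = _ + X]Ex_sum; last by move=> i; exact: (bmf_sample mZ (bH i)).
  rewrite -Ex_sum; last by move=> i; exact: (bmf_sample mZ (b1 i)).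
  rewrite -ExD; last 2 first.
  - by apply: bmf_sum => i; exact: (bmf_sample mZ (b1 i)).
  - by apply: bmf_sum => i; exact: (bmf_sample mZ (bH i)).
  apply: Ex_ext => w; rewrite /stat mulrDr !mulr_sumr; congr (_ + _).
  apply: eq_bigr => i _; rewrite -mulr_sumr; congr (_ * _).
  by rewrite sum_sel.
rewrite [X in _ + X]big1 ?addr0; last first.
  move=> i _; apply: En_edge_test => //; first exact: (bmf_tnth i (bmf_h mh h01)).
  have [->|ij] := eqVneq i j; [right|left].
    exact: (@indep_of_y_tnth _ _ _ _ _ (fun s => h s.2)).
  exact: (@indep_of_y_tnth _ _ _ _ _ (fun s => h s.2)).
have ivmin i s k : k != i -> k != s -> indep_of_y k (fun z : n.-tuple S => vmin z i s).
  move=> ki ks z t _; rewrite /vmin !tnth_upd.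
  by rewrite [i == k]eq_sym [s == k]eq_sym (negbTE ki) (negbTE ks).
have E0 i s k : k \in [:: j; r] -> k != i -> k != s -> E i s = 0.
  move=> kjr ki ks; apply: En_edge_test => //; first exact: bmfM.
  have ik : indep_of_y k (fun z : n.-tuple S => sel z i s * vmin z i s).
    by apply: indep_of_y_M => //; exact: ivmin.
  by move: kjr ik; rewrite !inE => /orP[/eqP ->|/eqP ->]; [left|right].
rewrite (bigD1 j)//= [X in _ + X](bigD1 r)//= [X in _ + (_ + X)]big1 ?addr0; last first.
  move=> i /andP[ij ir]; apply: big1 => s _.
  have [sj|sj] := eqVneq s j.
    by apply: (E0 _ _ r); rewrite ?inE ?eqxx ?orbT// 1?eq_sym// sj.
  by apply: (E0 _ _ j); rewrite ?inE ?eqxx// eq_sym.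
rewrite (bigD1 r)//= [X in _ + X + _]big1 ?addr0; last first.
  by move=> s sr; apply: (E0 _ _ r); rewrite ?inE ?eqxx ?orbT// eq_sym.
rewrite [X in _ + X](bigD1 j)//= [X in _ + (_ + X)]big1 ?addr0; last first.
  by move=> s sj; apply: (E0 _ _ j); rewrite ?inE ?eqxx// eq_sym.
rewrite /E /En -ExD; [|exact: (bmf_sample mZ (bE j r))|exact: (bmf_sample mZ (bE r j))].
apply: Ex_ext => w; rewrite /edge_test /vmin [Num.min (v (tnth _ r).2) _]minC.
rewrite /sel; case: (N _ j == r); case: (N _ r == j); rewrite /=; ring.
Qed.

Section Levels.
Variable M : nat.
Local Notation q := (M.+1%:R : R).
Variable c : 'I_M.+1 -> d.-tuple R -> R.
Hypothesis cP : forall k, cexp_of P X0 (fun w => lev v k (Z0 w) * res (Z0 w)) (c k).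
Hypothesis c1 : forall k x, `|c k x| <= 1.

Let bc k : bmf (c k). Proof. by case: (cP k). Qed.

(** On the grid, the minimum times the two residuals is a mean of products of a function of
    one point and a function of the other, and each of these is replaced by its conditional
    expectation c k. *)
Lemma En_edge_weight n (j r : 'I_n) (om : n.-tuple S -> R) : r != j -> bmf om ->
  (forall k, indep_of_y k om) -> (forall z, 0 <= om z) ->
  EZ (fun z => om z * (q^-1 * \sum_k c k (xs z j) * c k (xs z r) - q^-1)) <=
  EZ (fun z => om z * (vmin z j r * (res (tnth z j) * res (tnth z r)))).
Proof.
move=> rj bom iom om0; have jr : j != r by rewrite eq_sym.
pose g (k : 'I_M.+1) (s : S) := lev v k s * res s.
have bg k : bmf (g k) by apply: bmfM; [exact: bmf_lev|exact: bmf_res].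
have bgt k i : bmf (fun z : n.-tuple S => g k (tnth z i)) by exact: (bmf_tnth i (bg k)).
have bct k i : bmf (fun z : n.-tuple S => c k (xs z i)) by exact: bmf_xs.
have b1 k : bmf (fun z => om z * (g k (tnth z j) * g k (tnth z r))) by do 2 apply: bmfM => //.
have b2 k : bmf (fun z => om z * (c k (xs z j) * c k (xs z r))) by do 2 apply: bmfM => //.
have step k : EZ (fun z => om z * (g k (tnth z j) * g k (tnth z r))) =
    EZ (fun z => om z * (c k (xs z j) * c k (xs z r))).
  transitivity (EZ (fun z => g k (tnth z j) * (g k (tnth z r) * om z))).
    by apply: Ex_ext => w; ring.
  rewrite (En_cexp mZ mZ0 copies indep (b := g k) (bg k) (cP k)); last 2 first.
  - exact: bmfM.
  - by apply: indep_of_y_M => //; exact: indep_of_y_tnth.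
  transitivity (EZ (fun z => g k (tnth z r) * (c k (xs z j) * om z))).
    by apply: Ex_ext => w; ring.
  rewrite (En_cexp mZ mZ0 copies indep (b := g k) (bg k) (cP k)); last 2 first.
  - exact: bmfM.
  - by apply: indep_of_y_M => //; exact: (indep_of_y_xs (fun x => c k (x j))).
  by apply: Ex_ext => w; ring.
pose G z := q^-1 * \sum_k om z * (g k (tnth z j) * g k (tnth z r)) - q^-1 * om z.
have bG : bmf G.
  by apply: bmfB; apply: bmfM; try exact: bmf_cst; [exact: bmf_sum|].
apply: (@le_trans _ _ (EZ G)).
  have bsum (F : 'I_M.+1 -> n.-tuple S -> R) : (forall k, bmf (F k)) ->
      EZ (fun z => q^-1 * \sum_k F k z - q^-1 * om z) =
      q^-1 * \sum_k EZ (F k) - q^-1 * EZ om.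
    move=> bF; have bs : bmf (fun z => \sum_k F k z) by exact: bmf_sum.
    rewrite /En ExB; last 2 first.
    - by apply: (bmf_sample mZ (Phi := fun z => q^-1 * \sum_k F k z)); apply: bmfM => //; exact: bmf_cst.
    - by apply: (bmf_sample mZ (Phi := fun z => q^-1 * om z)); apply: bmfM => //; exact: bmf_cst.
    rewrite !ExZ ?Ex_sum//.
    - by move=> k; exact: (bmf_sample mZ (bF k)).
    - exact: (bmf_sample mZ bom).
    - exact: (bmf_sample mZ bs).
  rewrite [leRHS]bsum// (eq_bigr _ (fun k _ => step k)) -bsum//.
  rewrite le_eqVlt; apply/orP; left; apply/eqP; apply: Ex_ext => w.
  by rewrite mulrBr mulrCA mulr_sumr; congr (_ - _); rewrite mulrC.
have bR : bmf (fun z => om z * (vmin z j r * (res (tnth z j) * res (tnth z r)))).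
  by apply: bmfM => //; apply: bmfM => //; exact: bmfM.
apply: Ex_le; [exact: (bmf_sample mZ bG)|exact: (bmf_sample mZ bR)|move=> w].
set z := sample Z n w; rewrite /G.
have -> : q^-1 * \sum_k om z * (g k (tnth z j) * g k (tnth z r)) =
    om z * (grid M (vmin z j r) * (res (tnth z j) * res (tnth z r))).
  rewrite /vmin grid_min -!mulrA [RHS]mulrCA; congr (_ * _).
  rewrite mulr_suml mulr_sumr; apply: eq_bigr => k _; congr (_ * _).
  by rewrite /g /lev; ring.
rewrite [q^-1 * om z]mulrC -mulrBr ler_wpM2l//.
have /andP[g0 g1] : 0 <= vmin z j r - grid M (vmin z j r) <= q^-1.
  apply: grid_bound; have /andP[a0 a1] := v01 (tnth z j).2.
  have /andP[b0 b1'] := v01 (tnth z r).2.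
  by rewrite le_min a0 b0 ge_min a1.
rewrite lerBlDr -lerBlDl -mulrBl.
apply: le_trans (ler_norm _) _; rewrite normrM distrC (ger0_norm g0).
rewrite -[leRHS]mulr1; apply: ler_pM => //.
by rewrite normrM mulr_ile1// res_le.
Qed.

(** The conditional covariances c k of the k-th level with V enter squared: this is the
    limiting covariance per point, up to the rounding error. *)
Definition level_energy x : R := q^-1 * \sum_k c k x ^+ 2.

Let bA : bmf level_energy.
Proof. by apply: bmfM; [exact: bmf_cst|apply: bmf_sum => k; exact: bmfX]. Qed.

(** Replacing c k at the neighbour by c k at the point makes each edge contribute a
    square.  The weight is 1 or 2 according to whether the edge is mutual; squares only gain from
    the weight 2, the error terms are doubled. *)
Lemma pair_test_stat_pointwise n (z : n.-tuple S) : sep z ->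
  \sum_j (level_energy (xs z j) - 2 * (q^-1 *
    \sum_k `|c k (xs z j) - c k (xs z (nsel rho true z j))|)) - (1 + n%:R * (2 * q^-1)) <=
  \sum_j \sum_(r | r != j) sel z j r * (1 + sel z r j) *
    (q^-1 * \sum_k c k (xs z j) * c k (xs z r) - q^-1).
Proof.
move=> sz; have qi : 0 < q^-1 by rewrite invr_gt0.
have iso : \sum_j (N z j == j)%:R <= 1 :> R.
  case: (pickP (fun i => N z i == i)) => [i0 /eqP E|none]; last first.
    by rewrite big1// => i _; rewrite none.
  rewrite (bigD1 i0)//= big1 ?addr0; first by case: (_ == _); rewrite ?ler01.
  move=> i ii0; case: eqP => [Ei|//].
  by have := nbr_self_unique (rho := rho) sz Ei E => ie; rewrite ie eqxx in ii0.
apply: (@le_trans _ _ (\sum_j (level_energy (xs z j) - 2 * (q^-1 *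
    \sum_k `|c k (xs z j) - c k (xs z (N z j))|) - (N z j == j)%:R - 2 * q^-1))).
  rewrite !sumrB sum_cst_ord opprD addrA lerB// lerB//.
apply: ler_sum => j _; rewrite [leRHS]big_mkcond /=.
rewrite [leRHS](eq_bigr (fun r => sel z j r * ((r != j)%:R * ((1 + sel z r j) *
    (q^-1 * \sum_k c k (xs z j) * c k (xs z r) - q^-1))))); last first.
  by move=> r _; case: (r != j) => /=; [rewrite mul1r -mulrA|rewrite mul0r mulr0].
rewrite sum_sel; set B := q^-1 * \sum_k `|_|; set A := level_energy _.
have B0 : 0 <= B by rewrite mulr_ge0 ?(ltW qi)// sumr_ge0.
have A0 : 0 <= A.
  by rewrite mulr_ge0 ?(ltW qi)// sumr_ge0// => k _; exact: sqr_ge0.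
have A1 : A <= 1.
  apply: le_trans (ler_norm _) _; apply: mean_le => k.
  by rewrite normrX expr_le1.
have [E|E] := eqVneq (N z j) j.
  by rewrite mul0r; move: (q^-1) qi A A0 A1 B B0 => e *; rewrite /=; lra.
rewrite mul1r subr0.
have D : A - B <= q^-1 * \sum_k c k (xs z j) * c k (xs z (N z j)).
  rewrite /A /B /level_energy -mulrBr -sumrB ler_wpM2l ?(ltW qi)//.
  apply: ler_sum => k _; rewrite lerBlDr -lerBlDl expr2 -mulrBr.
  apply: le_trans (ler_norm _) _; rewrite normrM ler_piMl//.
move: (_ * _) D => D D1.
rewrite /sel; case: (N z _ == j) => /=; move: (q^-1) qi A A0 A1 B B0 D D1 => e *; lra.
Qed.

Lemma En_pair_test_stat n :
  n%:R * Ex P (fun w => level_energy (Z0 w).1) - 2 * mean_ndiff P Z rho c true n -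
    (1 + n%:R * (2 * q^-1)) <= EZ (fun z : n.-tuple S => pair_test z * stat rho v h z).
Proof.
pose om j r (z : n.-tuple S) := sel z j r * (1 + sel z r j).
have bom j r : bmf (om j r).
  by apply: bmfM => //; apply: bmfD => //; exact: bmf_cst.
pose D j r (z : n.-tuple S) := om j r z * (q^-1 * \sum_k c k (xs z j) * c k (xs z r) - q^-1).
have bcx k i : bmf (fun z : n.-tuple S => c k (xs z i)) by exact: bmf_xs.
have bD j r : bmf (D j r).
  apply: bmfM => //; apply: bmfB; last exact: bmf_cst.
  apply: bmfM; first exact: bmf_cst.
  by apply: bmf_sum => k; exact: bmfM.
have bDs j : bmf (fun z => \sum_(r | r != j) D j r z) by exact: bmf_sum.
have bes j r : bmf (fun z : n.-tuple S => edge_test z j r * stat rho v h z).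
  by apply: bmfM => //; exact: bmf_stat.
have bess j : bmf (fun z : n.-tuple S => \sum_(r | r != j) edge_test z j r * stat rho v h z).
  exact: bmf_sum.
apply: (@le_trans _ _ (EZ (fun z => \sum_j \sum_(r | r != j) D j r z))); last first.
  rewrite [leRHS](_ : _ = EZ (fun z : n.-tuple S =>
      \sum_j \sum_(r | r != j) edge_test z j r * stat rho v h z)); last first.
    apply: Ex_ext => w; rewrite /pair_test mulr_suml.
    by apply: eq_bigr => j _; rewrite mulr_suml.
  rewrite /En !Ex_sum; last 2 first.
  - by move=> j; exact: (bmf_sample mZ (bess j)).
  - by move=> j; exact: (bmf_sample mZ (bDs j)).
  apply: ler_sum => j _; rewrite !Ex_sum; last 2 first.
  - by move=> r; exact: (bmf_sample mZ (bes j r)).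
  - by move=> r; exact: (bmf_sample mZ (bD j r)).
  apply: ler_sum => r rj; rewrite -!/(En P Z _) [leRHS]En_edge_test_stat//.
  apply: (@En_edge_weight n j r (om j r)) => //.
    move=> k; apply: indep_of_y_M => // z t E.
    by congr (1 + _); exact: isel.
  by move=> z; rewrite mulr_ge0 ?addr_ge0.
have bB : bmf (fun z : n.-tuple S => \sum_j q^-1 *
    \sum_k `|c k (xs z j) - c k (xs z (nsel rho true z j))|).
  apply: bmf_sum => j; apply: bmfM; first exact: bmf_cst.
  apply: bmf_sum => k; apply: bmf_norm; apply: bmfB => //.
  exact: bmf_nsel.
have bAs : bmf (fun z : n.-tuple S => \sum_j level_energy (xs z j)).
  by apply: bmf_sum => j; exact: bmf_xs.
rewrite -(En_mean_ndiff P mZ rho n true bc) -(En_sum_tnth mZ mZ0 copies indep n bA).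
have b2B : bmf (fun z : n.-tuple S => 2 * \sum_j q^-1 *
    \sum_k `|c k (xs z j) - c k (xs z (nsel rho true z j))|).
  by apply: bmfM => //; exact: bmf_cst.
rewrite [leLHS](_ : _ = EZ (fun z : n.-tuple S => \sum_j level_energy (xs z j) -
    2 * (\sum_j q^-1 * \sum_k `|c k (xs z j) - c k (xs z (nsel rho true z j))|) -
    (1 + n%:R * (2 * q^-1)))); last first.
  have s1 := bmf_sample mZ bAs; have s2 := bmf_sample mZ b2B; have s3 := bmf_sample mZ bB.
  rewrite /En ExB ?Ex_cst; [|exact: bmfB|exact: bmf_cst].
  by rewrite ExB// ExZ.
apply: Ex_le_ae.
- apply: bmfB; last exact: bmf_cst.
  by apply: bmfB; [exact: (bmf_sample mZ bAs)|exact: (bmf_sample mZ b2B)].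
- by apply: bmf_sum => j; exact: (bmf_sample mZ (bDs j)).
apply: filterS (sep_ae n) => w sw.
by have := pair_test_stat_pointwise sw; rewrite sumrB -[X in _ - X - _ <= _]mulr_sumr.
Qed.

(** Jensen for the squares, as the family of tangents c^2 >= 2 t c - t^2. *)
Lemma level_energy_ge g : g = q^-1 * \sum_k Ex P (fun w => c k (Z0 w).1) ->
  forall t, 2 * t * g - t ^+ 2 <= Ex P (fun w => level_energy (Z0 w).1).
Proof.
move=> -> t; have bcX k : bmf (fun w => c k (Z0 w).1) by exact: bmf_comp (bc k) mX0.
have bs : bmf (fun w => \sum_k c k (Z0 w).1) by exact: bmf_sum.
have bm : bmf (fun w => q^-1 * \sum_k c k (Z0 w).1) by apply: bmfM => //; exact: bmf_cst.
have bt : bmf (fun w => 2 * t * (q^-1 * \sum_k c k (Z0 w).1)).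
  by apply: bmfM => //; exact: bmf_cst.
rewrite -Ex_sum// -ExZ// -ExZ// -[t ^+ 2](Ex_cst P) -ExB//; last exact: bmf_cst.
apply: Ex_le.
- by apply: bmfB => //; exact: bmf_cst.
- exact: bmf_comp bA mX0.
move=> w; rewrite /level_energy.
have -> : t ^+ 2 = q^-1 * \sum_(k < M.+1) t ^+ 2.
  by rewrite sum_cst_ord mulKf// gt_eqF.
rewrite mulrCA -mulrBr ler_wpM2l ?invr_ge0// mulr_sumr -sumrB; apply: ler_sum => k _.
by rewrite -subr_ge0; have := sqr_ge0 (c k (Z0 w).1 - t); rewrite sqrrB; lra.
Qed.

(** The mean of the c k is the expectation of the rounded V times the residual, and the
    expectation of V times the residual is the residual variance. *)
Lemma level_mean_ge : Ex P (fun w => res (Z0 w) ^+ 2) - q^-1 <=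
  q^-1 * \sum_k Ex P (fun w => c k (Z0 w).1).
Proof.
have bres : bmf (fun w => res (Z0 w)) by exact: bmf_comp bmf_res mZ0.
have bv0 : bmf (fun w => v (Z0 w).2) by exact: bmf_comp bv mZ0.
have br0 : bmf (fun w => reg (Z0 w).1) by exact: bmf_comp breg mX0.
have blr k : bmf (fun w => lev v (k : 'I_M.+1) (Z0 w) * res (Z0 w)).
  by apply: bmfM => //; exact: bmf_comp (bmf_lev mv v01 k) mZ0.
have bg : bmf (fun w => grid M (v (Z0 w).2)) by exact: bmf_grid.
have cE k : Ex P (fun w => c k (Z0 w).1) = Ex P (fun w => lev v k (Z0 w) * res (Z0 w)).
  have [_ H] := cP k; have := H _ (@bmf_cst _ _ _ 1).
  by under Ex_ext do rewrite mulr1; move=> ->; apply: Ex_ext => w; rewrite mulr1.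
rewrite (eq_bigr _ (fun k _ => cE k)) -Ex_sum// -ExZ; last exact: bmf_sum.
rewrite [leRHS](_ : _ = Ex P (fun w => grid M (v (Z0 w).2) * res (Z0 w))); last first.
  by apply: Ex_ext => w; rewrite /grid -mulrA mulr_suml.
have rr : Ex P (fun w => v (Z0 w).2 * reg (Z0 w).1) = Ex P (fun w => reg (Z0 w).1 * reg (Z0 w).1).
  by have [_ H] := regP; exact: H.
have -> : Ex P (fun w => res (Z0 w) ^+ 2) = Ex P (fun w => v (Z0 w).2 * res (Z0 w)).
  apply/eqP; rewrite -subr_eq0 -ExB; [|exact: bmfX|exact: bmfM].
  rewrite (@Ex_ext _ _ _ P _ (fun w => reg (Z0 w).1 * reg (Z0 w).1 - v (Z0 w).2 * reg (Z0 w).1)).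
    by rewrite ExB ?rr ?subrr//; exact: bmfM.
  by move=> w; rewrite /res; ring.
rewrite lerBlDr -lerBlDl -ExB; [|exact: bmfM|exact: bmfM].
apply: Ex_le_cst; first by apply: bmfB; exact: bmfM.
move=> w; rewrite -mulrBl; have /andP[g0 g1] := grid_bound M (v01 (Z0 w).2).
apply: le_trans (ler_norm _) _; rewrite normrM (ger0_norm g0) -[leRHS]mulr1.
by apply: ler_pM => //; exact: res_le.
Qed.

End Levels.

(** Written as E[lev V | X] - E[lev | X] E[V | X], so that it is bounded everywhere and not only
    almost surely. *)
Lemma residual_cexp M : exists2 c : 'I_M.+1 -> d.-tuple R -> R,
  forall k, cexp_of P X0 (fun w => lev v k (Z0 w) * res (Z0 w)) (c k) &
  forall k x, `|c k x| <= 1.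
Proof.
have [pb pbP pb01] := level_cexp P mZ0 mv v01 M.
have H (k : 'I_M.+1) : exists beta : d.-tuple R -> R,
    cexp_of P X0 (fun w => lev v k (Z0 w) * v (Z0 w).2) beta /\ forall x, 0 <= beta x <= 1.
  have bl : bmf (fun w => lev v k (Z0 w) * v (Z0 w).2).
    by apply: bmfM; [exact: bmf_comp (bmf_lev mv v01 k) mZ0|exact: bmf_comp bv mZ0].
  have l01 w : 0 <= lev v k (Z0 w) * v (Z0 w).2 <= 1.
    have /andP[a0 a1] := lev01 v k (Z0 w); have /andP[b0 b1] := v01 (Z0 w).2.
    by rewrite mulr_ge0//= mulr_ile1.
  by have [beta b1 b2] := cexp_exists01 P mX0 bl l01; exists beta.
have [be beP] := choice H.
exists (fun k x => be k x - pb k x * reg x) => k; last first.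
  move=> x; have [_ /(_ x)/andP[b0 b1]] := beP k.
  have /andP[p0 p1] := pb01 k x; have /andP[r0 r1] := reg01 x.
  have : 0 <= pb k x * reg x <= 1 by rewrite mulr_ge0//= mulr_ile1.
  by move=> /andP[m0 m1]; rewrite ler_norml; apply/andP; split; lra.
have [[bbe beE] _] := beP k; have [bpb pbE] := pbP k.
split=> [|phi bp]; first by apply: bmfB => //; exact: bmfM.
have bphi : bmf (fun w => phi (Z0 w).1) by exact: bmf_comp bp mX0.
have bl : bmf (fun w => lev v k (Z0 w)) by exact: bmf_comp (bmf_lev mv v01 k) mZ0.
have bv0 : bmf (fun w => v (Z0 w).2) by exact: bmf_comp bv mZ0.
have br0 : bmf (fun w => reg (Z0 w).1) by exact: bmf_comp breg mX0.
have bb0 : bmf (fun w => be k (Z0 w).1) by exact: bmf_comp bbe mX0.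
have bp0 : bmf (fun w => pb k (Z0 w).1) by exact: bmf_comp bpb mX0.
transitivity (Ex P (fun w => lev v k (Z0 w) * v (Z0 w).2 * phi (Z0 w).1) -
    Ex P (fun w => lev v k (Z0 w) * (reg (Z0 w).1 * phi (Z0 w).1))).
  rewrite -ExB; [|by apply: bmfM => //; exact: bmfM|by apply: bmfM => //; exact: bmfM].
  by apply: Ex_ext => w; rewrite /res; ring.
rewrite beE// (pbE (fun x => reg x * phi x)); last exact: bmfM.
rewrite -ExB; [|exact: bmfM|by apply: bmfM => //; exact: bmfM].
by apply: Ex_ext => w; ring.
Qed.

(** Cauchy-Schwarz for the covariance with [pair_test]. *)
Lemma Var_stat_ge : exists2 c0, 0 < c0 & exists n0, forall n, (n0 <= n)%N ->
  c0 * n%:R <= Var P (fun w => stat rho v h (sample Z n w)).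
Proof.
pose v0 := Ex P (fun w => res (Z0 w) ^+ 2); have v0p : 0 < v0 := res_pos.
have v01' : v0 <= 1.
  apply: Ex_le_cst; first by apply: bmfX; exact: bmf_comp bmf_res mZ0.
  by move=> w; rewrite -[leLHS]real_normK ?num_real// expr_le1// res_le.
have v2p : 0 < v0 ^+ 2 by rewrite exprn_gt0.
have v2v : v0 ^+ 2 <= v0 by rewrite expr2 ler_piMr// ltW.
(* With 1/(M+1) <= v0^2/32 the energy is at least v0^2/2, and each error below is at most a
   sixteenth of v0^2 per point. *)
pose M := Num.truncn (32 / v0 ^+ 2).
have [c cP c1] := residual_cexp M.
have p32 : 0 <= 32 / v0 ^+ 2 by rewrite divr_ge0 ?(ltW v2p).
have qM : (M.+1%:R : R)^-1 <= v0 ^+ 2 / 32.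
  have /andP[_ /ltW h1] := truncn_itv p32.
  by rewrite -[leRHS]invrK lef_pV2 ?posrE ?ltr0n ?invr_gt0 ?divr_gt0// invf_div.
have e0 : 0 < v0 ^+ 2 / 32 by rewrite divr_gt0.
have bc k : bmf (c k) by case: (cP k).
have [n1 n1P] := mean_ndiff_small mZ mZ0 copies indep rho sep_ae atomless true bc e0.
pose B : R := local_bound 1 (K + K) ^+ 2.
have B0 : 0 < B.
  by rewrite exprn_gt0// /local_bound ltr_pwDl// mulr_ge0.
exists (v0 ^+ 4 / 16 / B); first by rewrite !divr_gt0// exprn_gt0.
exists (maxn n1 (Num.truncn (32 / v0 ^+ 2)).+1) => n; rewrite geq_max => /andP[/n1P s1 nl].
have n32 : 1 <= v0 ^+ 2 / 32 * n%:R.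
  have /andP[_ /ltW h1] := truncn_itv p32.
  have : 32 / v0 ^+ 2 <= n%:R by rewrite (le_trans h1)// ler_nat.
  by rewrite ler_pdivrMr//; lra.
have np : (0 : R) < n%:R by rewrite ltr0n (leq_trans _ nl).
have bS : bmf (fun w => stat rho v h (sample Z n w)).
  by apply: (bmf_sample mZ (Phi := @stat _ _ rho v h n)); exact: bmf_stat.
have bT : bmf (fun w => pair_test (sample Z n w)) by exact: (bmf_sample mZ (@bmf_pair_test n)).
have lower : v0 ^+ 2 / 4 * n%:R <=
    Cov P (fun w => pair_test (sample Z n w)) (fun w => stat rho v h (sample Z n w)).
  have := En_pair_test n; rewrite /En /Cov => ->; rewrite mul0r subr0.
  apply: le_trans (En_pair_test_stat cP c1 n).
  have g1 := level_mean_ge cP.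
  have := level_energy_ge cP erefl (v0 / 2); rewrite -/v0.
  set g := _^-1 * _ in g1 *; set A := Ex P _ => HA.
  have gA : v0 ^+ 2 / 2 <= A.
    apply: le_trans HA; rewrite -/v0 in g1.
    have g2 : v0 * (3 / 4) <= g by apply: le_trans g1; move: (M.+1%:R^-1) qM => e qM; lra.
    have : v0 * (v0 * (3 / 4)) <= v0 * g by rewrite ler_wpM2l// ltW.
    by move: (g) => x h1; lra.
  have t1 : n%:R * (v0 ^+ 2 / 2) <= n%:R * A by rewrite ler_wpM2l.
  have t2 : n%:R * (2 * (M.+1%:R : R)^-1) <= n%:R * (2 * (v0 ^+ 2 / 32)).
    by rewrite ler_wpM2l// ler_wpM2l.
  have t0 : 0 <= v0 ^+ 2 * n%:R by rewrite mulr_ge0 ?ltW.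
  move: (mean_ndiff _ _ _ _ _ _) (_ * (2 * (M.+1%:R^-1))) (n%:R * A) s1 t1 t2.
  by move=> m q2 a s1 t1 t2; lra.
have CS := Cov_sqr_le P bT bS.
have VT := Var_pair_test n.
have {}CS : (v0 ^+ 2 / 4 * n%:R) ^+ 2 <= n%:R * B * Var P (fun w => stat rho v h (sample Z n w)).
  apply: (le_trans _ (le_trans CS _)); last by rewrite ler_wpM2r// Var_ge0.
  rewrite ler_sqr ?nnegrE//; first by rewrite mulr_ge0// divr_ge0// ltW.
  by apply: le_trans lower; rewrite mulr_ge0// divr_ge0// ltW.
have nB : 0 < n%:R * B by exact: mulr_gt0.
rewrite -(ler_pM2l nB); apply: (le_trans _ CS).
rewrite le_eqVlt; apply/orP; left; apply/eqP; field.
by rewrite gt_eqF.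
Qed.

End VarianceLowerBound.

(** * Normal approximation for smooth tests *)

Lemma bmf_continuous (R : realType) d (T : measurableType d) (F : R -> R) (f : T -> R) c :
  continuous F -> (forall x, `|F x| <= c) -> bmf f -> bmf (fun w => F (f w)).
Proof.
move=> cF Fc [mf _]; apply: (@bmf_le _ _ _ _ c) => //.
apply: (measurableT_comp _ mf); exact: continuous_measurable_fun.
Qed.

Lemma Ex_abs_le dT (T : measurableType dT) (R : realType) (P : probability T R)
  (f : T -> R) b : 0 <= b -> bmf f -> Ex P (fun w => f w ^+ 2) <= b ^+ 2 ->
  Ex P (fun w => `|f w|) <= b.
Proof.
move=> b0 bf fb; rewrite -ler_sqr ?nnegrE//; last by apply: Ex_ge0 => w.
exact: le_trans (Ex_CS_abs P bf) fb.
Qed.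

Section Transfer.
Context {dT : measure_display} {T : measurableType dT} {R : realType}.
Variable P : probability T R.
Variables (S W : T -> R) (s del : R).
Hypotheses (bS : bmf S) (bW : bmf W) (W0 : Ex P W = 0) (s0 : 0 < s).
Hypotheses (sE : Var P S = s ^+ 2) (del0 : 0 <= del) (del1 : del <= 1).
Hypothesis SW : Var P (fun w => S w - W w) <= (s * del) ^+ 2.

Let Y w := (S w - Ex P S) / s.
Let U w := W w / s.

Let bY : bmf Y.
Proof. by apply: bmfM; [apply: bmfB => //|]; exact: bmf_cst. Qed.
Let bU : bmf U.
Proof. by apply: bmfM => //; exact: bmf_cst. Qed.
Let bYU : bmf (fun w => Y w - U w). Proof. exact: bmfB. Qed.

Let sn : s != 0. Proof. by rewrite gt_eqF. Qed.

Lemma transfer_sqr : Ex P (fun w => (Y w - U w) ^+ 2) <= del ^+ 2.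
Proof.
have -> : Ex P (fun w => (Y w - U w) ^+ 2) = (s ^+ 2)^-1 * Var P (fun w => S w - W w).
  rewrite /Var -ExZ; last by apply: bmfX; apply: bmfB; [exact: bmfB|exact: bmf_cst].
  by apply: Ex_ext => w; rewrite ExB// W0 /Y /U; field.
by rewrite ler_pdivrMl ?exprn_gt0// -exprMn.
Qed.

Lemma transfer_second : `|1 - Ex P (fun w => U w ^+ 2)| <= 3 * del.
Proof.
have Y2 : Ex P (fun w => Y w ^+ 2) = 1.
  transitivity ((s ^+ 2)^-1 * Var P S); last by rewrite sE mulVf// expf_neq0.
  rewrite /Var -ExZ; last first.
    by apply: bmfX; apply: bmfB => //; exact: bmf_cst.
  by apply: Ex_ext => w; rewrite /Y; field.
rewrite -[X in `|X - _|]Y2 -ExB; [|exact: bmfX|exact: bmfX].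
have bYd : bmf (fun w => Y w * (Y w - U w)) by exact: bmfM.
have bd2 : bmf (fun w => (Y w - U w) ^+ 2) by exact: bmfX.
have b2 : bmf (fun w => 2 * (Y w * (Y w - U w))) by apply: bmfM => //; exact: bmf_cst.
rewrite (@Ex_ext _ _ _ P _ (fun w => 2 * (Y w * (Y w - U w)) - (Y w - U w) ^+ 2)); last first.
  by move=> w; ring.
rewrite ExB// ExZ//.
have CS : Ex P (fun w => Y w * (Y w - U w)) ^+ 2 <= del ^+ 2.
  have EY : Ex P Y = 0.
    rewrite /Y ExZr ?ExB ?Ex_cst ?subrr ?mul0r//; first exact: bmf_cst.
    by apply: bmfB => //; exact: bmf_cst.
  have := Cov_sqr_le P bY bYU; rewrite /Cov EY mul0r subr0 => h.
  apply: le_trans h _; rewrite VarE// EY expr0n /= subr0 Y2 mul1r VarE//.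
  have := transfer_sqr; have := sqr_ge0 (Ex P (fun w => Y w - U w)); lra.
have {}CS : `|Ex P (fun w => Y w * (Y w - U w))| <= del.
  by rewrite -ler_sqr ?nnegrE// real_normK ?num_real.
have h2 := transfer_sqr; have h3 : 0 <= Ex P (fun w => (Y w - U w) ^+ 2).
  by apply: Ex_ge0 => w; exact: sqr_ge0.
have h4 : del ^+ 2 <= del by rewrite expr2 ler_piMr.
move: CS; rewrite ler_norml => /andP[k1 k2].
by rewrite ler_norml; apply/andP; split; lra.
Qed.

(** W is close to the centred S in L2, at distance at most s del.  A Lipschitz test sees
    this at first order, and so does E[U^2], which is then near 1. *)
Lemma transfer_test (g F F' : R -> R) (Lg c1 m q : R) : 0 <= Lg ->
  (forall x y, `|g x - g y| <= Lg * `|x - y|) -> (forall x, `|g x| <= 1) ->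
  continuous F -> continuous F' -> (forall x, `|F x| <= c1) -> (forall x, `|F' x| <= c1) ->
  (forall x, F' x = x * F x + g x - m) ->
  `|Ex P (fun w => W w * F (U w)) -
    Ex P (fun w => F' (U w) / s) * Ex P (fun w => W w ^+ 2)| <= s * q ->
  `|Ex P (fun w => g (Y w)) - m| <= (Lg + 3 * c1) * del + q.
Proof.
move=> Lg0 gL g1 cF cF' Fc F'c eqn H.
have bFU : bmf (fun w => F (U w)) by exact: bmf_continuous cF Fc bU.
have bF'U : bmf (fun w => F' (U w)) by exact: bmf_continuous cF' F'c bU.
have cg : continuous g by exact: measurable_lipschitz gL.
have bgY : bmf (fun w => g (Y w)) by exact: bmf_continuous cg g1 bY.
have bgU : bmf (fun w => g (U w)) by exact: bmf_continuous cg g1 bU.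
have gU : Ex P (fun w => g (U w)) - m =
    Ex P (fun w => F' (U w)) - Ex P (fun w => U w * F (U w)).
  have bUF : bmf (fun w => U w * F (U w)) by exact: bmfM.
  rewrite -ExB// -(Ex_cst P m) -ExB//; last exact: bmf_cst.
  by apply: Ex_ext => w; rewrite eqn; ring.
have Q : `|Ex P (fun w => U w * F (U w)) -
    Ex P (fun w => F' (U w)) * Ex P (fun w => U w ^+ 2)| <= q.
  rewrite -(ler_pM2l s0); apply: le_trans H.
  rewrite -{1}(gtr0_norm s0) -normrM mulrBr.
  rewrite le_eqVlt; apply/orP; left; apply/eqP; congr (`|_ - _|).
    rewrite -ExZ; last exact: bmfM.
    by apply: Ex_ext => w; rewrite /U; field.
  rewrite ExZr// (@Ex_ext _ _ _ P (fun w => U w ^+ 2) (fun w => (s ^+ 2)^-1 * W w ^+ 2)).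
    rewrite ExZ; last exact: bmfX.
    by field.
  by move=> w; rewrite /U; field.
have gYU : `|Ex P (fun w => g (Y w)) - Ex P (fun w => g (U w))| <= Lg * del.
  rewrite -ExB//; apply: le_trans (Ex_normr P (bmfB bgY bgU)) _.
  apply: (@le_trans _ _ (Ex P (fun w => Lg * `|Y w - U w|))).
    apply: Ex_le => [||w]; last exact: gL.
    - by apply: bmf_norm; exact: bmfB.
    - by apply: bmfM; [exact: bmf_cst|exact: bmf_norm].
  rewrite ExZ; last exact: bmf_norm.
  by rewrite ler_wpM2l// Ex_abs_le// transfer_sqr.
have F1 : `|Ex P (fun w => F' (U w))| <= c1.
  apply: le_trans (Ex_normr P bF'U) _; apply: Ex_le_cst => //; exact: bmf_norm.
have F2 : `|Ex P (fun w => F' (U w)) * (1 - Ex P (fun w => U w ^+ 2))| <= c1 * (3 * del).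
  by rewrite normrM; apply: ler_pM => //; exact: transfer_second.
rewrite (_ : _ - m = (Ex P (fun w => g (Y w)) - Ex P (fun w => g (U w))) +
  (Ex P (fun w => F' (U w)) * (1 - Ex P (fun w => U w ^+ 2)) -
   (Ex P (fun w => U w * F (U w)) -
    Ex P (fun w => F' (U w)) * Ex P (fun w => U w ^+ 2)))); last first.
  by rewrite -[LHS](addrNK (Ex P (fun w => g (U w)))) -addrA; move: gU; lra.
apply: le_trans (ler_normD _ _) _; rewrite mulrDl -addrA lerD//.
by apply: le_trans (ler_normB _ _) _; rewrite lerD// [3 * c1]mulrC -mulrA.
Qed.

End Transfer.

Section CentralLimit.
Context {dT : measure_display} {T : measurableType dT} {R : realType}.
Variable P : probability T R.
Context {d : nat}.
Local Notation S := (d.-tuple R * R)%type.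
Variables (Z : nat -> T -> S) (Z0 : T -> S).
Hypothesis mZ : forall i, measurable_fun setT (Z i).
Hypothesis mZ0 : measurable_fun setT Z0.
Hypothesis copies : forall i, identically_distributed P (Z i) Z0.
Hypothesis indep : mutually_independent P Z.
Variable rho : neighbor_rule R d.
Hypothesis sep_ae : forall n, {ae P, forall w, sep (sample Z n w)}.
Hypothesis atomless : forall (k : 'I_d) c, P [set w | tnth (Z0 w).1 k = c] = 0%E.
Variables (v h : R -> R).
Hypotheses (mv : measurable_fun setT v) (mh : measurable_fun setT h).
Hypotheses (v01 : forall y, 0 <= v y <= 1) (h01 : forall y, 0 <= h y <= 1).
Variable reg : d.-tuple R -> R.
Hypothesis regP : cexp_of P (fun w => (Z0 w).1) (fun w => v (Z0 w).2) reg.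
Hypothesis reg01 : forall x, 0 <= reg x <= 1.
Hypothesis res_pos : 0 < Ex P (fun w => res v reg (Z0 w) ^+ 2).

Local Notation St n := (fun w => stat rho v h (sample Z n w)).

Let bSt n : bmf (St n).
Proof. by apply: (bmf_sample mZ (Phi := @stat _ _ rho v h n)); exact: bmf_stat. Qed.

Definition std n w := (St n w - Ex P (St n)) / Num.sqrt (Var P (St n)).

(** The distance del is chosen first, from the test; only then are W, and the size of n for
    which both the remainder and the error of the Stein identity are small. *)
Lemma clt_test (g : R -> R) Lg A : (forall x, 0 <= g x <= 1) -> 0 <= Lg ->
  (forall x y, `|g x - g y| <= Lg * `|x - y|) ->
  (forall x, x <= - A -> g x = 1) -> (forall x, A <= x -> g x = 0) ->
  forall e, 0 < e -> exists n0, forall n, (n0 <= n)%N ->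
    `|Ex P (fun w => g (std n w)) - stein_mean g| <= e.
Proof.
move=> g01 Lg0 gL gl gr e e0.
have [F [F' [c1 [L [L0 [Fc F'c] eqn taylor [cF cF']]]]]] := stein_solution g01 gL gl gr.
have c10 : 0 <= c1 by exact: le_trans (Fc 0).
have [c0 c0p [n1 n1P]] := Var_stat_ge mZ mZ0 copies indep rho sep_ae atomless mv mh v01 h01
  regP reg01 res_pos.
(* Half of e is spent on the remainder, half on the Stein error Kc / s. *)
pose del := Num.min 1 (e / (2 * (Lg + 3 * c1 + 1))).
have den : 0 < 2 * (Lg + 3 * c1 + 1) by rewrite mulr_gt0// ltr_wpDl// addr_ge0// mulr_ge0.
have del0 : 0 < del by rewrite lt_min ltr01 divr_gt0.
have del1 : del <= 1 by rewrite ge_min lexx.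
have dele : (Lg + 3 * c1) * del <= e / 2.
  apply: (@le_trans _ _ ((Lg + 3 * c1 + 1) * (e / (2 * (Lg + 3 * c1 + 1))))).
    apply: ler_pM; [by rewrite addr_ge0// mulr_ge0|exact: ltW|by rewrite lerDl|].
    by rewrite ge_min lexx orbT.
  rewrite le_eqVlt; apply/orP; left; apply/eqP; field.
  by rewrite gt_eqF// ltr_wpDl// addr_ge0// mulr_ge0.
have eta0 : 0 < c0 * del ^+ 2 by rewrite mulr_gt0// exprn_gt0.
have [a [l [n2 [[ba bl] [ac lc] l0 a0 n2P]]]] :=
  split_statistic mZ mZ0 copies indep rho sep_ae atomless mv mh v01 h01 eta0.
pose C1 := stein_const rho (2 : R); pose C2 := stein_var rho (2 : R).
have C10 : 0 <= C1.
  by rewrite /C1 /stein_const addr_ge0// mulr_ge0// sqr_ge0.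
pose Kc := L * C1 / c0 + c1 * Num.sqrt (C2 / c0).
have Kc0 : 0 <= Kc.
  by rewrite addr_ge0 ?mulr_ge0// ?sqrtr_ge0// ?invr_ge0 ltW.
pose n3 := (Num.truncn ((2 * Kc / e) ^+ 2 / c0)).+1.
exists (maxn (maxn n1 n2) n3) => n; rewrite !geq_max => /andP[/andP[/n1P V0 /n2P V1] nl].
have np : (0 : R) < n%:R by rewrite ltr0n (leq_trans _ nl).
have cn : 0 < c0 * n%:R by exact: mulr_gt0.
have Vp : 0 < Var P (St n) by exact: lt_le_trans V0.
pose s := Num.sqrt (Var P (St n)).
have s0 : 0 < s by rewrite sqrtr_gt0.
have sE : Var P (St n) = s ^+ 2 by rewrite sqr_sqrtr// ltW.
have W0 : Ex P (fun w => W rho a l (sample Z n w)) = 0.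
  have := @stein_identity _ _ _ _ _ _ _ mZ mZ0 copies indep rho sep_ae _ _ _ ba bl ac lc l0 a0 n
    (fun=> 1) (fun=> 0) 0 0 (lexx 0) (fun _ _ => bmf_cst 1) (fun _ _ => bmf_cst 0)
    (fun x y => ltac:(by rewrite subrr !mul0r subrr normr0)) (fun x => ltac:(by rewrite normr0)).
  rewrite !mul0r mulr0 addr0 normr_le0 subr_eq0 => /eqP.
  rewrite /En Ex_cst mul0r => <-.
  by apply: Ex_ext => w; rewrite mulr1.
have bW : bmf (fun w => W rho a l (sample Z n w)).
  by apply: (bmf_sample mZ (Phi := fun z : n.-tuple S => W rho a l z)); exact: bmf_W.
have SW : Var P (fun w => St n w - W rho a l (sample Z n w)) <= (s * del) ^+ 2.
  apply: le_trans V1 _; rewrite exprMn -sE mulrAC ler_wpM2r ?sqr_ge0//.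
have scont (G : R -> R) : continuous G -> continuous (fun x : R => G (x / s)).
  move=> cG x; apply: (@continuous_comp R R R (fun x : R => x / s) G); last exact: cG.
  by apply: cvgM; [exact: cvg_id|exact: cvg_cst].
have SI : `|Ex P (fun w => W rho a l (sample Z n w) * F (W rho a l (sample Z n w) / s)) -
    Ex P (fun w => F' (W rho a l (sample Z n w) / s) / s) *
    Ex P (fun w => W rho a l (sample Z n w) ^+ 2)| <=
    n%:R * (L / s ^+ 2 * C1) + c1 / s * Num.sqrt (n%:R * C2).
  apply: (stein_identity mZ mZ0 copies indep rho sep_ae ba bl ac lc l0 a0 (n := n)
    (f := fun x => F (x / s)) (f' := fun x => F' (x / s) / s)).
  - by rewrite divr_ge0// sqr_ge0.
  - by move=> Phi bP; exact: (@bmf_continuous _ _ _ _ _ c1 (scont _ cF) (fun x => Fc _)).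
  - move=> Phi bP; apply: bmfM; last exact: bmf_cst.
    exact: (@bmf_continuous _ _ _ _ _ c1 (scont _ cF') (fun x => F'c _)).
  - move=> x y; have := taylor (x / s) (y / s).
    rewrite -mulrBl expr_div_n (_ : L * (_ / _) = L / s ^+ 2 * (y - x) ^+ 2); last first.
      by rewrite mulrCA mulrC.
    by rewrite (_ : F' (x / s) * ((y - x) / s) = F' (x / s) / s * (y - x))// mulrCA mulrC.
  - move=> x; rewrite normrM (gtr0_norm (_ : 0 < s^-1)) ?invr_gt0//.
    by rewrite ler_wpM2r// invr_ge0 ltW.
have := @transfer_test _ _ _ P (St n) (fun w => W rho a l (sample Z n w)) s del
  (bSt n) bW W0 s0 sE (ltW del0) del1 SW g F F' Lg c1 (stein_mean g) (Kc / s)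
  Lg0 gL _ cF cF' Fc F'c eqn.
have sq : s * (Kc / s) = Kc by rewrite mulrCA divff ?mulr1// gt_eqF.
have g1 x : `|g x| <= 1 by have /andP[h0 h1] := g01 x; rewrite ger0_norm.
rewrite sq => H; apply: le_trans (H g1 _) _; last first.
  have k : 2 * Kc / e <= s.
    rewrite -ler_sqr ?nnegrE ?divr_ge0 ?mulr_ge0 ?(ltW e0) ?(ltW s0)//.
    rewrite -sE; apply: le_trans V0; rewrite [c0 * _]mulrC -ler_pdivrMr//.
    have p : 0 <= (2 * Kc / e) ^+ 2 / c0 by rewrite divr_ge0 ?(ltW c0p)// sqr_ge0.
    have /andP[_ /ltW h1] := truncn_itv p.
    by rewrite (le_trans h1)// ler_nat.
  rewrite [leRHS]splitr lerD// ler_pdivrMr//.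
  by move: k; rewrite ler_pdivrMr// mulrAC ler_pdivlMr// mulrC [e * s]mulrC.
apply: le_trans SI _; rewrite /Kc.
have ns : n%:R / s ^+ 2 <= c0^-1.
  by rewrite ler_pdivrMr ?exprn_gt0// ler_pdivlMl// -sE.
apply: lerD.
  rewrite (_ : n%:R * _ = L * C1 * (n%:R / s ^+ 2)); last by ring.
  by rewrite ler_wpM2l// mulr_ge0.
rewrite -mulrA ler_wpM2l//.
rewrite (_ : s^-1 = Num.sqrt (s^-1 ^+ 2)); last by rewrite sqrtr_sqr gtr0_norm// invr_gt0.
rewrite -sqrtrM ?sqr_ge0// ler_wsqrtr//.
rewrite (_ : s^-1 ^+ 2 * _ = C2 * (n%:R / s ^+ 2)); last by rewrite exprVn; ring.
rewrite ler_wpM2l// /C2 /stein_var.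
by rewrite addr_ge0// mulr_ge0// sqr_ge0.
Qed.

End CentralLimit.

(** * From smooth tests to distribution functions *)

Section Ramp.
Context {R : realType}.
Variables (t del : R).
Hypothesis del0 : 0 < del.

(** The piecewise linear step from 1 at t to 0 at t + del. *)
Definition ramp (x : R) : R := Num.min 1 (Num.max 0 ((t + del - x) / del)).

Lemma ramp01 x : 0 <= ramp x <= 1.
Proof. by rewrite /ramp le_min ler01 le_max lexx ge_min lexx. Qed.

Lemma ramp1 x : x <= t -> ramp x = 1.
Proof.
move=> xt; have h1 : 1 <= (t + del - x) / del by rewrite ler_pdivlMr// mul1r; lra.
by rewrite /ramp min_l// le_max h1 orbT.
Qed.

Lemma ramp0 x : t + del <= x -> ramp x = 0.
Proof.
move=> xt; have h1 : (t + del - x) / del <= 0 by rewrite ler_pdivrMr// mul0r; lra.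
by rewrite /ramp max_l// min_r.
Qed.

Lemma clamp_lipschitz (x y : R) :
  `|Num.min 1 (Num.max 0 x) - Num.min 1 (Num.max 0 y)| <= `|x - y|.
Proof.
wlog xy : x y / x <= y => [H|].
  by case: (leP x y) => [/H//|/ltW /H]; rewrite distrC [leRHS]distrC.
rewrite [leRHS]ler0_norm ?subr_le0//; rewrite ler_norml.
by case: (leP 0 x) => x0; case: (leP 0 y) => y0; case: (leP 1 x) => x1;
  case: (leP 1 y) => y1; case: (leP (1 : R) 0) => z0; apply/andP; split; lra.
Qed.

Lemma ramp_lipschitz x y : `|ramp x - ramp y| <= del^-1 * `|x - y|.
Proof.
apply: le_trans (clamp_lipschitz _ _) _.
have -> : (t + del - x) / del - (t + del - y) / del = del^-1 * (y - x).
  by field; rewrite gt_eqF.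
by rewrite normrM (gtr0_norm (_ : 0 < del^-1)) ?invr_gt0// distrC.
Qed.

End Ramp.

Section Sandwich.
Context {dT : measure_display} {T : measurableType dT} {R : realType}.
Variable P : probability T R.
Local Notation NP := (normal_prob (0 : R) 1).

Let meas_le (V : T -> R) t : measurable_fun setT V -> measurable [set w | V w <= t].
Proof.
move=> mV; rewrite (_ : [set w | _] = V @^-1` `]-oo, t]%classic).
  by rewrite -[X in measurable X]setTI; exact: mV.
by apply/seteqP; split => w /=; rewrite in_itv.
Qed.

Lemma cdf_le_test (V : T -> R) (g : R -> R) t : measurable_fun setT V ->
  bmf (fun w => g (V w)) -> (forall x, 0 <= g x) -> (forall x, x <= t -> g x = 1) ->
  fine (P [set w | V w <= t]) <= Ex P (fun w => g (V w)).
Proof.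
move=> mV bg g0 g1; rewrite -Ex_indic; last exact: meas_le.
apply: Ex_le => // [|w].
  apply: (@bmf_le _ _ _ _ 1); first by apply: measurable_indic; exact: meas_le.
  by move=> w; rewrite indicE; case: (_ \in _); rewrite ?normr1 ?normr0.
rewrite indicE; case: (boolP (_ \in _)) => [/set_mem /= h|_]; last exact: g0.
by rewrite g1.
Qed.

Lemma test_le_cdf (V : T -> R) (g : R -> R) t : measurable_fun setT V ->
  bmf (fun w => g (V w)) -> (forall x, g x <= 1) -> (forall x, t < x -> g x = 0) ->
  Ex P (fun w => g (V w)) <= fine (P [set w | V w <= t]).
Proof.
move=> mV bg g0 g1; rewrite -Ex_indic; last exact: meas_le.
apply: Ex_le => // [|w].
  apply: (@bmf_le _ _ _ _ 1); first by apply: measurable_indic; exact: meas_le.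
  by move=> w; rewrite indicE; case: (_ \in _); rewrite ?normr1 ?normr0.
rewrite indicE; case: (boolP (_ \in _)) => [_|/negP h]; first exact: g0.
rewrite g1// ltNge; apply/negP => h'; apply: h; exact/mem_set.
Qed.

(** The distribution function at t lies between the expectations of the ramps that end and
    start at t, and the normal distribution function hardly moves over their width. *)
Lemma cvg_of_tests (V : nat -> T -> R) : (forall n, measurable_fun setT (V n)) ->
  (forall (g : R -> R) Lg A, (forall x, 0 <= g x <= 1) -> 0 <= Lg ->
    (forall x y, `|g x - g y| <= Lg * `|x - y|) ->
    (forall x, x <= - A -> g x = 1) -> (forall x, A <= x -> g x = 0) ->
    forall e, 0 < e -> exists n0, forall n, (n0 <= n)%N ->
      `|Ex P (fun w => g (V n w)) - stein_mean g| <= e) ->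
  cvg_in_distribution P V NP.
Proof.
move=> mV H; split => // t ct.
have finN s : NP `]-oo, s]%classic \is a fin_num by exact: fin_num_measure.
have finP n : P [set w | V n w <= t] \is a fin_num.
  by apply: fin_num_measure; exact: meas_le.
rewrite -[X in _ --> X]fineK; last exact: finN.
apply/fine_cvgP; split; first by near=> n; exact: finP.
have {ct}ct : (fun s => fine (NP `]-oo, s]%classic)) s @[s --> t] --> fine (NP `]-oo, t]%classic).
  by apply: fine_cvg; rewrite fineK//; exact: ct.
apply/cvgrPdist_le => e e0.
have e20 : 0 < e / 2 by rewrite divr_gt0.
move/cvgrPdist_le : ct => /(_ _ e20) /nbhs_ballP[r /= r0 hr].
pose del := r / 2; have del0 : 0 < del by rewrite divr_gt0.
have rampT a : forall e, 0 < e -> exists n0, forall n, (n0 <= n)%N ->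
    `|Ex P (fun w => ramp a del (V n w)) - stein_mean (ramp a del)| <= e.
  apply: (H _ del^-1 (Num.max `|a| `|a + del|)).
  - exact: ramp01.
  - by rewrite invr_ge0 ltW.
  - exact: ramp_lipschitz.
  - move=> x xa; apply: ramp1 => //; apply: le_trans xa _.
    rewrite lerNl; apply: (le_trans (ler_norm (- a))).
    by rewrite normrN le_max lexx.
  - move=> x ax; apply: ramp0 => //; apply: le_trans ax.
    by apply: (le_trans (ler_norm _)); rewrite le_max lexx orbT.
have [n1 n1P] := rampT t _ e20; have [n2 n2P] := rampT (t - del) _ e20.
have bramp a n : bmf (fun w => ramp a del (V n w)).
  apply: (@bmf_le _ _ _ _ 1); last first.
    by move=> w; have /andP[h0 h1] := ramp01 a del (V n w); rewrite ger0_norm.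
  apply: (measurableT_comp _ (mV n)); apply: continuous_measurable_fun.
  exact: measurable_lipschitz (ramp_lipschitz a del0).
exists (maxn n1 n2) => // n /=; rewrite geq_max => /andP[/n1P u1 /n2P u2].
have up : fine (P [set w | V n w <= t]) <= Ex P (fun w => ramp t del (V n w)).
  apply: cdf_le_test => // [x|x]; last exact: ramp1.
  by case/andP: (ramp01 t del x).
have lo : Ex P (fun w => ramp (t - del) del (V n w)) <= fine (P [set w | V n w <= t]).
  apply: test_le_cdf => // [x|x tx]; first by case/andP: (ramp01 (t - del) del x).
  by apply: ramp0 => //; rewrite addrNK ltW.
have m1 : stein_mean (ramp t del) <= fine (NP `]-oo, t + del]%classic).
  apply: (stein_mean_le (ramp01 t del) (ramp_lipschitz t del0)) => x tx.
  by apply: ramp0 => //; exact: ltW.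
have m2 : fine (NP `]-oo, t - del]%classic) <= stein_mean (ramp (t - del) del).
  apply: (stein_mean_ge (ramp01 (t - del) del) (ramp_lipschitz (t - del) del0)) => x tx.
  exact: ramp1.
have c1 : `|fine (NP `]-oo, t]%classic) - fine (NP `]-oo, t + del]%classic)| <= e / 2.
  apply: hr; rewrite /ball /= (_ : t - (t + del) = - del) ?normrN ?gtr0_norm /del//; lra.
have c2 : `|fine (NP `]-oo, t]%classic) - fine (NP `]-oo, t - del]%classic)| <= e / 2.
  apply: hr; rewrite /ball /= (_ : t - (t - del) = del) ?gtr0_norm /del//; lra.
move: u1 u2 c1 c2; rewrite !ler_norml => /andP[? ?] /andP[? ?] /andP[? ?] /andP[? ?].
by apply/andP; split; lra.
Unshelve. all: by end_near.
Qed.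

End Sandwich.

(** * The two neighbour rules *)

Section RightRule.
Context {R : realType}.
Local Notation X := (1.-tuple R).

Let mcoord : measurable_fun setT (fun u : X => u`_0).
Proof.
rewrite (_ : (fun u : X => _) = fun u => tnth u ord0); first exact: measurable_tnth.
by apply/funext => u; rewrite (tnth_nth 0).
Qed.

Let m1 : measurable_fun setT (fun u : X * X => u.1`_0).
Proof. exact: (measurableT_comp mcoord). Qed.
Let m2 : measurable_fun setT (fun u : X * X => u.2`_0).
Proof. exact: (measurableT_comp mcoord). Qed.

(** On the line one colour is enough: of two points to the left of u, the farther one has the
    nearer one between itself and u. *)
Definition right_rule : neighbor_rule R 1.
Proof.
refine (@NeighborRule R 1 (fun u v => u`_0 < v`_0) (fun u v => v`_0 - u`_0)
  unit (fun _ _ => tt) _ _ _ _ _ _).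
- exact: measurable_fun_ltr.
- exact: measurable_funB.
- move=> u v w _ _ vw vu wu _ g; have h : v`_0 <= w`_0 by lra.
  by rewrite lt_neqAle vw h /=; lra.
- by move=> u v; rewrite neq_lt.
- by move=> u v k uv; rewrite (ord1 k) !(tnth_nth 0) /= ler0_norm; lra.
- move=> u v e H; rewrite mul1r; have := H ord0; rewrite !(tnth_nth 0) /= ler_norml.
  by move=> /andP[h1 h2]; lra.
Defined.

Lemma nbr_right_rule n (x : 'I_n -> X) i :
  nbr right_rule [set: 'I_n]%SET x i = right_nearest_neighbor x i.
Proof.
rewrite /nbr /nb /right_nearest_neighbor; congr odflt; apply: eq_pick => j /=.
have cE k : cand (arel right_rule x) [set: 'I_n]%SET i k = ((x i)`_0 < (x k)`_0).
  rewrite /cand finset.in_setT /= /arel /=; have [->|//] := eqVneq k i.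
  by rewrite ltxx.
rewrite cE; congr (_ && _); apply: eq_forallb => k; rewrite cE /lrel /=.
by rewrite lerD2r.
Qed.

End RightRule.

Section EuclideanRule.
Context {R : realType} {d : nat}.
Local Notation X := (d.-tuple R).

Lemma eucl_sqr (u v : X) : eucl_dist u v ^+ 2 = \sum_(k < d) (tnth u k - tnth v k) ^+ 2.
Proof. by rewrite sqr_sqrtr// sumr_ge0// => k _; exact: sqr_ge0. Qed.

Lemma eucl_ge0 (u v : X) : 0 <= eucl_dist u v. Proof. exact: sqrtr_ge0. Qed.

Lemma eucl_sym (u v : X) : eucl_dist u v = eucl_dist v u.
Proof.
by rewrite /eucl_dist; congr Num.sqrt; apply: eq_bigr => k _; rewrite -sqrrN opprB.
Qed.

Lemma eucl_ge (u v : X) k : `|tnth u k - tnth v k| <= eucl_dist u v.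
Proof.
rewrite -ler_sqr ?nnegrE ?eucl_ge0// real_normK ?num_real// eucl_sqr (bigD1 k)//= lerDl.
by rewrite sumr_ge0// => i _; exact: sqr_ge0.
Qed.

(** A crude constant, sufficient for comparing cells with distances. *)
Lemma eucl_le (u v : X) (e : R) :
  (forall k, `|tnth u k - tnth v k| <= e) -> eucl_dist u v <= d%:R * e.
Proof.
move=> H; have [k0 _|d0] := pickP (fun _ : 'I_d => true); last first.
  rewrite /eucl_dist big1 ?sqrtr0; last by move=> k; have := d0 k.
  by have := d0; case: (d) => [_|n /(_ ord0)//]; rewrite mul0r.
have e0 : 0 <= e by exact: le_trans (H k0).
have d1 : (1 : R) <= d%:R by rewrite ler1n; exact: leq_ltn_trans (ltn_ord k0).
have de0 : 0 <= d%:R * e by exact: mulr_ge0.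
have -> : (eucl_dist u v <= d%:R * e) = (eucl_dist u v ^+ 2 <= (d%:R * e) ^+ 2).
  by rewrite ler_sqr ?nnegrE ?eucl_ge0.
rewrite eucl_sqr exprMn; apply: (@le_trans _ _ (\sum_(k < d) e ^+ 2)).
  apply: ler_sum => k _; rewrite -[leLHS]real_normK ?num_real//.
  by rewrite ler_sqr ?nnegrE.
rewrite sum_cst_ord ler_wpM2r ?sqr_ge0// expr2 ler_peMr//.
Qed.

Lemma eucl_gt0 (u v : X) : u`_0 != v`_0 -> 0 < eucl_dist u v.
Proof.
move=> uv; have [dp|d0] := ltnP 0 d; last first.
  by move: uv; rewrite !nth_default ?eqxx// size_tuple.
apply: lt_le_trans (eucl_ge u v (Ordinal dp)).
by rewrite normr_gt0 subr_eq0 !(tnth_nth 0).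
Qed.

Let meucl : measurable_fun setT (fun u : X * X => eucl_dist u.1 u.2).
Proof.
apply: measurableT_comp; first exact: continuous_measurable_fun (@sqrt_continuous R).
apply: measurable_sum => k; apply: measurable_funX; apply: measurable_funB.
  by apply: (measurableT_comp (measurable_tnth k)).
by apply: (measurableT_comp (measurable_tnth k)).
Qed.

Definition direction (u v : X) (k : 'I_d) : R := (tnth v k - tnth u k) / eucl_dist u v.

(** [0, 2 (d+1)] is where (x + 1)(d + 1) lies when x is a coordinate of a unit vector. *)
Definition cell (x : R) : 'I_(2 * d.+1).+1 := inord (Num.truncn ((x + 1) * d.+1%:R)).

Lemma cell_close (x y : R) : -1 <= x <= 1 -> -1 <= y <= 1 -> cell x = cell y ->
  `|x - y| * d.+1%:R <= 1.
Proof.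
have q0 : (0 : R) < d.+1%:R by rewrite ltr0n.
have bnd (z : R) : -1 <= z <= 1 -> 0 <= (z + 1) * d.+1%:R /\
    (Num.truncn ((z + 1) * d.+1%:R) < (2 * d.+1).+1)%N.
  move=> /andP[z0 z1]; have z2 : 0 <= (z + 1) * d.+1%:R by rewrite mulr_ge0//; lra.
  split => //; rewrite ltnS -(ler_nat R) natrM.
  have /andP[h _] := truncn_itv z2; apply: le_trans h _.
  by rewrite ler_wpM2r//; lra.
move=> /bnd[x0 xb] /bnd[y0 yb] /(congr1 val); rewrite /cell /= !inordK// => E.
have /andP[a1 a2] := truncn_itv x0; have /andP[b1 b2] := truncn_itv y0.
rewrite -E in b1 b2; rewrite -{1}(gtr0_norm q0) -normrM mulrBl.
move: a1 a2 b1 b2; set c := Num.truncn _; rewrite -[c.+1%:R]natr1 !mulrDl !mul1r.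
move: c%:R (x * _) (y * _) => c' a b *.
by rewrite ler_norml; apply/andP; split; lra.
Qed.

(** The colour of a direction is the cell of the unit cube grid that contains it. *)
Definition eucl_color (u v : X) : {ffun 'I_d -> 'I_(2 * d.+1).+1} :=
  [ffun k => cell (direction u v k)].

Lemma direction_bound u v k : 0 < eucl_dist u v -> -1 <= direction u v k <= 1.
Proof.
move=> p; rewrite -ler_norml /direction normrM (gtr0_norm (_ : 0 < _^-1)) ?invr_gt0//.
by rewrite ler_pdivrMr// mul1r distrC eucl_ge.
Qed.

Lemma direction_unit u v : 0 < eucl_dist u v -> \sum_k direction u v k ^+ 2 = 1.
Proof.
move=> p; under eq_bigr do rewrite /direction expr_div_n.
rewrite -mulr_suml eucl_sym eucl_sqr divff//.
rewrite -eucl_sqr expf_neq0// gt_eqF// eucl_sym//.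
Qed.

(** Unit vectors with equal colour differ by less than 1 in norm, so their inner product is
    larger than 1/2; by the law of cosines the side opposite to u is then shorter than the longer of
    the other two. *)
Lemma eucl_cone (u v w : X) : 0 < eucl_dist u v -> 0 < eucl_dist u w ->
  eucl_color u v = eucl_color u w -> eucl_dist w u <= eucl_dist v u ->
  eucl_dist v w < eucl_dist v u.
Proof.
move=> rp sp E; rewrite ![eucl_dist _ u]eucl_sym.
set r := eucl_dist u v in rp *; set s := eucl_dist u w in sp * => sr.
pose a := direction u v; pose b := direction u w.
(* d coordinates, each differing by at most 1/(d+1). *)
have ab : \sum_k (a k - b k) ^+ 2 < 1.
  have q0 : (0 : R) < d.+1%:R by rewrite ltr0n.
  apply: (@le_lt_trans _ _ (\sum_(k < d) (d.+1%:R^-1) ^+ 2)).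
    apply: ler_sum => k _; rewrite -[leLHS]real_normK ?num_real//.
    rewrite ler_sqr ?nnegrE ?invr_ge0// -[leRHS]mul1r ler_pdivlMr//.
    apply: cell_close; [exact: direction_bound|exact: direction_bound|].
    by have := congr1 (fun f : {ffun _ -> _} => f k) E; rewrite !ffunE.
  rewrite sum_cst_ord exprVn ltr_pdivrMr ?exprn_gt0// mul1r -natrX ltr_nat.
  by rewrite expnS expn1; nia.
have a1 : \sum_k a k ^+ 2 = 1 by exact: direction_unit.
have b1 : \sum_k b k ^+ 2 = 1 by exact: direction_unit.
have dot : 2 * \sum_k a k * b k = 2 - \sum_k (a k - b k) ^+ 2.
  have -> : \sum_k (a k - b k) ^+ 2 = \sum_k a k ^+ 2 + \sum_k b k ^+ 2 - 2 * \sum_k a k * b k.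
    rewrite mulr_sumr -big_split /= -sumrB; apply: eq_bigr => k _; ring.
  by rewrite a1 b1; lra.
have vw : eucl_dist v w ^+ 2 = r ^+ 2 + s ^+ 2 - r * s * (2 * \sum_k a k * b k).
  have -> : r ^+ 2 = \sum_k r ^+ 2 * a k ^+ 2 by rewrite -mulr_sumr a1 mulr1.
  have -> : s ^+ 2 = \sum_k s ^+ 2 * b k ^+ 2 by rewrite -mulr_sumr b1 mulr1.
  rewrite eucl_sqr !mulr_sumr -big_split /= -sumrB.
  apply: eq_bigr => k _.
  have -> : tnth v k - tnth w k = r * a k - s * b k.
    rewrite /a /b /direction -/r -/s; field.
    by rewrite !gt_eqF.
  by ring.
rewrite -ltr_sqr ?nnegrE ?eucl_ge0 ?(ltW rp)// vw dot.
have rs : 0 < r * s by exact: mulr_gt0.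
have ss : s ^+ 2 <= r * s by rewrite expr2 ler_wpM2r// ltW.
have : r * s * \sum_k (a k - b k) ^+ 2 < r * s * 1 by rewrite ltr_pM2l.
move: (\sum_k _) => z; lra.
Qed.

Definition eucl_rule : neighbor_rule R d.
Proof.
refine (@NeighborRule R d (fun _ _ => true) (@eucl_dist R d) _ eucl_color _ _ _ _ _ _).
- exact: measurable_cst.
- exact: meucl.
- move=> u v w uv uw _ _ _; exact: eucl_cone (eucl_gt0 uv) (eucl_gt0 uw).
- by [].
- by move=> u v k _; exact: eucl_ge.
- exact: eucl_le.
Defined.

Lemma nbr_eucl_rule n (x : 'I_n -> X) i :
  nbr eucl_rule [set: 'I_n]%SET x i = nearest_neighbor x i.
Proof.
rewrite /nbr /nb /nearest_neighbor; congr odflt; apply: eq_pick => j /=.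
have cE k : cand (arel eucl_rule x) [set: 'I_n]%SET i k = (k != i).
  by rewrite /cand finset.in_setT /arel /= andbT.
by rewrite cE; congr (_ && _); apply: eq_forallb => k; rewrite cE.
Qed.

End EuclideanRule.

(** * Null events coming from continuity *)

Section Recovery.
Context {dT : measure_display} {T : measurableType dT} {R : realType}.
Variable P : probability T R.
Variables (Y : T -> R) (v : R -> R).
Hypotheses (mY : measurable_fun setT Y) (v_nd : {homo v : a b / a <= b}).
Hypothesis v_flat : forall a b, a <= b -> v a = v b -> P [set w | a < Y w <= b] = 0%E.

Let meas_itv a b : measurable [set w | a < Y w <= b].
Proof.
rewrite (_ : [set w | _] = Y @^-1` `]a, b]%classic).
  by rewrite -[X in measurable X]setTI; exact: mY.
by apply/seteqP; split => w /=; rewrite in_itv.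
Qed.

Let code (r : rat) : exists n, choice.unpickle n = Some r.
Proof. by exists (choice.pickle r); exact: choice.pickleK. Qed.

(** The points beyond q where v has not yet grown form an interval.  Either it has a last
    point, or rational points exhaust it. *)
Lemma flat_negligible q : P.-negligible [set w | q < Y w /\ v (Y w) = v q].
Proof.
pose F (n : nat) : set T := if (choice.unpickle n : option rat) is Some r then
  (if v (ratr r) == v q then [set w | q < Y w <= ratr r] else set0) else set0.
have nF : P.-negligible (\bigcup_n F n).
  apply: negligible_bigcup => n; rewrite /F; case: choice.unpickle => [r|]; last exact: negligible_set0.
  case: eqP => [E|_]; last exact: negligible_set0.
  have [qr|rq] := leP q (ratr r).
    by exists [set w | q < Y w <= ratr r]; split => //; apply: v_flat.
  rewrite (_ : [set w | _] = set0); first exact: negligible_set0.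
  by apply/seteqP; split => // w /= /andP[h1 h2]; have := lt_trans (lt_le_trans h1 h2) rq; rewrite ltxx.
(* First case: the flat piece has a last point b. *)
have [[b [qb vb bmax]]|nomax] := pselect (exists b, [/\ q < b, v b = v q &
    forall y, q < y -> v y = v q -> y <= b]).
  exists [set w | q < Y w <= b]; split => //; first by apply: v_flat; rewrite ?vb// ltW.
  by move=> w /= [qY vY]; rewrite qY bmax.
apply: negligibleS nF => w /= [qY vY].
have [y [qy vy Yy]] : exists y, [/\ q < y, v y = v q & Y w < y].
  apply: contrapT => H; apply: nomax; exists (Y w); split => // y qy vy.
  by rewrite leNgt; apply/negP => Yy; apply: H; exists y.
have [r /andP[h1 h2]] := rat_in_itvoo Yy.
move: h1 h2; rewrite !bnd_simp => h1 h2.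
have [n nE] := code r; exists n => //; rewrite /F nE.
have -> : v (ratr r) = v q.
  by apply/eqP; rewrite eq_le -{1}vy -vY !v_nd// ltW.
by rewrite eqxx /= qY ltW.
Qed.

(** Y is the supremum of the rationals q with v(q) < v(Y), off the flat pieces of v. *)
Lemma recover_from_cdf : measurable_fun setT v ->
  exists2 Q : R -> R, measurable_fun setT Q & {ae P, forall w, Y w = Q (v (Y w))}.
Proof.
move=> mv.
pose g (n : nat) (u : R) : \bar R := if (choice.unpickle n : option rat) is Some r then
  (if v (ratr r) < u then (ratr r : R)%:E else -oo%E) else -oo%E.
have mg n : measurable_fun setT (g n).
  rewrite /g; case: choice.unpickle => [r|]; last exact: measurable_cst.
  apply: measurable_fun_ifT; [|exact: measurable_cst|exact: measurable_cst].
  by apply: measurable_fun_ltr; [exact: measurable_cst|exact: measurable_id].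
exists (fun u => fine (esups (g ^~ u) 0%N)).
  apply: measurableT_comp; first exact: fine_measurable.
  exact: (measurable_fun_esups mg).
pose F (n : nat) : set T := if (choice.unpickle n : option rat) is Some r then
  [set w | ratr r < Y w /\ v (Y w) = v (ratr r)] else set0.
have nF : P.-negligible (\bigcup_n F n).
  apply: negligible_bigcup => n; rewrite /F; case: choice.unpickle => [r|].
    exact: flat_negligible.
  exact: negligible_set0.
apply: negligibleS nF => w /= nE; apply: contrapT => nb; apply: nE.
have good (r : rat) : ratr r < Y w -> v (ratr r) < v (Y w).
  move=> rY; rewrite lt_neqAle v_nd ?andbT; last exact: ltW.
  apply/eqP => E; apply: nb; have [n nE] := code r; exists n => //.
  by rewrite /F nE.
suff -> : esups (g ^~ (v (Y w))) 0%N = (Y w)%:E by [].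
apply/eqP; rewrite eq_le; apply/andP; split.
  apply: ge_ereal_sup => _ [n _ <-]; rewrite /g; case: choice.unpickle => [r|]; last exact: leNye.
  case: ltP => [h|_]; last exact: leNye.
  rewrite lee_fin leNgt; apply/negP => Yr.
  by have := lt_le_trans h (v_nd (ltW Yr)); rewrite ltxx.
apply/lee_addgt0Pr => e e0.
have [r] := @rat_in_itvoo R (Y w - e) (Y w) ltac:(lra).
rewrite in_itv /= => /andP[h1 h2].
apply: (@le_trans _ _ ((ratr r : R)%:E + e%:E)%E).
  by rewrite -EFinD lee_fin; lra.
have [n nE] := code r.
apply: leeD => //; apply: ereal_sup_ubound; exists n => //.
by rewrite /g nE good.
Qed.

End Recovery.

Section Atomless.
Context {dT : measure_display} {T : measurableType dT} {R : realType}.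
Variable P : probability T R.
Context {d : nat}.
Variables (X : T -> d.-tuple R) (Y : T -> R).
Hypotheses (mX : measurable_fun setT X) (mY : measurable_fun setT Y).
Hypothesis Fc : continuous (joint_cdf P X Y).

Let mle (p : 'rV[R]_d * R) : measurable [set w | (forall k : 'I_d, tnth (X w) k <= p.1 ord0 k) /\ Y w <= p.2].
Proof.
rewrite (_ : [set w | _] = (\bigcap_(k in [set: 'I_d]) [set w | tnth (X w) k <= p.1 ord0 k]) `&`
    [set w | Y w <= p.2]); last first.
  by apply/seteqP; split => w /= [h1 h2]; split => // k; [move=> _; exact: h1|exact: h1].
apply: measurableI.
  apply: fin_bigcap_measurable => [|k _]; first exact: finite_finset.
  rewrite (_ : [set w | _] = (fun w => tnth (X w) k) @^-1` `]-oo, p.1 ord0 k]%classic).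
    rewrite -[A in measurable A]setTI.
    by apply: (measurableT_comp (measurable_tnth k) mX).
  by apply/seteqP; split => w /=; rewrite in_itv.
rewrite (_ : [set w | _] = Y @^-1` `]-oo, p.2]%classic).
  by rewrite -[A in measurable A]setTI; exact: mY.
by apply/seteqP; split => w /=; rewrite in_itv.
Qed.

(** Inside a large box, the mass of a hyperplane is at most the jump of the joint distribution
    function across it. *)
Lemma coordinate_atomless (k : 'I_d) c : P [set w | tnth (X w) k = c] = 0%E.
Proof.
have mck : measurable [set w | tnth (X w) k = c].
  rewrite (_ : [set w | _] = (fun w => tnth (X w) k) @^-1` [set c]) //.
  rewrite -[A in measurable A]setTI.
  by apply: (measurableT_comp (measurable_tnth k) mX).
pose row (L s : R) : 'rV[R]_d * R := (\row_j (if j == k then s else L), L).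
pose B (L : nat) := [set w | tnth (X w) k = c] `&`
  [set w | (forall j : 'I_d, tnth (X w) j <= (row L%:R c).1 ord0 j) /\ Y w <= (row L%:R c).2].
have B0 L : P (B L) = 0%E.
  have mB : measurable (B L) by apply: measurableI => //; exact: mle.
  suff : fine (P (B L)) = 0.
    by move=> h; rewrite -[LHS]fineK ?h// fin_num_measure.
  apply/eqP; rewrite eq_le fine_ge0// andbT; apply/ler_addgt0Pl => e e0; rewrite addr0.
  have := @Fc (row L%:R c); move=> /cvgrPdist_le/(_ e e0)/nbhs_ballP[r /= r0 hr].
  have rr : ball (row L%:R c) r (row L%:R (c - r / 2)).
    split => /=; last exact: ballxx.
    split => // i j; rewrite !mxE; case: (j == k); last exact: ballxx.
    rewrite /ball /= (_ : c - (c - r / 2) = r / 2); last by lra.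
    by rewrite gtr0_norm; lra.
  have {rr}:= hr _ rr; rewrite /joint_cdf.
  set A1 := [set w | _]; set A2 := [set w | _] => hA.
  have mA1 : measurable A1 by exact: mle.
  have mA2 : measurable A2 by exact: mle.
  have A21 : A2 `<=` A1.
    move=> w [h1 h2]; split => // j; move: (h1 j); rewrite !mxE; case: (j == k) => //.
    by move=> h; apply: le_trans h _; lra.
  have BA : B L `<=` A1 `\` A2.
    move=> w [E h]; split => // -[h1 _]; move: (h1 k); rewrite mxE eqxx E; lra.
  have h3 : (P (B L) <= P A1 - P A2)%E.
    apply: (@le_trans _ _ (P (A1 `\` A2))); first by apply: le_measure; rewrite ?inE//; exact: measurableD.
    rewrite measureD//; last by rewrite ltey_eq fin_num_measure.
    by rewrite (_ : A1 `&` A2 = A2)//; apply/setIidPr.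
  apply: le_trans hA; rewrite -lee_fin fineK ?fin_num_measure//.
  apply: le_trans h3 _; rewrite -(fineK (fin_num_measure P A1 mA1)) -(fineK (fin_num_measure P A2 mA2)).
  by rewrite -EFinB lee_fin ler_norm.
apply/eqP; rewrite eq_le measure_ge0 andbT.
have U : [set w | tnth (X w) k = c] `<=` \bigcup_L B L.
  move=> w E; pose b := `|Y w| + \sum_j `|tnth (X w) j|.
  have b0 : 0 <= b by rewrite addr_ge0// sumr_ge0.
  have bj j : `|tnth (X w) j| <= b.
    by rewrite /b (bigD1 j)//= addrCA lerDl addr_ge0// sumr_ge0.
  have bY : `|Y w| <= b by rewrite /b lerDl sumr_ge0.
  have /andP[_ /ltW bL] := truncn_itv b0.
  exists (Num.truncn b).+1 => //; split => //; split => [j|] /=.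
    rewrite mxE; case: eqP => [->|_]; first by rewrite E.
    exact: le_trans (ler_norm _) (le_trans (bj j) bL).
  exact: le_trans (ler_norm _) (le_trans bY bL).
have : P.-negligible (\bigcup_L B L).
  apply: negligible_bigcup => L; exists (B L); split; [|exact: B0|by []].
  by apply: measurableI => //; exact: mle.
move=> /(negligibleS U)/negligibleP => H; by rewrite H.
Qed.

End Atomless.

Section NoTies.
Context {dT : measure_display} {T : measurableType dT} {R : realType}.
Variable P : probability T R.
Context {d : nat}.
Local Notation S := (d.-tuple R * R)%type.
Variables (Z : nat -> T -> S) (Z0 : T -> S).
Hypothesis mZ : forall i, measurable_fun setT (Z i).
Hypothesis mZ0 : measurable_fun setT Z0.
Hypothesis copies : forall i, identically_distributed P (Z i) Z0.
Hypothesis indep : mutually_independent P Z.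
Hypothesis atomless : forall (k : 'I_d) c, P [set w | tnth (Z0 w).1 k = c] = 0%E.
Hypothesis d0 : (0 < d)%N.

Let k0 := Ordinal d0.

(** Resampling one of the two points, a tie is an atom of its first coordinate. *)
Lemma no_ties n : {ae P, forall w, sep (sample Z n w)}.
Proof.
pose tie i j (z : n.-tuple S) := tnth (tnth z i).1 k0 == tnth (tnth z j).1 k0.
have mco i : measurable_fun setT (fun z : n.-tuple S => tnth (tnth z i).1 k0).
  by apply: (measurableT_comp (measurable_tnth k0)); exact: measurable_xs.
have mtie i j : measurable_fun setT (tie i j) by exact: measurable_fun_eqr.
have pair i j : {ae P, forall w, i != j -> ~~ tie i j (sample Z n w)}.
  have [->|ij] := eqVneq i j; first by apply/aeW.
  have E0 : En P Z (fun z => (tie i j z)%:R) = 0 :> R.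
    apply: (En_eq0 mZ mZ0 copies indep (j := j)); first exact: bmf_bool.
    move=> z; rewrite -(Ex_cst P 0); apply: Ex_ae_eq.
    - apply: bmf_bool; apply: (measurableT_comp (mtie i j)).
      apply: measurable_upd mZ0; exact: measurable_cst.
    - exact: bmf_cst.
    have : P.-negligible [set w | tnth (Z0 w).1 k0 = tnth (tnth z i).1 k0].
      exists [set w | tnth (Z0 w).1 k0 = tnth (tnth z i).1 k0]; split; [|exact: atomless|by []].
      rewrite (_ : [set w | _] = (fun w => tnth (Z0 w).1 k0) @^-1` [set tnth (tnth z i).1 k0])//.
      rewrite -[A in measurable A]setTI.
      by apply: (measurable_coord mZ0 k0).
    apply: negligibleS => w /= H; apply: contrapT => ne; apply: H.
    rewrite /tie !tnth_upd eqxx (negbTE ij); case: eqP => // E; case: ne.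
    by rewrite E.
  pose E := [set w | tie i j (sample Z n w)].
  have mE : measurable E.
    have := measurableT_comp (mtie i j) (measurable_sample (n := n) mZ).
    have mt : measurable [set true] by [].
    by move=> /(_ measurableT _ mt); rewrite setTI.
  have PE : P E = 0%E.
    rewrite -[LHS]fineK ?fin_num_measure// -Ex_indic//; congr EFin; rewrite -[RHS]E0.
    apply: Ex_ext => w; rewrite indicE; congr (_%:R); congr nat_of_bool.
    by apply/idP/idP => [/set_mem//|h]; exact/mem_set.
  exists E; split => // w /= H; apply: contrapT => nE; apply: H => _; exact/negP.
have all : {ae P, forall w i j, i != j -> ~~ tie i j (sample Z n w)}.
  by apply: filter_forall => i; apply: filter_forall => j; exact: pair.
apply: filterS all => w H i j ij; have := H i j ij.
by rewrite /tie /xs !(tnth_nth 0).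
Qed.

End NoTies.

(** * Versions of a conditional probability *)

Section ConditionalProbability.
Context {dT : measure_display} {T : measurableType dT} {R : realType}.
Variable P : probability T R.
Context {dU : measure_display} {U : measurableType dU}.
Variable X : T -> U.
Hypothesis mX : measurable_fun setT X.

Lemma cond_prob_measurable A g : is_cond_prob P X A g -> measurable_fun setT g.
Proof. by move=> [_ /measurable_int/measurable_EFinP]. Qed.

Let level_set (A B : set T) g g' : is_cond_prob P X A g -> is_cond_prob P X B g' ->
  exists2 C, measurable C & [set w | g' w < g w] = X @^-1` C.
Proof.
move=> [sg _ _] [sg' _ _].
have H1 (r : rat) : exists C, measurable C /\ forall w, C (X w) <-> g' w < ratr r.
  have [C mC CE] := sg' `]-oo, ratr r[%classic (measurable_itv _).
  exists C; split => // w; rewrite setTI in CE.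
  have -> : C (X w) = (X @^-1` C) w by [].
  by rewrite CE /= in_itv.
have H2 (r : rat) : exists C, measurable C /\ forall w, C (X w) <-> ratr r < g w.
  have [C mC CE] := sg `]ratr r, +oo[%classic (measurable_itv _).
  exists C; split => // w; rewrite setTI in CE.
  have -> : C (X w) = (X @^-1` C) w by [].
  by rewrite CE /= in_itv /= andbT.
have [C1 C1P] := choice H1; have [C2 C2P] := choice H2.
pose F n := if (choice.unpickle n : option rat) is Some r then C1 r `&` C2 r else set0.
exists (\bigcup_n F n).
  apply: bigcupT_measurable => n; rewrite /F; case: choice.unpickle => [r|] //.
  by apply: measurableI; [case: (C1P r)|case: (C2P r)].
apply/seteqP; split => w /=.
  move=> /rat_in_itvoo[r]; rewrite in_itv /= => /andP[h1 h2].
  have [n nE] : exists n, choice.unpickle n = Some r.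
    by exists (choice.pickle r); exact: choice.pickleK.
  exists n => //; rewrite /F nE; split.
    by have [_ /(_ w)[_ H]] := C1P r; exact: H.
  by have [_ /(_ w)[_ H]] := C2P r; exact: H.
move=> [n _]; rewrite /F; case: choice.unpickle => [r|//] [a1 a2].
have [_ /(_ w)[H _]] := C1P r; have [_ /(_ w)[H' _]] := C2P r.
exact: lt_trans (H a1) (H' a2).
Qed.

(** The event where g exceeds its bound is an event of sigma(X), so both versions can be
    integrated over it. *)
Lemma cond_prob_le (A B : set T) g g' : measurable A -> measurable B -> A `<=` B ->
  is_cond_prob P X A g -> is_cond_prob P X B g' -> {ae P, forall w, g w <= g' w}.
Proof.
move=> mA mB AB cg cg'; have [C mC CE] := level_set cg cg'.
have mE : measurable (X @^-1` C) by rewrite -[Y in measurable Y]setTI; exact: mX.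
have [_ ig Ig] := cg; have [_ ig' Ig'] := cg'.
have iE : P.-integrable (X @^-1` C) (EFin \o g) by exact: integrableS ig.
have iE' : P.-integrable (X @^-1` C) (EFin \o g') by exact: integrableS ig'.
have posE w : (X @^-1` C) w -> g' w < g w by rewrite -CE.
have I0 : (\int[P]_(w in X @^-1` C) `|(g w - g' w)%:E|)%E = 0%E.
  rewrite (eq_integral (fun w => (g w)%:E - (g' w)%:E)%E); last first.
    move=> w /set_mem /posE h; rewrite -EFinB /= ger0_norm// subr_ge0; exact: ltW.
  apply/eqP; rewrite eq_le; apply/andP; split; last first.
    by apply: integral_ge0 => w /posE h; rewrite -EFinB lee_fin subr_ge0 ltW.
  rewrite integralB_EFin// Ig// Ig'//.
  rewrite sube_le0; apply: le_measure; rewrite ?inE; try exact: measurableI.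
  by move=> w [Aw Cw]; split => //; exact: AB.
have md : measurable_fun (X @^-1` C) (fun w => (g w - g' w)%:E).
  apply: measurable_funTS; apply/measurable_EFinP; apply: measurable_funB.
  - exact: cond_prob_measurable cg.
  - exact: cond_prob_measurable cg'.
have /ae_eq_integral_abs H := I0; have {H}H := H mE md.
apply: filterS H => w H; rewrite leNgt; apply/negP => gg.
have Cw : (X @^-1` C) w by rewrite -CE.
have /= [E] := H Cw; move: gg; rewrite -subr_gt0 E ltxx//.
Qed.

Lemma cond_prob_cst (b : bool) : is_cond_prob P X (if b then setT else set0) (fun=> b%:R).
Proof.
split.
- move=> B mB; have [h|h] := pselect (B b%:R).
    exists setT => //; rewrite setTI preimage_setT.
    by apply/seteqP; split.
  exists set0 => //; rewrite setTI preimage_set0.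
  by apply/seteqP; split.
- exact: bmf_integrable (bmf_cst _).
- move=> C mC; have mE : measurable (X @^-1` C) by rewrite -[Y in measurable Y]setTI; exact: mX.
  rewrite integral_cst//; case: b => /=; first by rewrite mul1e setTI.
  by rewrite mul0e set0I measure0.
Qed.

Lemma cond_prob01 A g : measurable A -> is_cond_prob P X A g ->
  {ae P, forall w, 0 <= g w <= 1}.
Proof.
move=> mA cg.
have l := @cond_prob_le set0 A (fun=> 0) g measurable0 mA (@sub0set _ _) (cond_prob_cst false) cg.
have u := @cond_prob_le A setT g (fun=> 1) mA measurableT (@subsetT _ _) cg (cond_prob_cst true).
by apply: filterS2 l u => w -> ->.
Qed.

Variables (Y : T -> R) (G : R -> T -> R).
Hypothesis mY : measurable_fun setT Y.
Hypothesis GP : forall t, is_cond_prob P X [set w | t <= Y w] (G t).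

Let mYt t : measurable [set w | t <= Y w].
Proof.
rewrite (_ : [set w | _] = Y @^-1` `[t, +oo[%classic).
  by rewrite -[A in measurable A]setTI; exact: mY.
by apply/seteqP; split => w /=; rewrite in_itv /= andbT.
Qed.

(** The function h of the statistic.  It is measurable because it is nonincreasing: t >= s makes
    G t at most G s almost surely. *)
Definition tail_energy t := fine ('E_P[fun u => (G t u ^+ 2)%R])%E.

Let tE t : ('E_P[fun u => (G t u ^+ 2)%R])%E = (\int[P]_w (G t w ^+ 2)%:E)%E.
Proof. by rewrite unlock. Qed.

Let mG2 t : measurable_fun setT (fun w => (G t w ^+ 2)%:E).
Proof. by apply/measurable_EFinP; apply: measurable_funX; exact: cond_prob_measurable (GP t). Qed.

Let G2ge0 t : (0 <= \int[P]_w (G t w ^+ 2)%:E)%E.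
Proof. by apply: integral_ge0 => w _; rewrite lee_fin sqr_ge0. Qed.

Let G2le1 t : (\int[P]_w (G t w ^+ 2)%:E <= 1)%E.
Proof.
have -> : 1%E = (\int[P]_w (1%R)%:E)%E :> \bar R.
  by rewrite integral_cst// mul1e; apply/esym; exact: probability_setT.
apply: ae_ge0_le_integral => //; try by move=> w _; rewrite lee_fin ?sqr_ge0 ?ler01.
apply: filterS (cond_prob01 (mYt t) (GP t)) => w /andP[h0 h1] _.
by rewrite lee_fin expr_le1.
Qed.

Let finG t : (\int[P]_w (G t w ^+ 2)%:E)%E \is a fin_num.
Proof. by rewrite ge0_fin_numE//; exact: le_lt_trans (G2le1 t) (ltry 1). Qed.

Lemma tail_energy01 t : 0 <= tail_energy t <= 1.
Proof.
rewrite /tail_energy tE fine_ge0//=.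
by rewrite -lee_fin fineK.
Qed.

Lemma measurable_tail_energy : measurable_fun setT tail_energy.
Proof.
apply: nonincreasing_measurable => // s t st; rewrite /tail_energy !tE fine_le//.
apply: ae_ge0_le_integral => //; try by move=> w _; rewrite lee_fin sqr_ge0.
have sub : [set w | t <= Y w] `<=` [set w | s <= Y w] by move=> w /=; exact: le_trans.
have l := cond_prob_le (mYt t) (mYt s) sub (GP t) (GP s).
apply: filterS2 l (cond_prob01 (mYt t) (GP t)) => w h /andP[h0 _] _.
by rewrite lee_fin ler_sqr ?nnegrE// (le_trans h0).
Qed.

End ConditionalProbability.

(** * The central limit theorem *)

Section StandardizedStatistic.
Context {dT : measure_display} {T : measurableType dT} {R : realType}.
Variable P : probability T R.
Context {d : nat}.
Hypothesis d_gt0 : (0 < d)%N.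
Variables (X : {RV P >-> d.-tuple R}) (Y : {RV P >-> R}).
Hypothesis F_continuous : continuous (joint_cdf P X Y).
Hypothesis Y_not_function_of_X : ~ is_ae_measurable_function_of P Y X.
Variables (Xs : nat -> {RV P >-> d.-tuple R}) (Ys : nat -> {RV P >-> R}).
Hypothesis copies : forall i : nat, identically_distributed P
  (fun w => (Xs i w, Ys i w)) (fun w => (X w, Y w)).
Hypothesis indep : mutually_independent P (fun (i : nat) (w : T) => (Xs i w, Ys i w)).
Variable G : R -> T -> R.
Hypothesis GP : forall t : R, is_cond_prob P X [set w | t <= Y w] (G t).

Local Notation S := (d.-tuple R * R)%type.
Let Z (i : nat) (w : T) : S := (Xs i w, Ys i w).
Let Z0 (w : T) : S := (X w, Y w).
Let v (y : R) : R := fine (cdf Y y).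
Let h : R -> R := tail_energy P G.

Let mX : measurable_fun setT X. Proof. exact: measurable_funPT. Qed.
Let mY : measurable_fun setT Y. Proof. exact: measurable_funPT. Qed.
Let mZ i : measurable_fun setT (Z i).
Proof. by apply: measurable_fun_pair; exact: measurable_funPT. Qed.
Let mZ0 : measurable_fun setT Z0.
Proof. by apply: measurable_fun_pair; exact: measurable_funPT. Qed.

Let cfin y : cdf Y y \is a fin_num. Proof. exact: fin_num_measure. Qed.

Let v01 y : 0 <= v y <= 1.
Proof. by rewrite /v fine_ge0 ?cdf_ge0//= -lee_fin fineK// cdf_le1. Qed.

Let v_nd : {homo v : a b / a <= b}.
Proof. by move=> a b ab; rewrite /v fine_le// cdf_nondecreasing. Qed.

Let mv : measurable_fun setT v.
Proof. exact: nondecreasing_measurable. Qed.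

Let h01 y : 0 <= h y <= 1.
Proof. exact: (tail_energy01 mX mY GP). Qed.
Let mh : measurable_fun setT h.
Proof. exact: (measurable_tail_energy mX mY GP). Qed.

Let atomless (k : 'I_d) c : P [set w | tnth (Z0 w).1 k = c] = 0%E.
Proof. exact: (coordinate_atomless mX mY F_continuous). Qed.

Let sep_ae n : {ae P, forall w, sep (sample Z n w)}.
Proof. exact: (no_ties mZ mZ0 copies indep atomless d_gt0). Qed.

Let v_flat a b : a <= b -> v a = v b -> P [set w | a < Y w <= b] = 0%E.
Proof.
move=> ab E.
have mle c : measurable (Y @^-1` `]-oo, c]%classic).
  by rewrite -[A in measurable A]setTI; exact: mY.
have -> : [set w | a < Y w <= b] = Y @^-1` `]-oo, b]%classic `\` Y @^-1` `]-oo, a]%classic.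
  apply/seteqP; split => w /=; rewrite !in_itv /=.
    by move=> /andP[aY ->]; split => //; apply/negP; rewrite -ltNge.
  by move=> [-> /negP]; rewrite -ltNge => ->.
rewrite measureD//; last by rewrite ltey_eq fin_num_measure.
rewrite (_ : _ `&` _ = Y @^-1` `]-oo, a]%classic); last first.
  by apply/setIidPr => w /=; rewrite !in_itv /= => /le_trans; apply.
have Eab : P (Y @^-1` `]-oo, b]%classic) = P (Y @^-1` `]-oo, a]%classic).
  by rewrite -[LHS](fineK (cfin b)) -[RHS](fineK (cfin a)); congr EFin.
rewrite -[LHS]/(P (Y @^-1` `]-oo, b]%classic) - P (Y @^-1` `]-oo, a]%classic))%E.
by rewrite Eab subee// fin_num_measure.
Qed.

(** If the residual vanished, F(Y) would be a function of X, and so would Y. *)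
Lemma residual_pos reg : cexp_of P (fun w => (Z0 w).1) (fun w => v (Z0 w).2) reg ->
  0 < Ex P (fun w => res v reg (Z0 w) ^+ 2).
Proof.
move=> [breg _]; have bv0 : bmf (fun w => v (Y w)).
  exact: (bmf_comp (f := fun s : S => v s.2) (bmf_v mv v01) mZ0).
have br0 : bmf (fun w => reg (X w)) by exact: bmf_comp breg mX.
rewrite lt_neqAle Ex_ge0 ?andbT; last by move=> w; exact: sqr_ge0.
apply/eqP => E; apply: Y_not_function_of_X.
have [Q mQ YQ] := recover_from_cdf mY v_nd v_flat mv.
exists (fun x => Q (reg x)); first by apply: measurableT_comp => //; exact: breg.1.
have bres2 : bmf (fun w => res v reg (Z0 w) ^+ 2) by apply: bmfX; exact: bmfB.
have I0 : (\int[P]_(w in setT) `|(res v reg (Z0 w) ^+ 2)%:E|)%E = 0%E.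
  rewrite -[RHS]/((0 : R)%:E) E EFin_Ex//; apply: eq_integral => w _.
  by rewrite /= ger0_norm// sqr_ge0.
have mres : measurable_fun setT (fun w => (res v reg (Z0 w) ^+ 2)%:E).
  by apply/measurable_EFinP; exact: bres2.1.
have H : ae_eq P setT (fun w => (res v reg (Z0 w) ^+ 2)%:E) (cst 0%E).
  by apply/(ae_eq_integral_abs P measurableT mres).
apply: filterS2 YQ H => w -> /(_ I) /= [/eqP].
by rewrite sqrf_eq0 subr_eq0 => /eqP /= ->.
Qed.

Variable rho : neighbor_rule R d.
Variable nbhd : forall n : nat, ('I_n -> d.-tuple R) -> 'I_n -> 'I_n.
Hypothesis nbhdE : forall n (x : 'I_n -> d.-tuple R) i,
  nbhd x i = nbr rho [set: 'I_n]%SET x i.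

Let St n w := stat rho v h (sample Z n w).
Let bSt n : bmf (St n).
Proof. by apply: (bmf_sample mZ (Phi := @stat _ _ rho v h n)); exact: bmf_stat. Qed.

Let coef n : R := (6 * n%:R) / (n%:R ^+ 2 - 1).

Let xiE n w : xi_star nbhd Y G Xs Ys n w = coef n * St n w.
Proof.
rewrite /xi_star /coef /St /stat; congr (_ * (_ + _)).
  apply: eq_bigr => i _; rewrite /nn nbhdE !tnth_mktuple.
  suff -> : xs (sample Z n w) = (fun i0 => Xs i0 w) by [].
  by apply/funext => j; rewrite /xs tnth_mktuple.
by apply: eq_bigr => i _; rewrite tnth_mktuple.
Qed.

Let expE (f : T -> R) : bmf f -> fine ('E_P[f])%E = Ex P f.
Proof. by move=> bf; rewrite unlock. Qed.

Let varE (f : T -> R) : bmf f -> fine ('V_P[f])%E = Var P f.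
Proof.
move=> bf; rewrite /variance covariance.unlock (expE bf) expE; last first.
  by apply: bmfM; apply: bmfB => //; exact: bmf_cst.
by apply: Ex_ext => w; rewrite expr2.
Qed.

Let bxi n : bmf (xi_star nbhd Y G Xs Ys n).
Proof.
rewrite (_ : xi_star _ _ _ _ _ _ = fun w => coef n * St n w); last exact/funext/xiE.
by apply: bmfM; [exact: bmf_cst|exact: bSt].
Qed.

Let standardizeE n w : (2 <= n)%N ->
  standardize P (xi_star nbhd Y G Xs Ys n) w =
  (St n w - Ex P (St n)) / Num.sqrt (Var P (St n)).
Proof.
move=> n2; have c0 : 0 < coef n.
  have n2' : (2 : R) <= n%:R by rewrite ler_nat.
  rewrite divr_gt0//; first by rewrite mulr_gt0//; lra.
  by rewrite subr_gt0 expr_gt1//; lra.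
have xE : xi_star nbhd Y G Xs Ys n = fun w => coef n * St n w by exact/funext/xiE.
rewrite /standardize (expE (bxi n)) (varE (bxi n)) xE ExZ; last exact: bSt.
have -> : Var P (fun w => coef n * St n w) = coef n ^+ 2 * Var P (St n).
  rewrite /Var -ExZ; last first.
    by apply: bmfX; apply: bmfB; [exact: bSt|exact: bmf_cst].
  by apply: Ex_ext => u; rewrite ExZ; [ring|exact: bSt].
move: (Ex P _) (Var P _) (St n w) => a b x.
rewrite sqrtrM ?sqr_ge0// sqrtr_sqr gtr0_norm// -mulrBr -mulf_div divff ?mul1r//.
by rewrite gt_eqF.
Qed.

(** The argument is the same for every neighbour rule; it is applied to the Euclidean rule and
    to the right neighbour on the line. *)
Theorem standardized_clt : cvg_in_distribution P
  (fun n => standardize P (xi_star nbhd Y G Xs Ys n)) (normal_prob (0 : R) 1).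
Proof.
have bv0 : bmf (fun w => v (Z0 w).2).
  exact: (bmf_comp (f := fun s : S => v s.2) (bmf_v mv v01) mZ0).
have mX0 : measurable_fun setT (fun w => (Z0 w).1) by exact: mX.
have [reg regP reg01] := cexp_exists01 P mX0 bv0 (fun w => v01 (Z0 w).2).
have rpos := residual_pos regP.
apply: cvg_of_tests => [n|g Lg A g01 Lg0 gL gl gr e e0].
  apply: measurable_funM; last exact: measurable_cst.
  by apply: measurable_funB; [exact: (bxi n).1|exact: measurable_cst].
have [n0 n0P] := clt_test mZ mZ0 copies indep rho sep_ae atomless mv mh v01 h01
  regP reg01 rpos g01 Lg0 gL gl gr e0.
exists (maxn n0 2) => n; rewrite geq_max => /andP[/n0P H n2].
have E w : g (standardize P (xi_star nbhd Y G Xs Ys n) w) = g (std P Z rho v h n w).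
  by rewrite standardizeE.
by rewrite (Ex_ext P E).
Qed.

End StandardizedStatistic.

Theorem theorem1p4 (dT : measure_display) (T : measurableType dT)
    (R : realType) (P : probability T R) (d : nat) (d_gt0 : (0 < d)%N)
    (X : {RV P >-> d.-tuple R}) (Y : {RV P >-> R})
    (F_continuous : continuous (joint_cdf P X Y))
    (Y_not_function_of_X : ~ is_ae_measurable_function_of P Y X)
    (Xs : nat -> {RV P >-> d.-tuple R}) (Ys : nat -> {RV P >-> R})
    (copies : forall i : nat, identically_distributed P
       (fun w => (Xs i w, Ys i w)) (fun w => (X w, Y w)))
    (copies_independent : mutually_independent P
       (fun (i : nat) (w : T) => (Xs i w, Ys i w)))
    (G : R -> T -> R)
    (G_cond_prob : forall t : R,
       is_cond_prob P X [set w | t <= Y w] (G t)) :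
  cvg_in_distribution P
    (fun n => standardize P
       (xi_star (@nearest_neighbor R d) Y G Xs Ys n))
    (normal_prob (0 : R) 1)
  /\
  (d = 1%N ->
   cvg_in_distribution P
     (fun n => standardize P
        (xi_star (@right_nearest_neighbor R d) Y G Xs Ys n))
     (normal_prob (0 : R) 1)).
Proof.
split.
  apply: (standardized_clt d_gt0 F_continuous Y_not_function_of_X copies
    copies_independent G_cond_prob (rho := eucl_rule)) => n x i.
  by rewrite nbr_eucl_rule.
move=> d1; move: d_gt0 X F_continuous Y_not_function_of_X Xs copies copies_independent G_cond_prob.
rewrite d1 => d_gt0' X' Fc nf Xs' cp ind GP.
apply: (standardized_clt d_gt0' Fc nf cp ind GP (rho := right_rule)) => n x i.
by rewrite nbr_right_rule.
Qed.
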